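(* Let $(M^m,g,J)$ be a (connected) Kähler manifold of complex dimension $m\geq 2$. (1) If $M$ has $\alpha$-nonnegative (respectively, $\alpha$-nonpositive) curvature operator of the second kind for some $\alpha<\frac{3}{2}(m^2-1)$, then $M$ is flat. (2) If $M$ has $\frac{3}{2}(m^2-1)$-nonnegative (respectively, $\frac{3}{2}(m^2-1)$-nonpositive) curvature operator of the second kind, then $M$ has constant nonnegative (respectively, nonpositive) holomorphic sectional curvature.
   Context: Sign convention: the Riemann curvature tensor $R$ is normalized so that $R(X,Y,X,Y)$ is the sectional curvature of the plane spanned by orthonormal $X,Y$ (positive on round spheres). For a Riemannian manifold $(M^n,g)$ and $p\in M$, let $S^2_0(T_pM)$ be the space of traceless symmetric two-tensors on $T_pM$ with inner product $\langle A,B\rangle=\operatorname{tr}(A^TB)$, and let $N=\dim S^2_0(T_pM)=\frac{(n-1)(n+2)}{2}$. The curvature operator of the second kind is the symmetric bilinear form on $S^2_0(T_pM)$ given in an orthonormal basis by $\mathring{R}(\varphi,\psi)=\sum_{i,j,k,l=1}^n R_{ijkl}\varphi_{il}\psi_{jk}$. For a real number $\alpha\in[1,N]$, $(M,g)$ has $\alpha$-nonnegative (respectively, $\alpha$-positive) curvature operator of the second kind if for every $p\in M$ and every orthonormal basis $\{\varphi_i\}_{i=1}^N$ of $S^2_0(T_pM)$, $$\sum_{i=1}^{\lfloor\alpha\rfloor}\mathring{R}(\varphi_i,\varphi_i)+(\alpha-\lfloor\alpha\rfloor)\mathring{R}(\varphi_{\lfloor\alpha\rfloor+1},\varphi_{\lfloor\alpha\rfloor+1})\geq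 0\quad(\text{respectively, }>0),$$ where the last term is absent when $\alpha$ is an integer. It has $\alpha$-nonpositive (respectively, $\alpha$-negative) curvature operator of the second kind if the reversed inequality $\le 0$ (respectively, $<0$) always holds. A Kähler manifold of complex dimension $m$ has real dimension $n=2m$. The holomorphic sectional curvature of a unit tangent vector $X$ is $R(X,JX,X,JX)$; it is constant if it takes the same value for all unit tangent vectors at all points. Completeness is not assumed. *)

(* Defs.v *)
From HB Require Import structures.
From mathcomp Require Import all_boot all_order all_algebra.
From mathcomp Require Import boolp classical_sets functions reals.
From mathcomp Require Import topology normedtype derive.

Set Implicit Arguments.
Unset Strict Implicit.
Unset Printing Implicit Defensive.

Import Order.TTheory GRing.Theory Num.Theory.
Import numFieldNormedType.Exports.

Local Open Scope classical_set_scope.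
Local Open Scope ring_scope.

(* Tangent vectors are written in coordinates as row vectors, and linear maps *)
(* act on them from the right.                                                *)

Section Smooth.
Context {R : realType} {n : nat}.

Definition partial (i : 'I_n) (f : 'rV[R]_n -> R) : 'rV[R]_n -> R :=
  fun x => 'D_(delta_mx ord0 i) f x.

(* C^oo on an open set U; continuity of the iterated partial derivatives      *)
(* follows from their differentiability.                                      *)
Definition smooth_on (U : set 'rV[R]_n) (f : 'rV[R]_n -> R) : Prop :=
  forall (s : seq 'I_n) (x : 'rV[R]_n), U x ->
    differentiable (foldr partial f s) x.

End Smooth.

(* [chart_inv] is only meaningful on the image of [chart_dom].                *)
Record chart (R : realType) (n : nat) (M : topologicalType) := Chart {
  chart_dom : set M;
  chart_map : M -> 'rV[R]_n;
  chart_inv : 'rV[R]_n -> M;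
  chart_dom_open : open chart_dom;
  chart_img_open : open (chart_map @` chart_dom);
  chart_mapK : forall p, chart_dom p -> chart_inv (chart_map p) = p;
  chart_map_cont : forall p, chart_dom p -> {for p, continuous chart_map};
  chart_inv_cont : forall x, (chart_map @` chart_dom) x ->
    {for x, continuous chart_inv} }.

Definition transition (R : realType) (n : nat) (M : topologicalType)
    (a b : chart R n M) : 'rV[R]_n -> 'rV[R]_n :=
  fun x => chart_map b (chart_inv a x).

Record manifold (R : realType) (n : nat) := Manifold {
  man_space :> topologicalType;
  man_hausdorff : hausdorff_space man_space;
  man_second_countable : @second_countable man_space;
  man_index : Type;
  man_chart : man_index -> chart R n man_space;
  man_cover : forall p : man_space, exists a, chart_dom (man_chart a) p;
  man_smooth : forall (a b : man_index) (k : 'I_n),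
    smooth_on
      (chart_map (man_chart a) @`
        (chart_dom (man_chart a) `&` chart_dom (man_chart b)))
      (fun x => transition (man_chart a) (man_chart b) x ord0 k) }.

(* A tensor field of rank 2 is given by its matrix of components in every     *)
(* chart, smooth and obeying the tensor transformation law.                   *)
Record riemannian_metric (R : realType) (n : nat) (M : manifold R n) :=
  RiemannianMetric {
  metric_mx : man_index M -> 'rV[R]_n -> 'M[R]_n;
  metric_smooth : forall a i j,
    smooth_on (chart_map (man_chart a) @` chart_dom (man_chart a))
      (fun x => metric_mx a x i j);
  metric_sym : forall a p, chart_dom (man_chart a) p ->
    (metric_mx a (chart_map (man_chart a) p))^T =
    metric_mx a (chart_map (man_chart a) p);
  metric_pos : forall a p (v : 'rV[R]_n), chart_dom (man_chart a) p ->
    v != 0 ->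
    0 < (v *m metric_mx a (chart_map (man_chart a) p) *m v^T) ord0 ord0;
  metric_change : forall a b p,
    chart_dom (man_chart a) p -> chart_dom (man_chart b) p ->
    let x := chart_map (man_chart a) p in
    let y := chart_map (man_chart b) p in
    let D := 'J (transition (man_chart a) (man_chart b)) x in
    metric_mx a x = D *m metric_mx b y *m D^T }.

Record almost_complex_structure (R : realType) (n : nat) (M : manifold R n) :=
  AlmostComplexStructure {
  acs_mx : man_index M -> 'rV[R]_n -> 'M[R]_n;
  acs_smooth : forall a i j,
    smooth_on (chart_map (man_chart a) @` chart_dom (man_chart a))
      (fun x => acs_mx a x i j);
  acs_sqr : forall a p, chart_dom (man_chart a) p ->
    acs_mx a (chart_map (man_chart a) p) *m
    acs_mx a (chart_map (man_chart a) p) = - 1%:M;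
  acs_change : forall a b p,
    chart_dom (man_chart a) p -> chart_dom (man_chart b) p ->
    let x := chart_map (man_chart a) p in
    let y := chart_map (man_chart b) p in
    let D := 'J (transition (man_chart a) (man_chart b)) x in
    acs_mx a x *m D = D *m acs_mx b y }.

Section LocalGeometry.
Context {R : realType} {n : nat}.
Variable g : 'rV[R]_n -> 'M[R]_n.

(* Gamma^k_{ij} of the Levi-Civita connection                                 *)
Definition christoffel (k i j : 'I_n) (x : 'rV[R]_n) : R :=
  2^-1 * \sum_l invmx (g x) k l *
    (partial i (fun y => g y j l) x + partial j (fun y => g y i l) x
     - partial l (fun y => g y i j) x).

(* (nabla_l J)_i^k, where J(d_i) = sum_k J_i^k d_k                            *)
Definition cov_deriv_endo (J : 'rV[R]_n -> 'M[R]_n) (l i k : 'I_n)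
    (x : 'rV[R]_n) : R :=
  partial l (fun y => J y i k) x
  + \sum_p (christoffel k l p x * J x i p - christoffel p l i x * J x p k).

(* R_{ijkl} = <nabla_i nabla_j d_l - nabla_j nabla_i d_l, d_k>, so that       *)
(* R(X,Y,X,Y) is the sectional curvature of an orthonormal pair X, Y.         *)
Definition riemann_coef (i j k l : 'I_n) (x : 'rV[R]_n) : R :=
  \sum_p g x k p *
    (partial i (christoffel p j l) x - partial j (christoffel p i l) x
     + \sum_q (christoffel p i q x * christoffel q j l x
               - christoffel p j q x * christoffel q i l x)).

Definition riemann (x X Y Z W : 'rV[R]_n) : R :=
  \sum_i \sum_j \sum_k \sum_l
    riemann_coef i j k l x *
    X ord0 i * Y ord0 j * Z ord0 k * W ord0 l.

(* the rows of E are the vectors of the frame                                 *)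
Definition orthonormal_frame (x : 'rV[R]_n) (E : 'M[R]_n) : Prop :=
  E *m g x *m E^T = 1%:M.

Definition second_kind (x : 'rV[R]_n) (E phi psi : 'M[R]_n) : R :=
  \sum_i \sum_j \sum_k \sum_l
    riemann x (row i E) (row j E) (row k E) (row l E) * phi i l * psi j k.

End LocalGeometry.

Section TracelessSymmetric.
Context {R : realType} {n : nat}.

Definition S20 (A : 'M[R]_n) : Prop := A^T = A /\ \tr A = 0.

Definition dimS20 : nat := ((n - 1) * (n + 2) %/ 2)%N.

Definition orthonormal_basisS20 (phi : 'I_dimS20 -> 'M[R]_n) : Prop :=
  [/\ forall i, S20 (phi i),
      forall i j, \tr ((phi i)^T *m phi j) = (i == j)%:R &
      forall A, S20 A -> exists c : 'I_dimS20 -> R,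
        A = \sum_i c i *: phi i].

End TracelessSymmetric.
Arguments dimS20 n : clear implicits.

(* The last sum has at most one term, and none when alpha = N.                *)
Definition alpha_sum (R : realType) (N : nat) (alpha : R) (u : 'I_N -> R) : R :=
  let k := Num.truncn alpha in
  \sum_(i < N | (i < k)%N) u i
  + (alpha - k%:R) * \sum_(i < N | i == k :> nat) u i.

Section CurvatureOperatorSecondKind.
Context {R : realType} {n : nat} (M : manifold R n) (g : riemannian_metric M).

Definition alpha_nonnegative (alpha : R) : Prop :=
  1 <= alpha <= (dimS20 n)%:R /\
  forall a p, chart_dom (man_chart a) p ->
  let x := chart_map (man_chart a) p in
  forall E, orthonormal_frame (metric_mx g a) x E ->
  forall phi : 'I_(dimS20 n) -> 'M[R]_n, orthonormal_basisS20 phi ->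
  0 <= alpha_sum alpha
         (fun i => second_kind (metric_mx g a) x E (phi i) (phi i)).

Definition alpha_nonpositive (alpha : R) : Prop :=
  1 <= alpha <= (dimS20 n)%:R /\
  forall a p, chart_dom (man_chart a) p ->
  let x := chart_map (man_chart a) p in
  forall E, orthonormal_frame (metric_mx g a) x E ->
  forall phi : 'I_(dimS20 n) -> 'M[R]_n, orthonormal_basisS20 phi ->
  alpha_sum alpha
    (fun i => second_kind (metric_mx g a) x E (phi i) (phi i)) <= 0.

Definition flat : Prop :=
  forall a p, chart_dom (man_chart a) p ->
  forall X Y Z W,
    riemann (metric_mx g a) (chart_map (man_chart a) p) X Y Z W = 0.

End CurvatureOperatorSecondKind.

Record kahler_manifold (R : realType) (m : nat) := KahlerManifold {
  kahler_man :> manifold R (2 * m);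
  kahler_metric : riemannian_metric kahler_man;
  kahler_J : almost_complex_structure kahler_man;
  kahler_hermitian : forall a p, chart_dom (man_chart a) p ->
    let x := chart_map (man_chart a) p in
    acs_mx kahler_J a x *m metric_mx kahler_metric a x
      *m (acs_mx kahler_J a x)^T = metric_mx kahler_metric a x;
  kahler_parallel : forall a p l i k, chart_dom (man_chart a) p ->
    cov_deriv_endo (metric_mx kahler_metric a) (acs_mx kahler_J a) l i k
      (chart_map (man_chart a) p) = 0 }.

Definition has_constant_hsc (R : realType) (m : nat) (M : kahler_manifold R m)
    (c : R) : Prop :=
  forall a p, chart_dom (man_chart a) p ->
  let x := chart_map (man_chart a) p in
  let g := metric_mx (kahler_metric M) a in
  let J := acs_mx (kahler_J M) a x in
  forall X : 'rV[R]_(2 * m), (X *m g x *m X^T) ord0 ord0 = 1 ->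
    riemann g x X (X *m J) X (X *m J) = c.

(* Main.v *)
From HB Require Import structures.
Require Import Defs.
From mathcomp Require Import all_boot all_order all_algebra.
From mathcomp Require Import boolp classical_sets functions reals.
From mathcomp Require Import topology normedtype landau derive.
From mathcomp Require Import ring lra.

Set Implicit Arguments.
Unset Strict Implicit.
Unset Printing Implicit Defensive.

Import Order.TTheory GRing.Theory Num.Theory.
Import numFieldNormedType.Exports.

Local Open Scope classical_set_scope.
Local Open Scope ring_scope.

(** At a point p of a Kähler manifold of real dimension n = 2m, the traceless
    symmetric tensors split orthogonally into the J-invariant ones, of dimension
    m^2 - 1, and the J-anti-invariant ones, of dimension m(m + 1). The traces of
    the curvature operator of the second kind on these two spaces are
    -(m - 1)/(2m) S and S, where S is the scalar curvature. Nonnegativity of the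
    alpha-sums for all orthonormal bases gives [0 <= \sum_i w_i u_i] for all
    weights w in [0, 1] of total mass at least alpha, where the u_i are the
    values of the form on an orthonormal basis. Full weights give S >= 0. Weight
    1 on the invariant part and constant weight on the anti-invariant part, with
    total mass 3/2 (m^2 - 1), give exactly 0; so for alpha < 3/2 (m^2 - 1) a
    slightly smaller mass gives S <= 0, and for alpha <= 3/2 (m^2 - 1)
    perturbing the weight of a single anti-invariant vector in both directions
    forces the form to be constant on the unit anti-invariant tensors. Its value
    at (X X - JX JX) / sqrt 2 is the holomorphic sectional curvature of X, which
    is therefore S / (m(m + 1)) for every unit X at p. By polarization the
    curvature tensor at p is that of a complex space form; in particular it
    vanishes when S = 0. In general the Ricci form is a constant multiple of
    c omega, where c is the holomorphic sectional curvature and omega the Kähler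
    form; both forms are closed, hence dc /\ omega = 0 and dc = 0 as n > 2.
    Tensoriality of the curvature under changes of chart and connectedness make
    c constant. *)

(** * Weighted sums *)

Section AlphaSums.
Context {R : realType}.
Implicit Types alpha : R.

Definition alpha_weight alpha (i : nat) : R :=
  let k := Num.truncn alpha in
  if (i < k)%N then 1 else if i == k then alpha - k%:R else 0.

Lemma alpha_sumE (N : nat) alpha (u : 'I_N -> R) :
  alpha_sum alpha u = \sum_(i < N) alpha_weight alpha i * u i.
Proof.
rewrite /alpha_sum mulr_sumr big_mkcond [X in _ + X]big_mkcond -big_split /=.
apply: eq_bigr => i _; rewrite /alpha_weight; case: ltngtP => _;
  by rewrite ?mul1r ?mul0r ?add0r ?addr0.
Qed.

Lemma alpha_sumN (N : nat) alpha (u : 'I_N -> R) :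
  alpha_sum alpha (fun i => - u i) = - alpha_sum alpha u.
Proof.
by rewrite !alpha_sumE -sumrN; apply: eq_bigr => i _; rewrite mulrN.
Qed.

Lemma sum_alpha_weight (N : nat) alpha :
  0 <= alpha <= N%:R -> \sum_(i < N) alpha_weight alpha i = alpha.
Proof.
move=> /andP[alpha0 alphaN]; set k := Num.truncn alpha.
have /andP[k_le k_gt] := truncn_itv alpha0; rewrite -/k in k_le k_gt.
have kN : (k <= N)%N by rewrite -(ler_nat R) (le_trans k_le).
rewrite -(big_mkord xpredT (alpha_weight alpha)) (big_cat_nat _ (n := k)) //=.
have sum_low : \sum_(0 <= i < k) alpha_weight alpha i = k%:R.
  rewrite big_mkord (eq_bigr (fun=> 1)) ?sumr_const ?card_ord // => i _.
  by rewrite /alpha_weight -/k ltn_ord.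
have sum_high : \sum_(k <= i < N) alpha_weight alpha i = alpha - k%:R.
  move: kN; rewrite leq_eqVlt => /orP[/eqP kN|kN].
    by rewrite [in LHS]kN big_geq //; move: alphaN; rewrite -kN; lra.
  rewrite big_ltn // big_nat_cond big1 ?addr0.
    by rewrite /alpha_weight -/k ltnn eqxx.
  move=> i; rewrite andbT => /andP[ki _].
  by rewrite /alpha_weight -/k ltnNge (ltnW ki) gtn_eqF.
by rewrite sum_low sum_high addrC subrK.
Qed.

(* Among all weights of the same mass, the alpha-sum puts its weights on the
   smallest values. The slope [t] is the value at which the weights drop from
   1 to 0; it is a Lagrange multiplier for the mass. *)
Lemma alpha_sum_bathtub (N : nat) alpha (u : 'I_N -> R) :
  0 < alpha <= N%:R -> {homo u : i j / (i <= j)%N >-> i <= j} ->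
  exists t, forall w : 'I_N -> R, (forall i, 0 <= w i <= 1) ->
    t * (\sum_i w i - alpha) <= \sum_i w i * u i - alpha_sum alpha u.
Proof.
case: N u => [|N] u /andP[alpha0 alphaN] mono_u; first by lra.
set k := Num.truncn alpha.
pose o : 'I_N.+1 := inord (minn k N).
have oE : o = minn k N :> nat by rewrite inordK // ltnS geq_minr.
exists (u o) => w w01.
rewrite -{1}(sum_alpha_weight (N := N.+1) (alpha := alpha)); last first.
  by rewrite (ltW alpha0).
rewrite alpha_sumE -!sumrB mulr_sumr; apply: ler_sum => i _.
suff : 0 <= (w i - alpha_weight alpha i) * (u i - u o) by lra.
have /andP[w0 w1] := w01 i; have iN : (i <= N)%N by rewrite -ltnS.
rewrite /alpha_weight -/k; case: ltngtP => [ik|ki|ik].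
- rewrite mulr_le0 ?subr_le0 //; apply: mono_u.
  by rewrite oE leq_min (ltnW ik).
- rewrite mulr_ge0 ?subr_ge0 //; apply: mono_u.
  by rewrite oE geq_min (ltnW ki).
- rewrite (_ : i = o) ?subrr ?mulr0 //; apply: val_inj.
  by rewrite /= oE -ik; apply/esym/minn_idPl.
Qed.

Lemma weighted_sum_ge0 (T : eqType) (x0 : T) (s : seq T) (u w : T -> R) alpha :
  0 < alpha <= (size s)%:R ->
  (forall s', perm_eq s' s ->
    0 <= alpha_sum alpha (fun i : 'I_(size s) => u (nth x0 s' i))) ->
  {in s, forall x, 0 <= w x <= 1} -> alpha <= \sum_(x <- s) w x ->
  0 <= \sum_(x <- s) w x * u x.
Proof.
move=> alphaN alpha_sum_ge0 w01 alpha_le.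
pose leu := relpre u <=%R; pose s' := sort leu s.
have leu_trans : transitive leu by move=> y x z; exact: le_trans.
have leu_refl : reflexive leu by move=> x; exact: lexx.
have s's : perm_eq s' s by rewrite perm_sort.
have size_s' : size s' = size s by rewrite size_sort.
have nth_s' (i : 'I_(size s)) : nth x0 s' i \in s.
  by rewrite -(perm_mem s's) mem_nth // size_s'.
have sum_s' (F : T -> R) :
    \sum_(x <- s) F x = \sum_(i < size s) F (nth x0 s' i).
  by rewrite -(perm_big _ s's) (big_nth x0) big_mkord size_s'.
have [|t bathtub] :=
  @alpha_sum_bathtub _ alpha (fun i => u (nth x0 s' i)) alphaN.
  move=> i j ij; apply: (sorted_leq_nth leu_trans leu_refl) => //.
  - by apply: sort_sorted => x y; exact: le_total.
  - by rewrite inE size_s'.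
  - by rewrite inE size_s'.
have w_le := bathtub _ (fun i => w01 _ (nth_s' i)).
rewrite -(sum_s' w) -(sum_s' (fun x => w x * u x)) in w_le.
have alpha_sum_le :
    alpha_sum alpha (fun i : 'I_(size s) => u (nth x0 s' i)) <= t * alpha.
  have := bathtub (fun=> 0) (fun=> _); rewrite lexx ler01 => /(_ (fun=> isT)).
  under [X in _ <= X - _]eq_bigr do rewrite mul0r.
  by rewrite !big1_eq !sub0r mulrN lerN2.
have alpha_sum_s' := alpha_sum_ge0 _ s's.
have t0 : 0 <= t.
  case/andP: alphaN => alpha0 _; rewrite -(pmulr_lge0 _ alpha0).
  exact: le_trans alpha_sum_le.
have : 0 <= t * (\sum_(x <- s) w x - alpha) by rewrite mulr_ge0 ?subr_ge0.
by lra.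
Qed.

Lemma three_level_sum_ge0 (T : eqType) (x0 : T) (x : T) (t s : seq T)
    (u : T -> R) alpha b c :
  uniq (x :: t ++ s) -> 0 < alpha <= (size (x :: t ++ s))%:R ->
  (forall s', perm_eq s' (x :: t ++ s) ->
    0 <= alpha_sum alpha
           (fun i : 'I_(size (x :: t ++ s)) => u (nth x0 s' i))) ->
  0 <= b <= 1 -> 0 <= c <= 1 -> alpha <= (size s)%:R + (b + c * (size t)%:R) ->
  0 <= \sum_(y <- s) u y + (b * u x + c * \sum_(y <- t) u y).
Proof.
move=> uniq_ts alphaN alpha_sum_ge0 b01 c01 alpha_le.
pose w y := if y == x then b else if y \in t then c else 1.
have sum_w (F : T -> R) : \sum_(y <- x :: t ++ s) w y * F y =
    \sum_(y <- s) F y + (b * F x + c * \sum_(y <- t) F y).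
  move: uniq_ts; rewrite /= mem_cat negb_or cat_uniq.
  move=> /andP[/andP[xt xs] /and3P[_ /hasPn st _]].
  have -> : b = w x by rewrite /w eqxx.
  rewrite big_cons big_cat /= addrA addrC mulr_sumr.
  congr (_ + (_ + _)); apply: eq_big_seq => y y_in.
    have /negbTE yx : y != x by apply: contraNneq xs => <-.
    by rewrite /w yx (negbTE (st y y_in)) mul1r.
  have /negbTE yx : y != x by apply: contraNneq xt => <-.
  by rewrite /w yx y_in.
rewrite -sum_w; apply: weighted_sum_ge0 alphaN alpha_sum_ge0 _ _.
  by move=> y _; rewrite /w; do 2?case: ifP => _ //; rewrite ler01 lexx.
under eq_bigr do rewrite -[w _]mulr1.
by rewrite sum_w !big_const_seq !count_predT !iter_addr_0 mulr1.
Qed.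

End AlphaSums.

(** * Inner products *)

Section LinearFunctions.
Context {R : nzRingType} {U V : lmodType R} (f : U -> V).
Hypothesis f_linear : linear f.

Let F : {linear U -> V} :=
  HB.pack f (GRing.isLinear.Build R U V *:%R f f_linear).

Lemma linear_funD x y : f (x + y) = f x + f y.
Proof. exact: (linearD F). Qed.

Lemma linear_funN x : f (- x) = - f x.
Proof. exact: (linearN F). Qed.

Lemma linear_funB x y : f (x - y) = f x - f y.
Proof. exact: (linearB F). Qed.

Lemma linear_funZ a x : f (a *: x) = a *: f x.
Proof. exact: (linearZ_LR F). Qed.

Lemma linear_fun_sum (I : Type) (r : seq I) (E : I -> U) :
  f (\sum_(i <- r) E i) = \sum_(i <- r) f (E i).
Proof. exact: (linear_sum F). Qed.

End LinearFunctions.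

Section InnerProduct.
Context {R : realFieldType} {V : lmodType R}.

Record inner_product (B : V -> V -> R) : Prop := InnerProduct {
  ip_linear : forall a x y z, B (a *: x + y) z = a * B x z + B y z;
  ip_sym : forall x y, B x y = B y x;
  ip_gt0 : forall x, x != 0 -> 0 < B x x }.

Variable B : V -> V -> R.
Hypothesis ipB : inner_product B.

Lemma ipDl x y z : B (x + y) z = B x z + B y z.
Proof. by rewrite -[x]scale1r (ip_linear ipB) mul1r scale1r. Qed.

Lemma ip0l z : B 0 z = 0.
Proof. by have := ipDl 0 0 z; rewrite addr0; lra. Qed.

Lemma ipZl a x z : B (a *: x) z = a * B x z.
Proof. by rewrite -[a *: x]addr0 (ip_linear ipB) ip0l addr0. Qed.

Lemma ipNl x z : B (- x) z = - B x z.
Proof. by rewrite -scaleN1r ipZl mulN1r. Qed.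

Lemma ipBl x y z : B (x - y) z = B x z - B y z.
Proof. by rewrite ipDl ipNl. Qed.

Lemma ip_suml (I : Type) (r : seq I) (F : I -> V) z :
  B (\sum_(i <- r) F i) z = \sum_(i <- r) B (F i) z.
Proof. exact: (big_morph (B^~ z) (fun x y => ipDl x y z) (ip0l z)). Qed.

Lemma ipDr x y z : B z (x + y) = B z x + B z y.
Proof. by rewrite !(ip_sym ipB z) ipDl. Qed.

Lemma ip0r z : B z 0 = 0.
Proof. by rewrite (ip_sym ipB) ip0l. Qed.

Lemma ipZr a x z : B z (a *: x) = a * B z x.
Proof. by rewrite !(ip_sym ipB z) ipZl. Qed.

Lemma ipNr x z : B z (- x) = - B z x.
Proof. by rewrite !(ip_sym ipB z) ipNl. Qed.

Lemma ipBr x y z : B z (x - y) = B z x - B z y.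
Proof. by rewrite !(ip_sym ipB z) ipBl. Qed.

Lemma ip_inj x y : B x =1 B y -> x = y.
Proof.
move=> Bxy; apply/eqP; rewrite -subr_eq0; apply/negPn/negP => /(ip_gt0 ipB).
by rewrite ipBl Bxy subrr ltxx.
Qed.

Record orth_projection (P : V -> V) : Prop := OrthProjection {
  op_linear : linear P;
  op_idem : forall x, P (P x) = P x;
  op_selfadj : forall x y, B (P x) y = B x (P y) }.

Lemma orth_projection_id : orth_projection id.
Proof. by []. Qed.

Lemma orth_projection_involution (S : V -> V) :
  linear S -> involutive S -> (forall x y, B (S x) y = B x (S y)) ->
  orth_projection (fun x => 2^-1 *: (x + S x)).
Proof.
move=> S_lin SK S_adj; pose P x := 2^-1 *: (x + S x).
have SP x : S (P x) = P x.
  by rewrite /P (linear_funZ S_lin) (linear_funD S_lin) SK addrC.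
split=> [a x y|x|x y]; last by rewrite ipZl ipZr ipDl ipDr S_adj.
- by rewrite S_lin addrACA -[a *: x + _]scalerDr [LHS]scalerDr !scalerA mulrC.
- rewrite -[LHS]/(2^-1 *: (P x + S (P x))) SP.
  rewrite -(mulr2n (P x)) -(scaler_nat 2 (P x)) scalerA.
  by rewrite mulVf ?pnatr_eq0 // scale1r.
Qed.

Lemma orth_projection_comp (P Q : V -> V) :
  orth_projection P -> orth_projection Q -> (forall x, P (Q x) = Q (P x)) ->
  orth_projection (P \o Q).
Proof.
move=> [P_lin PP P_adj] [Q_lin QQ Q_adj] PQ; split=> [a x y|x|x y] /=.
- by rewrite Q_lin P_lin.
- by rewrite -PQ PP QQ.
- by rewrite P_adj Q_adj PQ.
Qed.

Lemma orth_projectionB (P Q : V -> V) :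
  orth_projection P -> orth_projection Q -> (forall x, P (Q x) = Q x) ->
  orth_projection (fun x => P x - Q x).
Proof.
move=> [P_lin PP P_adj] [Q_lin QQ Q_adj] PQ.
have QP x : Q (P x) = Q x.
  by apply: ip_inj => y; rewrite Q_adj P_adj PQ -Q_adj.
split=> [a x y|x|x y].
- by rewrite P_lin Q_lin opprD addrACA scalerBr.
- rewrite (linear_funB P_lin) (linear_funB Q_lin).
  by rewrite PP QQ PQ QP subrr subr0.
- by rewrite ipBl ipBr P_adj Q_adj.
Qed.

End InnerProduct.

Section OrthonormalSequences.
Context {R : rcfType} {V : vectType R} (B : V -> V -> R).
Hypothesis ipB : inner_product B.
Implicit Types (P Q : V -> V) (s t : seq V).

Definition orthonormal_seq s : Prop :=
  uniq s /\ {in s &, forall x y, B x y = (x == y)%:R}.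

Definition orthonormal_basis_of P s : Prop :=
  orthonormal_seq s /\ forall x, P x = \sum_(q <- s) B q x *: q.

Lemma orthonormal_seq_sum s (c : V -> R) x : orthonormal_seq s -> x \in s ->
  B (\sum_(q <- s) c q *: q) x = c x.
Proof.
move=> [uniq_s Bs] xs; rewrite (ip_suml ipB) (bigD1_seq x) //= (ipZl ipB) Bs //.
rewrite eqxx mulr1 big_seq_cond big1 ?addr0 // => q /andP[qs qx].
by rewrite (ipZl ipB) Bs // (negbTE qx) mulr0.
Qed.

Lemma orthonormal_seq_free s : orthonormal_seq s -> free s.
Proof.
move=> [uniq_s Bs]; rewrite -(in_tupleE s); apply/freeP => k k0 i.
have := congr1 (B^~ s`_i) k0; rewrite /= (ip0l ipB) (ip_suml ipB).
rewrite (bigD1 i) //= (ipZl ipB) Bs ?mem_nth // eqxx mulr1.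
rewrite big1 ?addr0 // => j ji.
by rewrite (ipZl ipB) Bs ?mem_nth // nth_uniq // val_eqE (negbTE ji) mulr0.
Qed.

Lemma orthonormal_seq_rcons s x : orthonormal_seq s -> B x x = 1 ->
  {in s, forall q, B q x = 0} -> orthonormal_seq (rcons s x).
Proof.
move=> [uniq_s Bs] xx sx.
have x_notin : x \notin s.
  by apply/negP => /sx; rewrite xx; apply/eqP; rewrite oner_eq0.
have neq_x q : q \in s -> q == x = false.
  by move=> qs; apply: contraNF x_notin => /eqP <-.
split=> [|y z]; first by rewrite rcons_uniq x_notin.
rewrite !mem_rcons !inE => /orP[/eqP->|ys] /orP[/eqP->|zs].
- by rewrite xx eqxx.
- by rewrite (ip_sym ipB) sx // eq_sym neq_x.
- by rewrite sx // neq_x.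
- exact: Bs.
Qed.

Lemma orthonormal_seq_cat s t : orthonormal_seq s -> orthonormal_seq t ->
  {in s & t, forall x y, B x y = 0} -> orthonormal_seq (s ++ t).
Proof.
move=> os [uniq_t Bt] st; elim: t s os uniq_t Bt st => [|x t IH] s os.
  by rewrite cats0.
move=> /= /andP[x_notin uniq_t] Bt st; rewrite -cat_rcons; apply: IH => //.
- apply: orthonormal_seq_rcons => // [|q qs].
    by rewrite Bt ?mem_head // eqxx.
  by rewrite st ?mem_head.
- by move=> y z yt zt; rewrite Bt // inE ?yt ?zt orbT.
- move=> y z; rewrite mem_rcons inE => /orP[/eqP-> zt|ys zt].
    have xz : x == z = false by apply: contraNF x_notin => /eqP->.
    by rewrite Bt ?inE ?eqxx ?zt ?orbT // xz.
  by rewrite st // inE zt orbT.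
Qed.

Lemma orthonormal_basis_fixed P s q :
  orthonormal_basis_of P s -> q \in s -> P q = q.
Proof.
move=> [[uniq_s Bs] ->] qs; rewrite (bigD1_seq q) //= Bs // eqxx scale1r.
rewrite big_seq_cond big1 ?addr0 // => p /andP[ps pq].
by rewrite Bs // (negbTE pq) scale0r.
Qed.

Lemma perm_orthonormal_basis P s t : perm_eq s t ->
  orthonormal_basis_of P s -> orthonormal_basis_of P t.
Proof.
move=> st [[uniq_s Bs] Ps]; split=> [|x]; last by rewrite -(perm_big _ st).
split; first by rewrite -(perm_uniq st).
by move=> x y; rewrite -!(perm_mem st); exact: Bs.
Qed.

Lemma size_orthonormal_basis s :
  orthonormal_basis_of id s -> size s = \dim {:V}.
Proof.
move=> [os expand]; apply/esym/(size_basis (X := in_tuple s)).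
rewrite /basis_of eqEsubv subvf /=; apply/andP; split; last first.
  exact: orthonormal_seq_free.
apply/subvP => x _; rewrite [x]expand big_seq.
by apply: memv_suml => q qs; rewrite memvZ // memv_span.
Qed.

Lemma orthonormal_basis_add P Q s t : orth_projection B P ->
  orth_projection B Q -> (forall x, P (Q x) = 0) ->
  orthonormal_basis_of P s -> orthonormal_basis_of Q t ->
  orthonormal_basis_of (fun x => P x + Q x) (s ++ t).
Proof.
move=> P_proj Q_proj PQ Ps Qt; split=> [|x]; last first.
  by rewrite big_cat -(proj2 Ps) -(proj2 Qt).
apply: orthonormal_seq_cat (proj1 Ps) (proj1 Qt) _ => x y xs yt.
rewrite -(orthonormal_basis_fixed Ps xs) -(orthonormal_basis_fixed Qt yt).
by rewrite (op_selfadj P_proj) PQ (ip0r ipB).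
Qed.

Section Extension.
Variable P : V -> V.
Hypothesis P_proj : orth_projection B P.

Lemma orthonormal_complement s x : orthonormal_seq s ->
  {in s, forall q, P q = q} -> P x != \sum_(q <- s) B q x *: q ->
  exists u, [/\ B u u = 1, P u = u & {in s, forall q, B q u = 0}].
Proof.
move=> os Ps; rewrite -subr_eq0; set v := _ - _ => v0.
have vv := ip_gt0 ipB v0.
have Pv : P v = v.
  rewrite /v (linear_funB (op_linear P_proj)) (op_idem P_proj).
  congr (_ - _); rewrite (linear_fun_sum (op_linear P_proj)) !big_seq.
  by apply: eq_bigr => q qs; rewrite (linear_funZ (op_linear P_proj)) Ps.
have sv : {in s, forall q, B q v = 0}.
  move=> q qs; rewrite (ipBr ipB) -(op_selfadj P_proj) Ps //.
  by rewrite [X in _ - X](ip_sym ipB) (orthonormal_seq_sum (B^~ x)) ?subrr.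
exists ((Num.sqrt (B v v))^-1 *: v); split=> [||q qs].
- rewrite (ipZl ipB) (ipZr ipB) mulrA -expr2 exprVn sqr_sqrtr ?mulVf ?gt_eqF //.
  exact: ltW.
- by rewrite (linear_funZ (op_linear P_proj)) Pv.
- by rewrite (ipZr ipB) (sv q qs) mulr0.
Qed.

Lemma orthonormal_basis_extend s :
  orthonormal_seq s -> {in s, forall q, P q = q} ->
  exists t, orthonormal_basis_of P (s ++ t).
Proof.
have [d] := ubnP ((\dim {:V}).+1 - size s); elim: d s => // d IH s d_gt os Ps.
have [expand|/existsNP[x /eqP not_span]] :=
    pselect (forall x, P x = \sum_(q <- s) B q x *: q).
  by exists [::]; rewrite cats0.
have [u [uu Pu su]] := orthonormal_complement os Ps not_span.
have size_s : (size s <= \dim {:V})%N.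
  by rewrite -(eqP (orthonormal_seq_free os)) dimvS ?subvf.
have [||t] := IH (rcons s u) _ (orthonormal_seq_rcons os uu su).
- by move: d_gt; rewrite size_rcons subSn // subSS.
- by move=> q; rewrite mem_rcons inE => /orP[/eqP->|/Ps].
by rewrite cat_rcons; exists (u :: t).
Qed.

End Extension.

Definition ip_frame n (e : 'I_n -> V) : Prop :=
  (forall i j, B (e i) (e j) = (i == j)%:R) /\
  forall x, x = \sum_i B (e i) x *: e i.

Lemma exists_ip_frame n : \dim {:V} = n -> exists e : 'I_n -> V, ip_frame e.
Proof.
move=> dimV; have [//|//|s s_basis] :=
  @orthonormal_basis_extend id (orth_projection_id B) [::].
have size_s : size s = n by rewrite (size_orthonormal_basis s_basis).
have [[uniq_s Bs] expand] := s_basis; exists (fun i => s`_i).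
split=> [i j|x]; first by rewrite Bs ?mem_nth ?size_s // nth_uniq ?size_s.
by rewrite [LHS]expand (big_nth 0) big_mkord size_s.
Qed.

Lemma parseval n (e : 'I_n -> V) x y : ip_frame e ->
  \sum_i B (e i) x * B (e i) y = B x y.
Proof.
move=> [_ expand]; rewrite [in RHS](expand x) (ip_suml ipB).
by apply: eq_bigr => i _; rewrite (ipZl ipB).
Qed.

End OrthonormalSequences.

(** * Algebraic Kähler curvature tensors *)

Section KahlerTensors.
Context {R : realFieldType} {V : lmodType R}.

Record complex_structure (J : V -> V) : Prop := ComplexStructure {
  cs_linear : linear J;
  cs_sqr : forall X, J (J X) = - X }.

Record hermitian_structure (B : V -> V -> R) (J : V -> V) : Prop :=
  HermitianStructure {
    hs_inner : inner_product B;
    hs_complex : complex_structure J;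
    hs_isometry : forall X Y, B (J X) (J Y) = B X Y }.

Record kahler_tensor (J : V -> V) (D : V -> V -> V -> V -> R) : Prop :=
  KahlerTensor {
    kt_linear : forall a X X' Y Z W,
      D (a *: X + X') Y Z W = a * D X Y Z W + D X' Y Z W;
    kt_anti12 : forall X Y Z W, D Y X Z W = - D X Y Z W;
    kt_anti34 : forall X Y Z W, D X Y W Z = - D X Y Z W;
    kt_bianchi : forall X Y Z W, D X Y Z W + D Y Z X W + D Z X Y W = 0;
    kt_J : forall X Y Z W, D X Y (J Z) (J W) = D X Y Z W }.

Lemma hs_skew B J X Y : hermitian_structure B J -> B X (J Y) = - B (J X) Y.
Proof.
move=> [ipB J_complex J_isom].
by rewrite -[LHS]J_isom (cs_sqr J_complex) (ipNr ipB).
Qed.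

Lemma kahler_tensorN J D : kahler_tensor J D ->
  kahler_tensor J (fun X Y Z W => - D X Y Z W).
Proof.
case=> lin anti12 anti34 bianchi invJ; split=> [a X X'|X|X|X|X] Y Z W.
- by rewrite lin; ring.
- by rewrite anti12.
- by rewrite anti34.
- by have := bianchi X Y Z W; lra.
- by rewrite invJ.
Qed.

Lemma kahler_tensorB J D D' : kahler_tensor J D -> kahler_tensor J D' ->
  kahler_tensor J (fun X Y Z W => D X Y Z W - D' X Y Z W).
Proof.
case=> lin anti12 anti34 bianchi invJ [lin' anti12' anti34' bianchi' invJ'].
split=> [a X X'|X|X|X|X] Y Z W.
- by rewrite lin lin'; ring.
- by rewrite anti12 anti12'; ring.
- by rewrite anti34 anti34'; ring.
- by have := bianchi X Y Z W; have := bianchi' X Y Z W; lra.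
- by rewrite invJ invJ'.
Qed.

Variables (J : V -> V) (D : V -> V -> V -> V -> R).
Hypothesis J_complex : complex_structure J.
Hypothesis D_kahler : kahler_tensor J D.

Lemma kt_pair X Y Z W : D X Y Z W = D Z W X Y.
Proof.
have [_ anti12 anti34 bianchi _] := D_kahler.
have := bianchi X Y Z W; have := bianchi Y Z W X.
have := bianchi Z W X Y; have := bianchi W X Y Z.
rewrite (anti34 Z W X Y) (anti34 W X Y Z) (anti12 Z X W Y) (anti34 X Y Z W).
rewrite (anti12 W Y X Z) (anti34 W Y Z X) (anti34 Y Z W X) (anti34 Z X W Y).
by lra.
Qed.

Let linear2 a X X' Y Z W : D Y (a *: X + X') Z W = a * D Y X Z W + D Y X' Z W.
Proof.
by rewrite ![D Y _ _ _](kt_anti12 D_kahler) (kt_linear D_kahler); ring.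
Qed.
Let linear3 a X X' Y Z W : D Y Z (a *: X + X') W = a * D Y Z X W + D Y Z X' W.
Proof. by rewrite ![D Y Z _ _]kt_pair (kt_linear D_kahler). Qed.
Let linear4 a X X' Y Z W : D Y Z W (a *: X + X') = a * D Y Z W X + D Y Z W X'.
Proof. by rewrite ![D Y Z _ _]kt_pair linear2. Qed.

Lemma ktD :
  ((forall X X' Y Z W, (D (X + X') Y Z W = D X Y Z W + D X' Y Z W)%R) *
   (forall X Y Y' Z W, (D X (Y + Y') Z W = D X Y Z W + D X Y' Z W)%R) *
   (forall X Y Z Z' W, (D X Y (Z + Z') W = D X Y Z W + D X Y Z' W)%R) *
   (forall X Y Z W W', (D X Y Z (W + W') = D X Y Z W + D X Y Z W')%R))%type.
Proof.
split; [split; [split|]|] => [X X' Y Z W|X Y Y' Z W|X Y Z Z' W|X Y Z W W'].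
- by rewrite -[X in D (X + _)]scale1r (kt_linear D_kahler) mul1r.
- by rewrite -[Y in D _ (Y + _)]scale1r linear2 mul1r.
- by rewrite -[Z in D _ _ (Z + _)]scale1r linear3 mul1r.
- by rewrite -[W in D _ _ _ (W + _)]scale1r linear4 mul1r.
Qed.

Lemma kt0 :
  ((forall Y Z W, (D 0 Y Z W = 0)%R) * (forall X Z W, (D X 0 Z W = 0)%R) *
   (forall X Y W, (D X Y 0 W = 0)%R) * (forall X Y Z, (D X Y Z 0 = 0)%R))%type.
Proof.
split; [split; [split|]|] => [Y Z W|X Z W|X Y W|X Y Z].
- by have := ktD.1.1.1 0 0 Y Z W; rewrite addr0; lra.
- by have := ktD.1.1.2 X 0 0 Z W; rewrite addr0; lra.
- by have := ktD.1.2 X Y 0 0 W; rewrite addr0; lra.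
- by have := ktD.2 X Y Z 0 0; rewrite addr0; lra.
Qed.

Lemma ktZ :
  ((forall a X Y Z W, (D (a *: X) Y Z W = a * D X Y Z W)%R) *
   (forall a X Y Z W, (D X (a *: Y) Z W = a * D X Y Z W)%R) *
   (forall a X Y Z W, (D X Y (a *: Z) W = a * D X Y Z W)%R) *
   (forall a X Y Z W, (D X Y Z (a *: W) = a * D X Y Z W)%R))%type.
Proof.
split; [split; [split|]|] => a X Y Z W.
- by rewrite -[_ *: _]addr0 (kt_linear D_kahler) kt0 addr0.
- by rewrite -[_ *: _]addr0 linear2 kt0 addr0.
- by rewrite -[_ *: _]addr0 linear3 kt0 addr0.
- by rewrite -[_ *: _]addr0 linear4 kt0 addr0.
Qed.

Lemma ktN :
  ((forall X Y Z W, (D (- X) Y Z W = - D X Y Z W)%R) *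
   (forall X Y Z W, (D X (- Y) Z W = - D X Y Z W)%R) *
   (forall X Y Z W, (D X Y (- Z) W = - D X Y Z W)%R) *
   (forall X Y Z W, (D X Y Z (- W) = - D X Y Z W)%R))%type.
Proof.
by split; [split; [split|]|] => X Y Z W; rewrite -scaleN1r ktZ mulN1r.
Qed.

Section Sums.
Variables (I : Type) (r : seq I) (F : I -> V).

Lemma kt_sum :
  ((forall Y Z W,
      (D (\sum_(i <- r) F i) Y Z W = \sum_(i <- r) D (F i) Y Z W)%R) *
   (forall X Z W,
      (D X (\sum_(i <- r) F i) Z W = \sum_(i <- r) D X (F i) Z W)%R) *
   (forall X Y W,
      (D X Y (\sum_(i <- r) F i) W = \sum_(i <- r) D X Y (F i) W)%R) *
   (forall X Y Z,
      (D X Y Z (\sum_(i <- r) F i) = \sum_(i <- r) D X Y Z (F i))%R))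
  %type.
Proof.
split; [split; [split|]|] => [Y Z W|X Z W|X Y W|X Y Z].
- apply: (big_morph (fun X => D X Y Z W)); last by rewrite kt0.
  by move=> X X'; rewrite ktD.
- apply: (big_morph (fun Y => D X Y Z W)); last by rewrite kt0.
  by move=> Y Y'; rewrite ktD.
- apply: (big_morph (fun Z => D X Y Z W)); last by rewrite kt0.
  by move=> Z Z'; rewrite ktD.
- apply: (big_morph (fun W => D X Y Z W)); last by rewrite kt0.
  by move=> W W'; rewrite ktD.
Qed.

End Sums.

Lemma kt_alt12 X Z W : D X X Z W = 0.
Proof. by have := kt_anti12 D_kahler X X Z W; lra. Qed.

Lemma kt_swapJ34 X Y Z W : D X Y Z (J W) = D X Y W (J Z).
Proof.
rewrite -[LHS](kt_J D_kahler) (cs_sqr J_complex) ktN.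
by rewrite (kt_anti34 D_kahler _ _ W (J Z)) opprK.
Qed.

Lemma kt_swapJ12 X Y Z W : D X (J Y) Z W = D Y (J X) Z W.
Proof. by rewrite kt_pair kt_swapJ34 kt_pair. Qed.

Lemma kt_bisectional X Y :
  D X (J X) Y (J Y) = D X Y X Y + D X (J Y) X (J Y).
Proof.
have := kt_bianchi D_kahler X (J X) Y (J Y).
rewrite (kt_anti12 D_kahler Y (J X)) -(kt_swapJ12 X Y) (kt_swapJ34 X (J Y)).
by rewrite (kt_anti12 D_kahler X Y (J X)) (kt_J D_kahler); lra.
Qed.

Lemma kt_hsc0_sec0 : (forall X, D X (J X) X (J X) = 0) ->
  forall X Y, D X Y X Y = 0.
Proof.
move=> hsc0; have J_lin := cs_linear J_complex.
have polarized X Y : 3 * D X (J Y) X (J Y) + D X Y X Y = 0.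
  have := hsc0 (X + Y); have := hsc0 (X - Y).
  rewrite !(linear_funD J_lin) (linear_funN J_lin) !(ktD, ktN) !hsc0.
  rewrite (kt_pair Y (J Y) X (J X)) !(kt_swapJ12 Y X) !(kt_swapJ34 _ _ Y X).
  by have := kt_bisectional X Y; lra.
move=> X Y; have := polarized X Y; have := polarized X (J Y).
by rewrite (cs_sqr J_complex) !ktN; lra.
Qed.

Lemma kt_sec0 : (forall X Y, D X Y X Y = 0) -> forall X Y Z W, D X Y Z W = 0.
Proof.
move=> sec0.
have alt13 X Y W : D X Y X W = 0.
  by have := sec0 X (Y + W); rewrite !ktD !sec0 (kt_pair X W); lra.
have cyclic X Y Z W : D Y Z X W = D X Y Z W.
  have := alt13 (X + Z) Y W.
  by rewrite !ktD !alt13 (kt_anti12 D_kahler Y Z); lra.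
move=> X Y Z W; have := kt_bianchi D_kahler X Y Z W.
by rewrite (cyclic Y Z X) (cyclic X Y Z); lra.
Qed.

End KahlerTensors.

Section ConstantHolomorphicSectionalCurvature.
Context {R : realFieldType} {V : lmodType R} (B : V -> V -> R) (J : V -> V).
Hypothesis BJ : hermitian_structure B J.

Let ipB : inner_product B := hs_inner BJ.
Let J_complex : complex_structure J := hs_complex BJ.

(* Four times the curvature tensor of a space of constant holomorphic
   sectional curvature 1. *)
Definition hsc_model (X Y Z W : V) : R :=
  B X Z * B Y W - B X W * B Y Z + B X (J Z) * B Y (J W)
  - B X (J W) * B Y (J Z) + 2 * (B X (J Y) * B Z (J W)).

Let skew X Y : B X (J Y) = - B Y (J X).
Proof. by rewrite (hs_skew _ _ BJ) (ip_sym ipB). Qed.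

Lemma hsc_model_hsc X : hsc_model X (J X) X (J X) = 4 * B X X ^+ 2.
Proof.
have XJX : B X (J X) = 0 by have := skew X X; lra.
rewrite /hsc_model !(cs_sqr J_complex) !(ipNr ipB) (hs_isometry BJ).
by rewrite (ip_sym ipB (J X) X) XJX; ring.
Qed.

Lemma hsc_model_kahler c :
  kahler_tensor J (fun X Y Z W => c * hsc_model X Y Z W).
Proof.
rewrite /hsc_model; split=> [a X X'|X|X|X|X] Y Z W.
- by rewrite !(ip_linear ipB); ring.
- by rewrite (skew Y X); ring.
- by rewrite (skew W Z); ring.
- rewrite (skew X Z) (skew Y X) (skew Z Y) !(ip_sym ipB _ X) (ip_sym ipB Z Y).
  by ring.
- by rewrite !(cs_sqr J_complex) !(ipNr ipB) (hs_skew Z W BJ); ring.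
Qed.

Lemma kt_const_hsc D c : kahler_tensor J D ->
  (forall X, D X (J X) X (J X) = c * B X X ^+ 2) ->
  forall X Y Z W, D X Y Z W = c / 4 * hsc_model X Y Z W.
Proof.
move=> D_kahler hscD X Y Z W; apply/eqP; rewrite -subr_eq0; apply/eqP.
have E_kahler := kahler_tensorB D_kahler (hsc_model_kahler (c / 4)).
apply: (kt_sec0 E_kahler); apply: (kt_hsc0_sec0 J_complex E_kahler) => X'.
by rewrite hscD hsc_model_hsc; field.
Qed.

End ConstantHolomorphicSectionalCurvature.

Lemma hsc_model_ricci (R : rcfType) (V : vectType R) (B : V -> V -> R)
    (J : V -> V) n (e : 'I_n -> V) X Y :
  hermitian_structure B J -> ip_frame B e ->
  \sum_i hsc_model B J X Y (J (e i)) (e i) = (2 * n%:R + 4) * B X (J Y).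
Proof.
move=> BJ e_frame; have [ipB J_complex J_isom] := BJ.
have termE i : hsc_model B J X Y (J (e i)) (e i) = 2 * B X (J Y)
    + (2 * (B (e i) X * B (e i) (J Y)) - 2 * (B (e i) (J X) * B (e i) Y)).
  rewrite /hsc_model !(cs_sqr J_complex) !(ipNr ipB) J_isom (proj1 e_frame).
  by rewrite eqxx mulr1 !(hs_skew _ (e i) BJ) !(ip_sym ipB _ (e i)); ring.
under eq_bigr do rewrite termE.
rewrite big_split /= sumrB -!mulr_sumr !(parseval ipB _ _ e_frame).
rewrite sumr_const card_ord -[B (J X) Y]opprK -(hs_skew X Y BJ) -mulr_natr.
by ring.
Qed.

(** * Symmetric matrices and a complex structure *)

Section MatrixInnerProduct.
Context {R : realFieldType} {n : nat}.
Implicit Types A B : 'M[R]_n.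

Definition mxdot A B : R := \tr (A^T *m B).

Lemma mxdotE A B : mxdot A B = \sum_a \sum_b A a b * B a b.
Proof.
rewrite /mxdot /mxtrace exchange_big /=; apply: eq_bigr => b _.
by rewrite mxE; apply: eq_bigr => a _; rewrite mxE.
Qed.

Lemma mxdot_inner : inner_product mxdot.
Proof.
split=> [a A A' B|A B|A A0].
- by rewrite /mxdot linearP /= mulmxDl -scalemxAl linearP.
- by rewrite /mxdot -mxtrace_tr trmx_mul trmxK.
- have sqr_ge0 a b : 0 <= A a b * A a b by rewrite -expr2 sqr_ge0.
  have row_ge0 a : 0 <= \sum_b A a b * A a b by exact: sumr_ge0.
  rewrite lt_neqAle mxdotE sumr_ge0 // andbT; apply: contra A0 => /eqP/esym A0.
  apply/eqP/matrixP => a b; rewrite mxE; apply/eqP; rewrite -sqrf_eq0 expr2.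
  have row0 := psumr_eq0P (fun a _ => row_ge0 a) A0 (i := a) isT.
  by rewrite (psumr_eq0P (fun b _ => sqr_ge0 a b) row0).
Qed.

Lemma mxdot_tr A B : mxdot A^T B = mxdot A B^T.
Proof. by rewrite /mxdot trmxK -mxtrace_tr trmx_mul mxtrace_mulC. Qed.

Lemma mxdot1r A : mxdot A 1%:M = \tr A.
Proof. by rewrite /mxdot mulmx1 mxtrace_tr. Qed.

Lemma mxdot_delta A a b : mxdot A (delta_mx a b) = A a b.
Proof.
rewrite mxdotE (bigD1 a) //= (bigD1 b) //= mxE !eqxx mulr1.
rewrite !big1 ?addr0 // => [c /negbTE ca|d /negbTE db].
  by apply: big1 => d _; rewrite mxE ca mulr0.
by rewrite mxE db andbF mulr0.
Qed.

Lemma delta_mx1E (a b c d : 'I_n) :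
  delta_mx a b c d = (1%:M : 'M[R]_n) a c * (1%:M : 'M[R]_n) b d.
Proof. by rewrite !mxE -natrM mulnb (eq_sym a) (eq_sym b). Qed.

Lemma sum_diag_mul A B : \sum_a \sum_b A a a * B b b = \tr A * \tr B.
Proof. by rewrite mulr_suml; apply: eq_bigr => a _; rewrite mulr_sumr. Qed.

Lemma sum_mul_swap A B : \sum_a \sum_b A a b * B b a = \tr (A *m B).
Proof. by apply: eq_bigr => a _; rewrite mxE. Qed.

End MatrixInnerProduct.

Section MatrixBasis.
Context {R : rcfType} {n : nat} (P : 'M[R]_n -> 'M[R]_n) (s : seq 'M[R]_n).
Hypothesis Ps : orthonormal_basis_of mxdot P s.

Lemma orthonormal_basis_kernel a b c d :
  \sum_(q <- s) q a b * q c d = P (delta_mx a b) c d.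
Proof.
rewrite (proj2 Ps) summxE; apply: eq_bigr => q _.
by rewrite mxE mxdot_delta.
Qed.

Lemma size_orthonormal_basis_trace :
  (size s)%:R = \sum_a \sum_b P (delta_mx a b) a b.
Proof.
transitivity (\sum_(q <- s) mxdot q q).
  have [[_ q_dot] _] := Ps; rewrite big_seq (eq_bigr (fun=> 1)); last first.
    by move=> q qs; rewrite q_dot ?eqxx.
  by rewrite -big_seq big_const_seq count_predT iter_addr_0.
under eq_bigr do rewrite mxdotE.
rewrite exchange_big; apply: eq_bigr => a _.
rewrite exchange_big; apply: eq_bigr => b _; exact: orthonormal_basis_kernel.
Qed.

End MatrixBasis.

Section CongruenceProjections.
Context {R : realType} {n : nat} (J : 'M[R]_n).
Hypothesis JJ : J *m J = - 1%:M.
Hypothesis JT : J^T = - J.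
Hypothesis n_gt0 : (0 < n)%N.
Implicit Types A B : 'M[R]_n.

Let nR : n%:R != 0 :> R. Proof. by rewrite pnatr_eq0 -lt0n. Qed.

Definition congrmx A : 'M[R]_n := J^T *m A *m J.

Lemma congrmx_linear : linear congrmx.
Proof.
by move=> a A B; rewrite /congrmx mulmxDr mulmxDl -scalemxAr -scalemxAl.
Qed.

Let congrmxD := linear_funD congrmx_linear.
Let congrmxN := linear_funN congrmx_linear.
Let congrmxZ := linear_funZ congrmx_linear.

Lemma congrmxK : involutive congrmx.
Proof.
move=> A; have JTJT : J^T *m J^T = - 1%:M.
  by rewrite JT mulNmx mulmxN opprK JJ.
rewrite /congrmx !mulmxA JTJT -(mulmxA _ J J) JJ.
by rewrite mulmxN mulmx1 mulNmx mul1mx opprK.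
Qed.

Lemma congrmx_tr A : congrmx A^T = (congrmx A)^T.
Proof. by rewrite /congrmx !trmx_mul trmxK mulmxA. Qed.

Lemma congrmx1 : congrmx 1%:M = 1%:M.
Proof. by rewrite /congrmx mulmx1 JT mulNmx JJ opprK. Qed.

Lemma mxdot_congrmx A B : mxdot (congrmx A) B = mxdot A (congrmx B).
Proof.
rewrite /mxdot /congrmx !trmx_mul trmxK -!mulmxA mxtrace_mulC !mulmxA JT.
by rewrite !(mulmxN, mulNmx).
Qed.

Lemma mxtrace_congrmx A : \tr (congrmx A) = \tr A.
Proof. by rewrite -mxdot1r mxdot_congrmx congrmx1 mxdot1r. Qed.

Lemma congrmx_delta a b c d : congrmx (delta_mx a b) c d = J a c * J b d.
Proof.
rewrite /congrmx -(mul_delta_mx (ord0 : 'I_1)) mulmxA.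
rewrite -(mulmxA _ _ J) -colE -rowE mxE.
by rewrite big_ord1 !mxE.
Qed.

Definition sym_part A : 'M[R]_n := 2^-1 *: (A + A^T).
Definition inv_part A : 'M[R]_n := 2^-1 *: (A + congrmx A).
Definition anti_part A : 'M[R]_n := 2^-1 *: (A - congrmx A).
Definition scalar_part A : 'M[R]_n := (\tr A / n%:R) *: 1%:M.

(* Orthogonal projections onto the J-anti-invariant symmetric matrices and
   the traceless J-invariant symmetric ones. *)
Definition proj_anti A : 'M[R]_n := sym_part (anti_part A).
Definition proj_inv A : 'M[R]_n := sym_part (inv_part A) - scalar_part A.

Let sym_proj : orth_projection mxdot sym_part.
Proof.
apply: (orth_projection_involution mxdot_inner) => [a A B|A|A B].
- exact: linearP.
- exact: trmxK.
- exact: mxdot_tr.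
Qed.

Let inv_proj : orth_projection mxdot inv_part.
Proof.
apply: (orth_projection_involution mxdot_inner) => [a A B|A|A B].
- exact: congrmx_linear.
- exact: congrmxK.
- exact: mxdot_congrmx.
Qed.

Let anti_proj : orth_projection mxdot anti_part.
Proof.
apply: (orth_projection_involution mxdot_inner (S := fun A => - congrmx A)).
- by move=> a A B; rewrite congrmx_linear opprD scalerN.
- by move=> A; rewrite congrmxN opprK congrmxK.
- by move=> A B; rewrite (ipNl mxdot_inner) mxdot_congrmx (ipNr mxdot_inner).
Qed.

Let scalar_proj : orth_projection mxdot scalar_part.
Proof.
rewrite /scalar_part; split=> [a A B|A|A B].
- by rewrite mxtraceD mxtraceZ mulrDl scalerDl scalerA mulrA.
- by rewrite mxtraceZ mxtrace1 divfK.
- rewrite (ipZl mxdot_inner) (ipZr mxdot_inner) (ip_sym mxdot_inner 1%:M).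
  by rewrite !mxdot1r mulrAC [RHS]mulrAC (mulrC (\tr B)).
Qed.

Let sym_anti A : sym_part (anti_part A) = anti_part (sym_part A).
Proof.
rewrite /sym_part /anti_part congrmxZ congrmxD congrmx_tr.
by move: (congrmx A) => C; apply/matrixP => a b; rewrite !mxE; ring.
Qed.

Let sym_inv A : sym_part (inv_part A) = inv_part (sym_part A).
Proof.
rewrite /sym_part /inv_part congrmxZ congrmxD congrmx_tr.
by move: (congrmx A) => C; apply/matrixP => a b; rewrite !mxE; ring.
Qed.

Let inv_part1 a : inv_part (a *: 1%:M) = a *: 1%:M.
Proof.
rewrite /inv_part congrmxZ congrmx1; apply/matrixP => i j.
by rewrite !mxE; field.
Qed.

Let sym_part1 a : sym_part (a *: 1%:M) = a *: 1%:M.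
Proof.
rewrite /sym_part scalemx1 tr_scalar_mx; apply/matrixP => i j.
by rewrite !mxE; field.
Qed.

Lemma proj_anti_orth : orth_projection mxdot proj_anti.
Proof. exact: orth_projection_comp sym_proj anti_proj sym_anti. Qed.

Lemma proj_inv_orth : orth_projection mxdot proj_inv.
Proof.
apply: (orth_projectionB mxdot_inner) scalar_proj _ => [|A].
  exact: orth_projection_comp sym_proj inv_proj sym_inv.
by rewrite /= inv_part1 sym_part1.
Qed.

Lemma proj_anti_inv A : proj_anti (proj_inv A) = 0.
Proof.
have anti_inv B : anti_part (inv_part B) = 0.
  rewrite /anti_part /inv_part congrmxZ congrmxD congrmxK.
  by rewrite (addrC (congrmx B)) subrr scaler0.
have -> : proj_inv A = inv_part (sym_part A - scalar_part A).
  rewrite (linear_funB (op_linear inv_proj)) /proj_inv sym_inv.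
  by rewrite [inv_part (scalar_part A)]inv_part1.
by rewrite /proj_anti anti_inv /sym_part trmx0 addr0 scaler0.
Qed.

Let sym_partT A : (sym_part A)^T = sym_part A.
Proof. by apply/matrixP => a b; rewrite !mxE addrC. Qed.

Let mxtrace_sym_part A : \tr (sym_part A) = \tr A.
Proof. by rewrite mxtraceZ mxtraceD mxtrace_tr; field. Qed.

Let sym_part_id A : A^T = A -> sym_part A = A.
Proof.
by move=> AT; rewrite /sym_part AT; apply/matrixP => a b; rewrite !mxE; field.
Qed.

Lemma proj_anti_S20 A : S20 (proj_anti A).
Proof.
split; first exact: sym_partT.
rewrite mxtrace_sym_part mxtraceZ linearB /= mxtrace_congrmx.
by rewrite subrr mulr0.
Qed.

Lemma proj_inv_S20 A : S20 (proj_inv A).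
Proof.
rewrite /proj_inv /scalar_part; split.
  by rewrite linearB /= sym_partT scalemx1 tr_scalar_mx.
rewrite linearB /= mxtrace_sym_part !mxtraceZ mxtraceD mxtrace_congrmx mxtrace1.
by field.
Qed.

Lemma proj_anti_add_inv A : S20 A -> proj_anti A + proj_inv A = A.
Proof.
move=> [AT trA]; rewrite /proj_inv /scalar_part trA mul0r scale0r subr0.
rewrite /proj_anti sym_anti sym_inv (sym_part_id AT) /anti_part /inv_part.
by move: (congrmx A) => C; apply/matrixP => a b; rewrite !mxE; field.
Qed.

Lemma proj_anti_id A : A^T = A -> congrmx A = - A -> proj_anti A = A.
Proof.
move=> AT JA; rewrite /proj_anti -[RHS](sym_part_id AT) /anti_part JA.
by congr sym_part; apply/matrixP => a b; rewrite !mxE; field.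
Qed.

Local Notation I := (1%:M : 'M[R]_n).

Let sym_partE A a b : sym_part A a b = 2^-1 * (A a b + A b a).
Proof. by rewrite !mxE. Qed.

Let anti_partE A a b : anti_part A a b = 2^-1 * (A a b - congrmx A a b).
Proof. by rewrite /anti_part; move: (congrmx A) => C; rewrite !mxE. Qed.

Let inv_partE A a b : inv_part A a b = 2^-1 * (A a b + congrmx A a b).
Proof. by rewrite /inv_part; move: (congrmx A) => C; rewrite !mxE. Qed.

Lemma proj_anti_delta a b c d : proj_anti (delta_mx a b) c d =
  4^-1 * (I a c * I b d + I a d * I b c - J a c * J b d - J a d * J b c).
Proof.
by rewrite sym_partE !anti_partE !congrmx_delta !delta_mx1E; field.
Qed.

Lemma proj_inv_delta a b c d : proj_inv (delta_mx a b) c d =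
  4^-1 * (I a c * I b d + I a d * I b c + J a c * J b d + J a d * J b c)
  - n%:R^-1 * (I a b * I c d).
Proof.
have tr_delta : \tr (delta_mx a b : 'M[R]_n) = I a b.
  by rewrite -mxdot1r (ip_sym mxdot_inner) mxdot_delta.
have scalar_partE x y : scalar_part (delta_mx a b) x y = I a b / n%:R * I x y.
  by rewrite /scalar_part tr_delta mxE.
rewrite [LHS]mxE [X in _ + X]mxE sym_partE !inv_partE scalar_partE.
by rewrite !congrmx_delta !delta_mx1E; field.
Qed.

Let trJ : \tr J = 0.
Proof. by have := mxtrace_tr J; rewrite JT linearN /=; lra. Qed.

Lemma proj_anti_trace :
  \sum_a \sum_b proj_anti (delta_mx a b) a b = n%:R * (n%:R + 2) / 4.
Proof.
under eq_bigr do under eq_bigr do rewrite proj_anti_delta.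
under eq_bigr do rewrite -mulr_sumr !sumrB big_split /=.
rewrite -mulr_sumr !sumrB big_split /= !sum_diag_mul !sum_mul_swap.
by rewrite mulmx1 JJ linearN /= mxtrace1 trJ; field.
Qed.

Lemma proj_inv_trace :
  \sum_a \sum_b proj_inv (delta_mx a b) a b = n%:R ^+ 2 / 4 - 1.
Proof.
under eq_bigr do under eq_bigr do rewrite proj_inv_delta.
under eq_bigr do rewrite sumrB -!mulr_sumr !big_split /=.
rewrite sumrB -!mulr_sumr !big_split /= !sum_diag_mul !sum_mul_swap.
by rewrite -mxdotE /mxdot trmx1 mulmx1 JJ linearN /= mxtrace1 trJ; field.
Qed.

End CongruenceProjections.

(** * Traces of the curvature operator of the second kind *)

Section CurvatureForm.
Context {R : realFieldType} {V : lmodType R} {n : nat}.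
Variables (D : V -> V -> V -> V -> R) (e : 'I_n -> V).
Implicit Types K L : 'I_n -> 'I_n -> 'I_n -> 'I_n -> R.

Definition curv_form (A : 'M[R]_n) : R :=
  \sum_i \sum_j \sum_k \sum_l D (e i) (e j) (e k) (e l) * A i l * A j k.

Definition curv_scal : R := \sum_i \sum_j D (e i) (e j) (e i) (e j).

Definition curv_contraction K : R :=
  \sum_i \sum_j \sum_k \sum_l D (e i) (e j) (e k) (e l) * K i l j k.

Lemma eq_curv_contraction K L : (forall a b c d, K a b c d = L a b c d) ->
  curv_contraction K = curv_contraction L.
Proof.
move=> KL; apply: eq_bigr => i _; apply: eq_bigr => j _.
by apply: eq_bigr => k _; apply: eq_bigr => l _; rewrite KL.
Qed.

Lemma curv_contractionD K L :
  curv_contraction (fun a b c d => K a b c d + L a b c d) =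
  curv_contraction K + curv_contraction L.
Proof.
rewrite -big_split; apply: eq_bigr => i _; rewrite -big_split /=.
apply: eq_bigr => j _; rewrite -big_split; apply: eq_bigr => k _ /=.
by rewrite -big_split; apply: eq_bigr => l _; rewrite mulrDr.
Qed.

Lemma curv_contractionZ x K :
  curv_contraction (fun a b c d => x * K a b c d) = x * curv_contraction K.
Proof.
rewrite mulr_sumr; apply: eq_bigr => i _; rewrite mulr_sumr.
apply: eq_bigr => j _; rewrite mulr_sumr; apply: eq_bigr => k _.
by rewrite mulr_sumr; apply: eq_bigr => l _; rewrite mulrCA.
Qed.

Variable J : V -> V.
Hypothesis D_kahler : kahler_tensor J D.

Let frame_comb (P : 'M[R]_n) i : V := \sum_j P i j *: e j.

Lemma curv_contraction_parallel (P Q : 'M[R]_n) :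
  curv_contraction (fun a b c d => P a c * Q b d) =
  \sum_i \sum_l D (e i) (frame_comb P i) (frame_comb Q l) (e l).
Proof.
apply: eq_bigr => i _; rewrite [RHS](_ : _ = \sum_l \sum_j \sum_k
    D (e i) (e j) (e k) (e l) * (P i j * Q l k)).
  rewrite [RHS]exchange_big; apply: eq_bigr => j _.
  by rewrite [RHS]exchange_big.
apply: eq_bigr => l _; rewrite (kt_sum D_kahler); apply: eq_bigr => j _.
rewrite (ktZ D_kahler) (kt_sum D_kahler) mulr_sumr; apply: eq_bigr => k _.
by rewrite (ktZ D_kahler); ring.
Qed.

Lemma curv_contraction_cross (P Q : 'M[R]_n) :
  curv_contraction (fun a b c d => P a d * Q b c) =
  \sum_i \sum_l D (e i) (frame_comb Q l) (frame_comb P i) (e l).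
Proof.
apply: eq_bigr => i _; rewrite [RHS](_ : _ = \sum_l \sum_j \sum_k
    D (e i) (e j) (e k) (e l) * (P i k * Q l j)).
  rewrite [RHS]exchange_big; apply: eq_bigr => j _.
  by rewrite [RHS]exchange_big.
apply: eq_bigr => l _; rewrite (kt_sum D_kahler); apply: eq_bigr => j _.
rewrite (ktZ D_kahler) (kt_sum D_kahler) mulr_sumr; apply: eq_bigr => k _.
by rewrite (ktZ D_kahler); ring.
Qed.

Lemma sum_curv_orthogonal (P : 'M[R]_n) X Z : P^T *m P = 1%:M ->
  \sum_l D X (frame_comb P l) Z (frame_comb P l) = \sum_l D X (e l) Z (e l).
Proof.
move=> PP; rewrite [LHS](_ : _ = \sum_l \sum_j \sum_k
    D X (e j) Z (e k) * (P l j * P l k)); last first.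
  apply: eq_bigr => l _; rewrite (kt_sum D_kahler); apply: eq_bigr => j _.
  rewrite (ktZ D_kahler) (kt_sum D_kahler) mulr_sumr; apply: eq_bigr => k _.
  by rewrite (ktZ D_kahler); ring.
rewrite exchange_big; apply: eq_bigr => j _; rewrite exchange_big /=.
have P_col k : \sum_l P l j * P l k = (j == k)%:R.
  have := congr1 (fun M : 'M[R]_n => M j k) PP; rewrite !mxE => <-.
  by apply: eq_bigr => l _; rewrite mxE.
under eq_bigr do rewrite -mulr_sumr P_col.
rewrite (bigD1 j) //= eqxx mulr1 big1 ?addr0 // => k kj.
by rewrite eq_sym (negbTE kj) mulr0.
Qed.

Lemma curv_contraction_rank1 (x y z w : 'I_n -> R) :
  curv_contraction (fun a b c d => x a * y b * z c * w d) =
  D (\sum_i x i *: e i) (\sum_i z i *: e i) (\sum_i w i *: e i)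
    (\sum_i y i *: e i).
Proof.
rewrite !(kt_sum D_kahler); apply: eq_bigr => i _.
rewrite !(kt_sum D_kahler); apply: eq_bigr => j _.
rewrite !(kt_sum D_kahler); apply: eq_bigr => k _.
rewrite !(kt_sum D_kahler); apply: eq_bigr => l _.
by rewrite !(ktZ D_kahler); ring.
Qed.

Let frame_comb1 i : frame_comb 1%:M i = e i.
Proof.
rewrite /frame_comb (bigD1 i) //= mxE eqxx scale1r big1 ?addr0 // => j ji.
by rewrite mxE eq_sym (negbTE ji) scale0r.
Qed.

Local Notation I := (1%:M : 'M[R]_n).
Local Notation S := curv_scal.

Lemma curv_contraction_id :
  curv_contraction (fun a b c d => I a c * I b d) = 0.
Proof.
rewrite curv_contraction_parallel big1 // => i _; rewrite big1 // => l _.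
by rewrite !frame_comb1 (kt_alt12 D_kahler).
Qed.

Lemma curv_contraction_swap :
  curv_contraction (fun a b c d => I a d * I b c) = S.
Proof.
rewrite curv_contraction_cross; apply: eq_bigr => i _; apply: eq_bigr => l _.
by rewrite !frame_comb1.
Qed.

Lemma curv_contraction_trace :
  curv_contraction (fun a b c d => I a b * I c d) = - S.
Proof.
rewrite -sumrN; apply: eq_bigr => i _; rewrite -sumrN; apply: eq_bigr => j _.
rewrite (bigD1 j) //= [X in _ + X]big1 ?addr0 => [|k kj]; last first.
  by rewrite big1 // => l _; rewrite [I j k]mxE eq_sym (negbTE kj) !mulr0.
rewrite (bigD1 i) //= big1 ?addr0 => [|l li]; last first.
  by rewrite [I i l]mxE eq_sym (negbTE li) mul0r mulr0.
by rewrite !mxE !eqxx !mulr1 (kt_anti34 D_kahler).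
Qed.

Variable Jm : 'M[R]_n.
Hypothesis J_complex : complex_structure J.
Hypothesis Je : forall i, J (e i) = \sum_j Jm i j *: e j.
Hypothesis JmJm : Jm *m Jm = - 1%:M.
Hypothesis JmT : Jm^T = - Jm.

Let frame_combJ i : frame_comb Jm i = J (e i).
Proof. by rewrite Je. Qed.

Let curv_scalJ : \sum_i \sum_l D (e i) (J (e l)) (e i) (J (e l)) = S.
Proof.
apply: eq_bigr => i _; rewrite -(sum_curv_orthogonal (P := Jm)).
  by apply: eq_bigr => l _; rewrite frame_combJ.
by rewrite JmT mulNmx JmJm opprK.
Qed.

Lemma curv_contractionJ_parallel :
  curv_contraction (fun a b c d => Jm a c * Jm b d) = - (2 * S).
Proof.
rewrite curv_contraction_parallel mulr_natl mulr2n opprD -{1}curv_scalJ -!sumrN.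
rewrite -big_split; apply: eq_bigr => i _ /=; rewrite -!sumrN -big_split.
apply: eq_bigr => l _ /=; rewrite !frame_combJ (kt_anti34 D_kahler).
by rewrite (kt_bisectional J_complex D_kahler) opprD addrC.
Qed.

Lemma curv_contractionJ_cross :
  curv_contraction (fun a b c d => Jm a d * Jm b c) = - S.
Proof.
rewrite curv_contraction_cross -curv_scalJ -sumrN; apply: eq_bigr => i _.
rewrite -sumrN; apply: eq_bigr => l _; rewrite !frame_combJ.
by rewrite (kt_anti34 D_kahler) (kt_swapJ34 J_complex D_kahler).
Qed.

End CurvatureForm.

Section CurvatureFormTraces.
Context {R : realType} {V : lmodType R} {n : nat}.
Variables (D : V -> V -> V -> V -> R) (e : 'I_n -> V) (J : V -> V).
Variable Jm : 'M[R]_n.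

Lemma curv_form_trace (P : 'M[R]_n -> 'M[R]_n) s :
  orthonormal_basis_of mxdot P s ->
  \sum_(q <- s) curv_form D e q =
  curv_contraction D e (fun a b => P (delta_mx a b)).
Proof.
move=> Ps; rewrite exchange_big; apply: eq_bigr => i _.
rewrite exchange_big; apply: eq_bigr => j _.
rewrite exchange_big; apply: eq_bigr => k _.
rewrite exchange_big; apply: eq_bigr => l _.
rewrite -(orthonormal_basis_kernel Ps) mulr_sumr.
by apply: eq_bigr => q _; rewrite mulrA.
Qed.

Hypothesis J_complex : complex_structure J.
Hypothesis D_kahler : kahler_tensor J D.
Hypothesis Je : forall i, J (e i) = \sum_j Jm i j *: e j.
Hypothesis JmJm : Jm *m Jm = - 1%:M.
Hypothesis JmT : Jm^T = - Jm.
Variable s : seq 'M[R]_n.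

Local Notation S := (curv_scal D e).
Local Notation contractions := (curv_contraction_id e D_kahler,
  curv_contraction_swap e D_kahler, curv_contraction_trace e D_kahler,
  curv_contractionJ_parallel D_kahler J_complex Je JmJm JmT,
  curv_contractionJ_cross D_kahler J_complex Je JmJm JmT).

Local Notation I := (1%:M : 'M[R]_n).

Lemma curv_form_trace_anti :
  orthonormal_basis_of mxdot (proj_anti Jm) s ->
  \sum_(q <- s) curv_form D e q = S.
Proof.
move=> /curv_form_trace->; rewrite (eq_curv_contraction D e (L := fun a b c d =>
  4^-1 * ((I a c * I b d + I a d * I b c)
    + (-1) * (Jm a c * Jm b d + Jm a d * Jm b c)))); last first.
  by move=> a b c d; rewrite proj_anti_delta; ring.
by rewrite !(curv_contractionD, curv_contractionZ) !contractions; field.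
Qed.

Lemma curv_form_trace_inv : (0 < n)%N ->
  orthonormal_basis_of mxdot (proj_inv Jm) s ->
  \sum_(q <- s) curv_form D e q = S / n%:R - S / 2.
Proof.
move=> n_gt0; have nR : n%:R != 0 :> R by rewrite pnatr_eq0 -lt0n.
move=> /curv_form_trace->; rewrite (eq_curv_contraction D e (L := fun a b c d =>
  4^-1 * ((I a c * I b d + I a d * I b c)
    + (Jm a c * Jm b d + Jm a d * Jm b c))
  + - n%:R^-1 * (I a b * I c d))); last first.
  by move=> a b c d; rewrite proj_inv_delta //; ring.
by rewrite !(curv_contractionD, curv_contractionZ) !contractions; field.
Qed.

End CurvatureFormTraces.

(** * The pointwise theorem *)

Lemma natr_dimS20 (R : realType) (m : nat) : (0 < m)%N ->
  (dimS20 (2 * m))%:R = m%:R ^+ 2 - 1 + m%:R * (m%:R + 1) :> R.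
Proof.
move=> m_gt0; rewrite /dimS20.
have -> : ((2 * m - 1) * (2 * m + 2) = (2 * m - 1) * (m + 1) * 2)%N.
  by rewrite -mulnA mulnDl mul1n (mulnC m).
by rewrite mulnK // natrM natrB ?muln_gt0 // natrM natrD; ring.
Qed.

Lemma orthonormal_basisS20_nth (R : realType) (n : nat)
    (P : 'M[R]_n -> 'M[R]_n) (s : seq 'M[R]_n) :
  orthonormal_basis_of mxdot P s -> size s = dimS20 n ->
  (forall A, S20 (P A)) -> (forall A, S20 A -> P A = A) ->
  orthonormal_basisS20 (fun i : 'I_(dimS20 n) => s`_i).
Proof.
move=> Ps size_s P_S20 P_id; have [[uniq_s s_dot] expand] := Ps.
have mem_s (i : 'I_(dimS20 n)) : s`_i \in s by rewrite mem_nth ?size_s.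
split=> [i|i j|A /P_id PA].
- by rewrite -(orthonormal_basis_fixed Ps (mem_s i)).
- by rewrite -/(mxdot _ _) s_dot // nth_uniq ?size_s.
- exists (fun i => mxdot s`_i A).
  by rewrite -[LHS]PA expand (big_nth 0) big_mkord size_s.
Qed.

Definition unit_anti (R : realType) n (J theta : 'M[R]_n) : Prop :=
  [/\ mxdot theta theta = 1, theta^T = theta & congrmx J theta = - theta].

Section AdaptedBasis.
Context {R : realType} {m : nat}.
Local Notation n := (2 * m)%N.
Variable J : 'M[R]_n.
Hypothesis m_gt0 : (0 < m)%N.
Hypothesis JJ : J *m J = - 1%:M.
Hypothesis JT : J^T = - J.

Let n_gt0 : (0 < n)%N. Proof. by rewrite muln_gt0. Qed.

Lemma size_proj_anti_basis s : orthonormal_basis_of mxdot (proj_anti J) s ->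
  (size s)%:R = m%:R * (m%:R + 1) :> R.
Proof.
move=> /size_orthonormal_basis_trace ->.
by rewrite (proj_anti_trace JJ JT) natrM; field.
Qed.

Lemma size_proj_inv_basis s : orthonormal_basis_of mxdot (proj_inv J) s ->
  (size s)%:R = m%:R ^+ 2 - 1 :> R.
Proof.
move=> /size_orthonormal_basis_trace ->.
by rewrite (proj_inv_trace JJ JT n_gt0) natrM; field.
Qed.

Lemma exists_proj_inv_basis :
  exists s, orthonormal_basis_of mxdot (proj_inv J) s.
Proof.
have P_orth := proj_inv_orth JJ JT n_gt0.
by apply: (orthonormal_basis_extend mxdot_inner P_orth (s := [::])).
Qed.

Lemma exists_proj_anti_basis theta : unit_anti J theta ->
  exists t, orthonormal_basis_of mxdot (proj_anti J) (theta :: t).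
Proof.
move=> [theta1 thetaT thetaJ]; have P_orth := proj_anti_orth JJ JT.
apply: (orthonormal_basis_extend mxdot_inner P_orth (s := [:: theta])).
- by split=> // x y; rewrite !inE => /eqP-> /eqP->; rewrite eqxx theta1.
- by move=> q; rewrite inE => /eqP->; exact: proj_anti_id.
Qed.

Lemma orthonormal_basisS20_perm s t r :
  orthonormal_basis_of mxdot (proj_anti J) s ->
  orthonormal_basis_of mxdot (proj_inv J) t -> perm_eq r (s ++ t) ->
  orthonormal_basisS20 (fun i : 'I_(dimS20 n) => r`_i).
Proof.
move=> s_basis t_basis r_perm.
have st_basis := orthonormal_basis_add mxdot_inner (proj_anti_orth JJ JT)
  (proj_inv_orth JJ JT n_gt0) (proj_anti_inv JJ JT) s_basis t_basis.
apply: (orthonormal_basisS20_nth (perm_orthonormal_basis _ st_basis)).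
- by rewrite perm_sym.
- apply/eqP; rewrite (perm_size r_perm) size_cat -(eqr_nat R) natrD.
  rewrite (size_proj_anti_basis s_basis) (size_proj_inv_basis t_basis).
  by rewrite natr_dimS20 // addrC.
- move=> A /=; have [antiT anti0] := proj_anti_S20 JJ JT A.
  have [invT inv0] := proj_inv_S20 JJ JT n_gt0 A.
  split; first by rewrite linearD /= antiT invT.
  by rewrite mxtraceD anti0 inv0 addr0.
- by move=> A; exact: proj_anti_add_inv.
Qed.

End AdaptedBasis.

Section AntiInvariantForm.
Context {R : realType} {V : lmodType R} {m : nat}.
Local Notation n := (2 * m)%N.
Variables (J : V -> V) (D : V -> V -> V -> V -> R) (e : 'I_n -> V).
Variables (Jm theta : 'M[R]_n) (alpha : R).
Hypothesis m_ge2 : (2 <= m)%N.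
Hypothesis J_complex : complex_structure J.
Hypothesis D_kahler : kahler_tensor J D.
Hypothesis Je : forall i, J (e i) = \sum_j Jm i j *: e j.
Hypothesis JmJm : Jm *m Jm = - 1%:M.
Hypothesis JmT : Jm^T = - Jm.
Hypothesis theta_anti : unit_anti Jm theta.
Hypothesis alphaN : 1 <= alpha <= (dimS20 n)%:R.
Hypothesis alpha_sum_ge0 : forall phi : 'I_(dimS20 n) -> 'M[R]_n,
  orthonormal_basisS20 phi ->
  0 <= alpha_sum alpha (fun i => curv_form D e (phi i)).

Let m_gt0 : (0 < m)%N. Proof. exact: ltnW. Qed.
Let n_gt0 : (0 < n)%N. Proof. by rewrite muln_gt0. Qed.

Local Notation S := (curv_scal D e).
Local Notation u := (curv_form D e theta).
Local Notation M := (m%:R : R).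
Local Notation N := (M * (M + 1)).

Lemma weighted_trace_ge0 b c : 0 <= b <= 1 -> 0 <= c <= 1 ->
  alpha <= M ^+ 2 - 1 + (b + c * (N - 1)) ->
  0 <= S / n%:R - S / 2 + (b * u + c * (S - u)).
Proof.
move=> b01 c01 alpha_le.
have [t t_basis] := exists_proj_anti_basis JmJm JmT theta_anti.
have [s s_basis] := exists_proj_inv_basis m_gt0 JmJm JmT.
have [[/= uniq_ts _] _] := orthonormal_basis_add mxdot_inner
  (proj_anti_orth JmJm JmT) (proj_inv_orth JmJm JmT n_gt0)
  (proj_anti_inv JmJm JmT) t_basis s_basis.
have size_t := size_proj_anti_basis JmJm JmT t_basis.
have size_s := size_proj_inv_basis m_gt0 JmJm JmT s_basis.
have trace_t := curv_form_trace_anti J_complex D_kahler Je JmJm JmT t_basis.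
have trace_s :=
  curv_form_trace_inv J_complex D_kahler Je JmJm JmT n_gt0 s_basis.
have size_ts : size (theta :: t ++ s) = dimS20 n.
  apply/eqP; rewrite -(eqr_nat R) -cat_cons size_cat natrD size_t size_s.
  by rewrite natr_dimS20 // addrC.
rewrite -trace_s -trace_t big_cons (addrC u) addrK.
apply: (three_level_sum_ge0 (x0 := 0) (alpha := alpha)) => // [|r r_perm|].
- rewrite size_ts; case/andP: alphaN => alpha_ge1 ->; rewrite andbT.
  exact: lt_le_trans alpha_ge1.
- rewrite size_ts; apply: alpha_sum_ge0.
  exact: (orthonormal_basisS20_perm m_gt0 JmJm JmT t_basis s_basis r_perm).
- have -> : (size t)%:R = N - 1 by rewrite -size_t /= -natr1 addrK.
  by rewrite size_s.
Qed.

Let M_ge2 : 2 <= M. Proof. by rewrite (ler_nat R 2). Qed.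

(* The weight on the anti-invariant tensors that balances weight 1 on the
   invariant ones. *)
Let ratio : R := (M - 1) / (2 * M).

Let ratio_bounds : 1 / 4 <= ratio <= 1 / 2.
Proof.
have M_gt0 : 0 < 2 * M by move: M_ge2; lra.
by rewrite /ratio ler_pdivlMr // ler_pdivrMr //; move: M_ge2; lra.
Qed.

Let ratio_mass : ratio * N = (M ^+ 2 - 1) / 2.
Proof. by rewrite /ratio; field; move: M_ge2; lra. Qed.

Let N_ge6 : 6 <= N.
Proof. by move: M_ge2; nra. Qed.

Let weighted_ge0 b c : 0 <= b <= 1 -> 0 <= c <= 1 ->
  alpha <= M ^+ 2 - 1 + (b + c * (N - 1)) ->
  0 <= - (ratio * S) + (b * u + c * (S - u)).
Proof.
have -> : - (ratio * S) = S / n%:R - S / 2.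
  by rewrite /ratio natrM; field; move: M_ge2; lra.
exact: weighted_trace_ge0.
Qed.

Lemma curv_scal_ge0 : 0 <= S.
Proof.
have := @weighted_ge0 1 1; rewrite ler01 lexx => /(_ isT isT).
have /andP[_ alpha_le] := alphaN; rewrite natr_dimS20 // in alpha_le.
have /andP[_ ratio_le] := ratio_bounds.
have -> : 1 + 1 * (N - 1) = N by ring.
by move=> /(_ alpha_le) S_ge0; nra.
Qed.

(* With total mass 3/2 (M^2 - 1) the weighted sum is eps (N u - S), where eps
   is free in a neighbourhood of 0. *)
Lemma curv_form_anti : alpha <= 3 / 2 * (M ^+ 2 - 1) -> N * u = S.
Proof.
move=> alpha_le; have /andP[ratio_ge ratio_le] := ratio_bounds.
have N_gt0 : 0 < N by move: N_ge6; lra.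
have perturbed eps : - (1 / 8) <= eps * N <= 1 / 8 -> 0 <= eps * (N * u - S).
  move=> /andP[epsN_ge epsN_le].
  have /andP[eps_ge eps_le] : - (1 / 8) <= eps <= 1 / 8.
    rewrite -(ler_pM2r N_gt0) -(ler_pM2r N_gt0 eps).
    by move: N_ge6; lra.
  have := @weighted_ge0 (ratio + (eps * N - eps)) (ratio - eps).
  have -> : - (ratio * S) + ((ratio + (eps * N - eps)) * u
    + (ratio - eps) * (S - u)) = eps * (N * u - S) by ring.
  have -> : ratio + (eps * N - eps) + (ratio - eps) * (N - 1) = ratio * N.
    by ring.
  by rewrite ratio_mass; apply; [apply/andP; split; lra..|move: alpha_le; lra].
pose eps := 1 / 8 / N.
have epsN : eps * N = 1 / 8 by rewrite divfK // gt_eqF.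
have eps_gt0 : 0 < eps by rewrite !divr_gt0.
have u_ge : 0 <= N * u - S.
  by rewrite -(pmulr_rge0 _ eps_gt0) perturbed // epsN; lra.
have u_le : N * u - S <= 0.
  rewrite -(pmulr_rle0 _ eps_gt0) -oppr_ge0 -mulNr perturbed // mulNr epsN.
  by lra.
by lra.
Qed.

Lemma curv_scal_le0 : alpha < 3 / 2 * (M ^+ 2 - 1) -> S <= 0.
Proof.
move=> alpha_lt; have /andP[ratio_ge ratio_le] := ratio_bounds.
pose c := Num.max 0 ((alpha - (M ^+ 2 - 1)) / N).
have N_gt0 : 0 < N by move: N_ge6; lra.
have c_lt : c < ratio.
  rewrite gt_max ltr_pdivrMr // ratio_mass.
  by apply/andP; split; move: alpha_lt; lra.
have c01 : 0 <= c <= 1 by rewrite le_max lexx /=; lra.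
have c_mass : alpha <= M ^+ 2 - 1 + (c + c * (N - 1)).
  have -> : c + c * (N - 1) = c * N by ring.
  by rewrite -lerBlDl -ler_pdivrMr // le_max lexx orbT.
have := weighted_ge0 c01 c01 c_mass.
have -> : - (ratio * S) + (c * u + c * (S - u)) = (c - ratio) * S by ring.
by rewrite nmulr_rge0 // subr_lt0.
Qed.

End AntiInvariantForm.

Section UnitAntiInvariantTensor.
Context {R : realType} {n : nat} (J : 'M[R]_n).
Hypothesis JJ : J *m J = - 1%:M.
Hypothesis JT : J^T = - J.

(* If xi represents X in a frame, this tensor represents
   (X X - JX JX) / sqrt 2, at which the form takes the value of the
   holomorphic sectional curvature. *)
Definition anti_square (xi : 'rV[R]_n) : 'M[R]_n :=
  (Num.sqrt 2)^-1 *: (xi^T *m xi - (xi *m J)^T *m (xi *m J)).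

Lemma anti_square_unit xi : xi *m xi^T = 1%:M -> unit_anti J (anti_square xi).
Proof.
move=> xi_xi; rewrite /anti_square; move etaE : (xi *m J) => eta.
have etaJ : eta *m J = - xi by rewrite -etaE -mulmxA JJ mulmxN mulmx1.
have JTeta : J^T *m eta^T = - xi^T by rewrite -trmx_mul etaJ linearN.
have eta_eta : eta *m eta^T = 1%:M.
  by rewrite -{2}etaE trmx_mul JT mulNmx mulmxN mulmxA etaJ mulNmx opprK.
have xi_eta : xi *m eta^T = 0.
  have skew : (xi *m eta^T)^T = - (xi *m eta^T).
    by rewrite trmx_mul trmxK -etaE trmx_mul JT mulNmx mulmxN opprK mulmxA.
  move: (xi *m eta^T) skew => A /matrixP skew; apply/matrixP => i j.
  by have := skew i j; rewrite !ord1 !mxE; lra.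
have eta_xi : eta *m xi^T = 0.
  by rewrite -[LHS]trmxK trmx_mul trmxK xi_eta trmx0.
set A := xi^T *m xi - eta^T *m eta.
have AT : A^T = A by rewrite /A linearB /= !trmx_mul !trmxK.
have sqrA : \tr (A *m A) = 2.
  rewrite /A mulmxBl !mulmxBr !mulmxA.
  rewrite -!(mulmxA _ _ xi^T) -!(mulmxA _ _ eta^T) xi_xi eta_eta xi_eta eta_xi.
  rewrite !mulmx0 !mul0mx !mulmx1 subr0 sub0r opprK mxtraceD.
  by rewrite !(mxtrace_mulC _^T) xi_xi eta_eta mxtrace1.
have thetaT : ((Num.sqrt 2)^-1 *: A)^T = (Num.sqrt 2)^-1 *: A.
  by rewrite linearZ /= AT.
split=> //.
- rewrite /mxdot thetaT -scalemxAl -scalemxAr !mxtraceZ sqrA mulrA.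
  by rewrite -invfM -expr2 sqr_sqrtr // mulVf ?pnatr_eq0.
- rewrite /congrmx -scalemxAr -scalemxAl -scalerN; congr (_ *: _).
  rewrite mulmxBr mulmxBl !mulmxA JTeta -!(mulmxA _ _ J) etaJ etaE.
  by rewrite -trmx_mul etaE mulNmx mulmxN opprK opprB.
Qed.

End UnitAntiInvariantTensor.

Lemma curv_form_anti_square (R : realType) (V : lmodType R) (n : nat)
    (J : V -> V) D (e : 'I_n -> V) (Jm : 'M[R]_n) (xi : 'rV[R]_n) (X Y : V) :
  kahler_tensor J D -> X = \sum_i xi ord0 i *: e i ->
  Y = \sum_i (xi *m Jm) ord0 i *: e i ->
  curv_form D e (anti_square Jm xi) = D X Y X Y.
Proof.
move=> D_kahler XE YE; set eta := xi *m Jm in YE *.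
pose sq (x y z w : 'rV[R]_n) (a b c d : 'I_n) :=
  x ord0 a * y ord0 b * z ord0 c * w ord0 d.
have sqrt2 : (Num.sqrt 2)^-1 * (Num.sqrt 2)^-1 = 2^-1 :> R.
  by rewrite -invfM -expr2 sqr_sqrtr.
have squareE a b : anti_square Jm xi a b =
    (Num.sqrt 2)^-1 * (xi ord0 a * xi ord0 b - eta ord0 a * eta ord0 b).
  by rewrite /anti_square -/eta !mxE !big_ord1 !mxE.
transitivity (curv_contraction D e (fun a b c d =>
    2^-1 * ((sq xi xi xi xi a b c d + sq eta eta eta eta a b c d)
      + (-1) * (sq xi xi eta eta a b c d + sq eta eta xi xi a b c d)))).
  apply: eq_bigr => i _; apply: eq_bigr => j _; apply: eq_bigr => k _.
  by apply: eq_bigr => l _; rewrite !squareE -sqrt2 /sq; ring.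
rewrite !(curv_contractionD, curv_contractionZ).
rewrite !(curv_contraction_rank1 e D_kahler) -XE -YE.
rewrite !(kt_alt12 D_kahler) (kt_anti34 D_kahler X Y X Y).
by rewrite (kt_anti12 D_kahler X Y); field.
Qed.

Section PointwiseTheorem.
Context {R : realType} {V : vectType R} {m : nat}.
Local Notation n := (2 * m)%N.
Variables (B : V -> V -> R) (J : V -> V) (D : V -> V -> V -> V -> R).
Variable alpha : R.
Hypothesis m_ge2 : (2 <= m)%N.
Hypothesis dimV : \dim {:V} = n.
Hypothesis BJ : hermitian_structure B J.
Hypothesis D_kahler : kahler_tensor J D.
Hypothesis alphaN : 1 <= alpha <= (dimS20 n)%:R.
Hypothesis alpha_le : alpha <= 3 / 2 * (m%:R ^+ 2 - 1).
Hypothesis alpha_sum_ge0 :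
  forall (e : 'I_n -> V) (phi : 'I_(dimS20 n) -> 'M[R]_n),
  (forall i j, B (e i) (e j) = (i == j)%:R) -> orthonormal_basisS20 phi ->
  0 <= alpha_sum alpha (fun i => curv_form D e (phi i)).

Let ipB : inner_product B := hs_inner BJ.
Let J_complex : complex_structure J := hs_complex BJ.
Let m_gt0 : (0 < m)%N. Proof. exact: ltnW. Qed.
Let n_gt0 : (0 < n)%N. Proof. by rewrite muln_gt0. Qed.

Section Frame.
Variable e : 'I_n -> V.
Hypothesis e_frame : ip_frame B e.

Let Jm : 'M[R]_n := \matrix_(i, j) B (e j) (J (e i)).

Let Je i : J (e i) = \sum_j Jm i j *: e j.
Proof.
by rewrite {1}(proj2 e_frame (J _)); apply: eq_bigr => j _; rewrite mxE.
Qed.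

Let JmT : Jm^T = - Jm.
Proof.
by apply/matrixP => i j; rewrite !mxE (hs_skew _ _ BJ) (ip_sym ipB).
Qed.

Let JmJm : Jm *m Jm = - 1%:M.
Proof.
apply/matrixP => i k; rewrite [LHS]mxE [RHS]mxE [in RHS]mxE.
rewrite -(proj1 e_frame) -(hs_isometry BJ) -(parseval ipB _ _ e_frame) -sumrN.
apply: eq_bigr => j _; rewrite !mxE (ip_sym ipB (e k)) -mulrN.
by rewrite (hs_skew (e j) (e k) BJ) opprK.
Qed.

Lemma frame_hsc X : B X X = 1 ->
  [/\ 0 <= curv_scal D e,
      alpha < 3 / 2 * (m%:R ^+ 2 - 1) -> curv_scal D e <= 0 &
      m%:R * (m%:R + 1) * D X (J X) X (J X) = curv_scal D e].
Proof.
move=> XX; pose xi := \row_i B (e i) X.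
have XE : X = \sum_i xi ord0 i *: e i.
  by rewrite {1}(proj2 e_frame X); apply: eq_bigr => i _; rewrite mxE.
have JXE : J X = \sum_i (xi *m Jm) ord0 i *: e i.
  rewrite {1}(proj2 e_frame (J X)); apply: eq_bigr => i _; congr (_ *: _).
  rewrite {1}XE (linear_fun_sum (cs_linear J_complex)) (ip_sym ipB).
  rewrite (ip_suml ipB) mxE; apply: eq_bigr => j _.
  rewrite (linear_funZ (cs_linear J_complex)) (ipZl ipB) (ip_sym ipB).
  by rewrite [Jm _ _]mxE.
have xi_xi : xi *m xi^T = 1%:M.
  apply/matrixP => i j; rewrite !ord1 !mxE -XX -(parseval ipB _ _ e_frame).
  by apply: eq_bigr => k _; rewrite !mxE.
have anti := anti_square_unit JmJm JmT xi_xi.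
have sum_ge0 phi (phi_basis : orthonormal_basisS20 phi) :=
  alpha_sum_ge0 (proj1 e_frame) phi_basis.
rewrite -(curv_form_anti_square D_kahler XE JXE); split.
- exact: (curv_scal_ge0 m_ge2 J_complex D_kahler Je JmJm JmT anti alphaN).
- exact: (curv_scal_le0 m_ge2 J_complex D_kahler Je JmJm JmT anti alphaN).
- exact: (curv_form_anti m_ge2 J_complex D_kahler Je JmJm JmT anti alphaN).
Qed.

End Frame.

Lemma pointwise_unit_hsc : exists c, [/\ 0 <= c,
  alpha < 3 / 2 * (m%:R ^+ 2 - 1) -> c = 0 &
  forall X, B X X = 1 -> D X (J X) X (J X) = c].
Proof.
have [e e_frame] := exists_ip_frame ipB dimV.
pose N : R := m%:R * (m%:R + 1).
have N_gt0 : 0 < N by rewrite mulr_gt0 ?ltr_wpDl ?ler0n // ltr0n.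
have e0_unit : B (e (Ordinal n_gt0)) (e (Ordinal n_gt0)) = 1.
  by rewrite (proj1 e_frame) eqxx.
have [scal_ge0 scal_le0 _] := frame_hsc e_frame e0_unit.
exists (curv_scal D e / N); split=> [|alpha_lt|X X1].
- by rewrite divr_ge0 // ltW.
- rewrite (_ : curv_scal D e = 0) ?mul0r //.
  by apply/eqP; rewrite eq_le scal_ge0 scal_le0.
- have [_ _ <-] := frame_hsc e_frame X1; rewrite -/N mulrC mulKf //.
  by rewrite gt_eqF.
Qed.

Lemma pointwise_hsc : exists c, [/\ 0 <= c,
  alpha < 3 / 2 * (m%:R ^+ 2 - 1) -> c = 0 &
  forall X, D X (J X) X (J X) = c * B X X ^+ 2].
Proof.
have [c [c_ge0 c0 hsc]] := pointwise_unit_hsc; exists c; split=> // X.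
have [->|X_neq0] := eqVneq X 0.
  by rewrite (kt0 D_kahler) (ip0l ipB) expr0n mulr0.
have BX := ip_gt0 ipB X_neq0; pose r := Num.sqrt (B X X).
have r_neq0 : r != 0 by rewrite gt_eqF // sqrtr_gt0.
have r_sqr : r ^+ 2 = B X X by rewrite sqr_sqrtr // ltW.
have [Y XE] : exists Y, X = r *: Y.
  by exists (r^-1 *: X); rewrite scalerA divff // scale1r.
have Y_unit : B Y Y = 1.
  apply: (mulfI (expf_neq0 2 r_neq0)).
  by rewrite mulr1 [in RHS]r_sqr [in RHS]XE (ipZl ipB) (ipZr ipB); ring.
rewrite -r_sqr {1 2 3 4}XE (linear_funZ (cs_linear J_complex)).
by rewrite !(ktZ D_kahler) hsc //; ring.
Qed.

End PointwiseTheorem.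

(** * Smooth functions *)

Section NearEqual.
Context {R : realType} {V W : normedModType R}.
Implicit Types f g h : V -> W.

Lemma near0_differentiable h x : (\near x, h x = 0) -> differentiable h x.
Proof.
move=> h0; have hx : h x = 0 by exact: (nbhs_singleton h0).
have h_littleo : h \o shift x = cst (h x) + (0 : V -> W) +o_ 0 id.
  apply/eqaddoP => eps eps_gt0; near=> y.
  rewrite -[X in `|X|]/(h (y + x) - (h x + 0)) hx addr0 subr0.
  rewrite (_ : h (y + x) = 0) ?normr0 ?mulr_ge0 ?(ltW eps_gt0) //.
  by near: y; move: h0; rewrite (near_shift 0) /= subr0.
apply/diff_locallyP; rewrite (_ : ('d h x : V -> W) = 0).
  by split; [move=> y; exact: cst_continuous|].
have -> : 0 = (GRing.Linear.sort (\0%R : {linear V -> W})) by [].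
by apply: diff_unique => //; move=> y; exact: cst_continuous.
Unshelve. all: by end_near. Qed.

Lemma near_eq_differentiable f g x :
  (\near x, f x = g x) -> differentiable f x -> differentiable g x.
Proof.
move=> fg df; have -> : g = f + (g - f) by rewrite addrC subrK.
apply: differentiableD df _; apply: near0_differentiable.
by apply: filterS fg => y fgy; rewrite !fctE fgy subrr.
Qed.

End NearEqual.

Section Schwarz.
Context {R : realType} {V : normedModType R}.
Implicit Types (f : V -> R) (x v w : V).

Lemma is_derive_line f v y (s : R) : differentiable f (s *: v + y) ->
  is_derive s 1 (fun t : R => f (t *: v + y)) ('D_v f (s *: v + y)).
Proof.
move=> df; have dv : derivable f (s *: v + y) v by exact: diff_derivable.
have quotientE : (fun h : R => h^-1 *:
      ((fun t : R => f (t *: v + y)) (h *: 1 + s) - f (s *: v + y))) =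
    (fun h : R => h^-1 *: (f (h *: v + (s *: v + y)) - f (s *: v + y))).
  by apply/funext => h; rewrite [h *: 1]mulr1 scalerDl addrA.
by apply: DeriveDef; rewrite /derivable /derive /= quotientE.
Qed.

Definition second_difference f x v w (t : R) : R :=
  f (t *: v + (t *: w + x)) - f (t *: v + x) - f (t *: w + x) + f x.

Lemma second_differenceC f x v w t :
  second_difference f x v w t = second_difference f x w v t.
Proof. by rewrite /second_difference addrCA; ring. Qed.

Lemma second_difference_mvt f x v w (t : R) : 0 < t ->
  (forall s u : R, 0 <= s <= t -> 0 <= u <= t ->
    differentiable f (s *: v + (u *: w + x))) ->
  exists2 c, 0 <= c <= t & second_difference f x v w t =
    t * ('D_v f (c *: v + (t *: w + x)) - 'D_v f (c *: v + (0 *: w + x))).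
Proof.
move=> t_gt0 df; have t01 : 0 <= t <= t by rewrite lexx ltW.
have z01 : 0 <= (0 : R) <= t by rewrite lexx ltW.
pose phi s := f (s *: v + (t *: w + x)) - f (s *: v + (0 *: w + x)).
pose dphi s := 'D_v f (s *: v + (t *: w + x)) - 'D_v f (s *: v + (0 *: w + x)).
have phi_derive s : 0 <= s <= t -> is_derive s 1 phi (dphi s).
  by move=> s01; apply: is_deriveB; apply: is_derive_line; exact: df.
have [c] : exists2 c, c \in `]0, t[%R & phi t - phi 0 = dphi c * (t - 0).
  apply: MVT => // [s|].
    by rewrite in_itv /= => /andP[s0 st]; apply: phi_derive; rewrite !ltW.
  apply: derivable_within_continuous => s; rewrite in_itv /=.
  by move=> /phi_derive[].
rewrite in_itv /= => /andP[c0 ct] mvt; exists c; first by rewrite !ltW.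
rewrite -[RHS]mulrC -[X in _ * X]subr0 -mvt /second_difference /phi.
by rewrite !scale0r !add0r; ring.
Qed.

Lemma ler_norm_combination v w (s u t : R) : 0 <= s <= t -> 0 <= u <= t ->
  `|s *: v + u *: w| <= t * (`|v| + `|w|).
Proof.
move=> /andP[s0 st] /andP[u0 ut]; apply: (le_trans (ler_normD _ _)).
by rewrite !normrZ !ger0_norm // mulrDr lerD // ler_wpM2r.
Qed.

Lemma near_parallelogram (P : set V) x v w : (\forall y \near x, P y) ->
  \forall t \near (0 : R)^'+, forall s u, 0 <= s <= t -> 0 <= u <= t ->
    P (s *: v + (u *: w + x)).
Proof.
rewrite (near_shift 0) /= subr0 => /nbhs_norm0P[r /= r_gt0 P_ball].
have K_gt0 : 0 < `|v| + `|w| + 1 by rewrite ltr_wpDl ?addr_ge0.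
near=> t => s u s0t u0t; rewrite addrA; apply: P_ball => /=.
apply: le_lt_trans (ler_norm_combination v w s0t u0t) _.
have t_ge0 : 0 <= t by [].
apply: le_lt_trans (_ : t * (`|v| + `|w| + 1) < r).
  by rewrite ler_wpM2l // lerDl.
rewrite -ltr_pdivlMr //; near: t.
by apply: nbhs_right_lt; rewrite divr_gt0.
Unshelve. all: by end_near. Qed.

Lemma near_parallelogram_differentiable f x v w (eps : R) :
  differentiable f x -> 0 < eps ->
  \forall t \near (0 : R)^'+, forall s u, 0 <= s <= t -> 0 <= u <= t ->
    `|f (s *: v + (u *: w + x)) - (f x + (s * 'D_v f x + u * 'D_w f x))|
      <= eps * t.
Proof.
move=> df eps_gt0; pose K := `|v| + `|w| + 1.
have K_gt0 : 0 < K by rewrite ltr_wpDl ?addr_ge0.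
have remainder : \forall y \near x,
    `|f y - (f x + 'd f x (y - x))| <= eps / K * `|y - x|.
  rewrite (near_shift 0) /= subr0.
  have /eqaddoP/(_ _ (divr_gt0 eps_gt0 K_gt0)) := diff_locally df.
  by apply: filterS => h; rewrite /= addrK.
near=> t => s u s0t u0t.
have : `|f (s *: v + (u *: w + x)) - (f x + 'd f x (s *: v + (u *: w + x) - x))|
    <= eps / K * `|s *: v + (u *: w + x) - x|.
  by move: s u s0t u0t; near: t; exact: near_parallelogram remainder.
rewrite addrA addrK !deriveE //; set L := 'd f x.
rewrite (_ : L (_ + _) = s * L v + u * L w); last by rewrite linearD !linearZ.
move=> /le_trans; apply.
have t_ge0 : 0 <= t by [].
rewrite mulrAC ler_pdivrMr // -mulrA ler_wpM2l ?(ltW eps_gt0) //.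
apply: le_trans (ler_norm_combination v w s0t u0t) _.
by rewrite ler_wpM2l // lerDl.
Unshelve. all: by end_near. Qed.

Lemma second_difference_cvg f x v w :
  (\forall y \near x, differentiable f y) -> differentiable ('D_v f) x ->
  (fun t => second_difference f x v w t / t ^+ 2) @ 0^'+ --> 'D_w ('D_v f) x.
Proof.
move=> df dDf; apply/cvgrPdist_le => /= eps eps_gt0.
near=> t; have t_gt0 : 0 < t by [].
have t01 : 0 <= t <= t by rewrite lexx ltW.
have z01 : 0 <= (0 : R) <= t by rewrite lexx ltW.
have [|c c0t ->] := @second_difference_mvt f x v w t t_gt0.
  by near: t; exact: near_parallelogram v w df.
set Df := 'D_v f; set a := 'D_w Df x; set b := 'D_v Df x.
have estimate s u : 0 <= s <= t -> 0 <= u <= t ->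
    `|Df (s *: v + (u *: w + x)) - (Df x + (s * b + u * a))| <= eps / 2 * t.
  move: s u; near: t; apply: near_parallelogram_differentiable => //.
  by rewrite divr_gt0.
have t_estimate := estimate c t c0t t01.
have z_estimate := estimate c 0 c0t z01.
have -> : a - t * (Df (c *: v + (t *: w + x)) - Df (c *: v + (0 *: w + x)))
    / t ^+ 2 =
  ((Df (c *: v + (0 *: w + x)) - (Df x + (c * b + 0 * a)))
   - (Df (c *: v + (t *: w + x)) - (Df x + (c * b + t * a)))) / t.
  by field; rewrite gt_eqF.
rewrite normrM normfV (gtr0_norm t_gt0) ler_pdivrMr //.
by apply: le_trans (ler_normB _ _) _; lra.
Unshelve. all: by end_near. Qed.

Lemma derive_comm f x v w : (\forall y \near x, differentiable f y) ->
  differentiable ('D_v f) x -> differentiable ('D_w f) x ->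
  'D_v ('D_w f) x = 'D_w ('D_v f) x.
Proof.
move=> df dDv dDw; have := second_difference_cvg (v := v) (w := w) df dDv.
under eq_fun do rewrite second_differenceC.
exact: cvg_unique (second_difference_cvg df dDw).
Qed.

End Schwarz.

Section Partial.
Context {R : realType} {n : nat}.
Implicit Types (f g : 'rV[R]_n -> R) (U : set 'rV[R]_n) (i : 'I_n).

Lemma open_near_eq U f g x : open U -> U x ->
  (forall y, U y -> f y = g y) -> \near x, f x = g x.
Proof.
move=> U_open Ux fg; have : nbhs x U by exact: open_nbhs_nbhs.
by apply: filterS => y; exact: fg.
Qed.

Lemma eq_partial_on U f g i x : open U -> U x ->
  (forall y, U y -> f y = g y) -> partial i f x = partial i g x.
Proof.
by move=> U_open Ux fg; apply: near_eq_derive; exact: open_near_eq fg.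
Qed.

Lemma partialD f g i x : differentiable f x -> differentiable g x ->
  partial i (fun y => f y + g y) x = partial i f x + partial i g x.
Proof. by move=> df dg; apply: deriveD; exact: diff_derivable. Qed.

Lemma partialN f i x : differentiable f x ->
  partial i (fun y => - f y) x = - partial i f x.
Proof. by move=> df; apply: deriveN; exact: diff_derivable. Qed.

Lemma partialM f g i x : differentiable f x -> differentiable g x ->
  partial i (fun y => f y * g y) x = partial i f x * g x + f x * partial i g x.
Proof.
move=> df dg; have /= := @deriveM _ _ f g x (delta_mx ord0 i)
  (diff_derivable df) (diff_derivable dg).
by rewrite /partial => ->; rewrite addrC [g x *: _]mulrC.
Qed.

Lemma partial_cst (c : R) i x : partial i (fun=> c) x = 0.
Proof. exact: derive_cst. Qed.

Lemma partialV f i x : differentiable f x -> f x != 0 ->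
  partial i (fun y => (f y)^-1) x = - ((f x)^-1 * (f x)^-1 * partial i f x).
Proof.
move=> df f0; have /= := @deriveV _ _ f x (delta_mx ord0 i) f0
  (diff_derivable df).
by rewrite /partial => ->; rewrite -exprVn expr2 scaleNr.
Qed.

Lemma differentiable_bigsum (I : Type) (r : seq I) (F : I -> 'rV[R]_n -> R) x :
  (forall k, differentiable (F k) x) ->
  differentiable (fun y => \sum_(k <- r) F k y) x.
Proof.
move=> dF; elim: r => [|k r IH].
  by under eq_fun do rewrite big_nil; exact: differentiable_cst.
by under eq_fun do rewrite big_cons; exact: differentiableD.
Qed.

Lemma partial_sum (I : Type) (r : seq I) (F : I -> 'rV[R]_n -> R) i x :
  (forall k, differentiable (F k) x) ->
  partial i (fun y => \sum_(k <- r) F k y) x = \sum_(k <- r) partial i (F k) x.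
Proof.
move=> dF; elim: r => [|k r IH].
  by under eq_fun do rewrite big_nil; rewrite big_nil partial_cst.
under eq_fun do rewrite big_cons.
by rewrite big_cons partialD ?IH //; exact: differentiable_bigsum.
Qed.

Lemma diff_partialE f x (v : 'rV[R]_n) : differentiable f x ->
  'd f x v = \sum_i v ord0 i * partial i f x.
Proof.
move=> df; rewrite [in LHS](row_sum_delta v) linear_sum; apply: eq_bigr => i _.
by rewrite linearZ /= /partial deriveE.
Qed.

End Partial.

Section SmoothFunctions.
Context {R : realType} {n : nat} (U : set 'rV[R]_n).
Hypothesis U_open : open U.
Implicit Types (f g : 'rV[R]_n -> R).

Fixpoint differentiable_upto (k : nat) f : Prop :=
  (forall x, U x -> differentiable f x) /\
  (if k is k'.+1 then forall i, differentiable_upto k' (partial i f) else True).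

Lemma differentiable_upto_on k f x :
  differentiable_upto k f -> U x -> differentiable f x.
Proof. by case: k => [|k] [df _]; exact: df. Qed.

Lemma differentiable_uptoS k f :
  differentiable_upto k.+1 f -> differentiable_upto k f.
Proof.
elim: k f => [|k IH] f [df pf]; split=> // i.
by apply: IH; exact: pf.
Qed.

Lemma eq_differentiable_upto k f g : (forall x, U x -> f x = g x) ->
  differentiable_upto k f -> differentiable_upto k g.
Proof.
elim: k f g => [|k IH] f g fg [df pf]; (split; last by
    [|move=> i; apply: IH (pf i) => x Ux; exact: eq_partial_on U_open Ux fg]) =>
  x Ux; exact: near_eq_differentiable (open_near_eq U_open Ux fg) (df x Ux).
Qed.

Lemma smooth_onP f : smooth_on U f <-> forall k, differentiable_upto k f.
Proof.
split=> [sf k|f_upto s].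
  elim: k f sf => [|k IH] f sf; split=> //; try exact: (sf [::]).
  move=> i; apply: IH => s x Ux.
  by have := sf (rcons s i) x Ux; rewrite foldr_rcons.
elim/last_ind: s f f_upto => [|s i IH] f f_upto x Ux.
  exact: differentiable_upto_on (f_upto 0) Ux.
by rewrite foldr_rcons; apply: IH => // k; have [_ /(_ i)] := f_upto k.+1.
Qed.

Lemma differentiable_upto_cst k (c : R) : differentiable_upto k (fun=> c).
Proof.
elim: k c => [|k IH] c; split=> //; try by move=> x _;
  exact: differentiable_cst.
by move=> i; apply: eq_differentiable_upto (IH 0) => x _; rewrite partial_cst.
Qed.

Lemma differentiable_uptoD k f g :
  differentiable_upto k f -> differentiable_upto k g ->
  differentiable_upto k (fun x => f x + g x).
Proof.
elim: k f g => [|k IH] f g [df pf] [dg pg]; split=> //;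
  try by move=> x Ux; apply: differentiableD; [exact: df|exact: dg].
move=> i; apply: eq_differentiable_upto (IH _ _ (pf i) (pg i)) => x Ux.
by rewrite partialD //; [exact: df|exact: dg].
Qed.

Lemma differentiable_uptoM k f g :
  differentiable_upto k f -> differentiable_upto k g ->
  differentiable_upto k (fun x => f x * g x).
Proof.
elim: k f g => [|k IH] f g f_upto g_upto;
  have [df pf] := f_upto; have [dg pg] := g_upto; split=> //;
  try by move=> x Ux; apply: differentiableM; [exact: df|exact: dg].
move=> i; have f_uptok := differentiable_uptoS f_upto.
have g_uptok := differentiable_uptoS g_upto.
have fg_upto := differentiable_uptoD (IH _ _ (pf i) g_uptok)
  (IH _ _ f_uptok (pg i)).
apply: eq_differentiable_upto fg_upto => x Ux.
by rewrite partialM //; [exact: df|exact: dg].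
Qed.

Lemma differentiable_uptoV k f : (forall x, U x -> f x != 0) ->
  differentiable_upto k f -> differentiable_upto k (fun x => (f x)^-1).
Proof.
move=> f0; elim: k => [|k IH] f_upto; have [df pf] := f_upto; split=> //;
  try by move=> x Ux; apply: differentiableV; [exact: df|exact: f0].
move=> i; have V_upto := IH (differentiable_uptoS f_upto).
have := differentiable_uptoM (differentiable_upto_cst k (-1))
  (differentiable_uptoM (differentiable_uptoM V_upto V_upto) (pf i)).
apply: eq_differentiable_upto => x Ux.
by rewrite partialV ?mulN1r //; [exact: df|exact: f0].
Qed.

Lemma smooth_onD f g : smooth_on U f -> smooth_on U g ->
  smooth_on U (fun x => f x + g x).
Proof.
move=> /smooth_onP sf /smooth_onP sg; apply/smooth_onP => k.
exact: differentiable_uptoD.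
Qed.

Lemma smooth_onM f g : smooth_on U f -> smooth_on U g ->
  smooth_on U (fun x => f x * g x).
Proof.
move=> /smooth_onP sf /smooth_onP sg; apply/smooth_onP => k.
exact: differentiable_uptoM.
Qed.

Lemma smooth_onV f : (forall x, U x -> f x != 0) -> smooth_on U f ->
  smooth_on U (fun x => (f x)^-1).
Proof.
move=> f0 /smooth_onP sf; apply/smooth_onP => k; exact: differentiable_uptoV.
Qed.

Lemma smooth_on_cst (c : R) : smooth_on U (fun=> c).
Proof. by apply/smooth_onP => k; exact: differentiable_upto_cst. Qed.

Lemma smooth_onN f : smooth_on U f -> smooth_on U (fun x => - f x).
Proof.
move=> sf; under [fun x => - f x]eq_fun do rewrite -mulN1r.
by apply: smooth_onM => //; exact: smooth_on_cst.
Qed.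

Lemma eq_smooth_on f g : (forall x, U x -> f x = g x) ->
  smooth_on U f -> smooth_on U g.
Proof.
move=> fg /smooth_onP sf; apply/smooth_onP => k.
exact: eq_differentiable_upto (sf k).
Qed.

Lemma smooth_on_partial f i : smooth_on U f -> smooth_on U (partial i f).
Proof.
by move=> sf s x Ux; have := sf (rcons s i) x Ux; rewrite foldr_rcons.
Qed.

Lemma smooth_on_differentiable f x : smooth_on U f -> U x -> differentiable f x.
Proof. by move=> sf; exact: (sf [::]). Qed.

Lemma smooth_on_partialC f i j x : smooth_on U f -> U x ->
  partial i (partial j f) x = partial j (partial i f) x.
Proof.
move=> sf Ux; apply: derive_comm.
- have : nbhs x U by exact: open_nbhs_nbhs.
  by apply: filterS => y; exact: smooth_on_differentiable.
- exact: smooth_on_differentiable (smooth_on_partial i sf) Ux.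
- exact: smooth_on_differentiable (smooth_on_partial j sf) Ux.
Qed.

Lemma smooth_on_sum (I : Type) (r : seq I) (F : I -> 'rV[R]_n -> R) :
  (forall k, smooth_on U (F k)) -> smooth_on U (fun x => \sum_(k <- r) F k x).
Proof.
move=> sF; elim: r => [|k r IH].
  by under eq_fun do rewrite big_nil; exact: smooth_on_cst.
by under eq_fun do rewrite big_cons; exact: smooth_onD.
Qed.

Lemma smooth_on_prod (I : Type) (r : seq I) (F : I -> 'rV[R]_n -> R) :
  (forall k, smooth_on U (F k)) -> smooth_on U (fun x => \prod_(k <- r) F k x).
Proof.
move=> sF; elim: r => [|k r IH].
  by under eq_fun do rewrite big_nil; exact: smooth_on_cst.
by under eq_fun do rewrite big_cons; exact: smooth_onM.
Qed.

End SmoothFunctions.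

(* Locked: otherwise unification of distinct instances unfolds derivatives. *)
HB.lock Definition partial_mx (R : realType) (n k l : nat) (i : 'I_n)
    (M : 'rV[R]_n -> 'M[R]_(k, l)) (x : 'rV[R]_n) : 'M[R]_(k, l) :=
  \matrix_(a, b) partial i (fun y => M y a b) x.

Section MatrixFunctions.
Context {R : realType} {n : nat}.

Definition differentiable_mx k l (M : 'rV[R]_n -> 'M[R]_(k, l))
    (x : 'rV[R]_n) : Prop :=
  forall a b, differentiable (fun y => M y a b) x.

Definition smooth_mx k l (U : set 'rV[R]_n)
    (M : 'rV[R]_n -> 'M[R]_(k, l)) : Prop :=
  forall a b, smooth_on U (fun y => M y a b).

Lemma partial_mxE k l (i : 'I_n) (M : 'rV[R]_n -> 'M[R]_(k, l)) x a b :
  partial_mx i M x a b = partial i (fun y => M y a b) x.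
Proof. by rewrite partial_mx.unlock mxE. Qed.

Section Pointwise.
Context {k l : nat}.
Implicit Types (M N : 'rV[R]_n -> 'M[R]_(k, l)) (i : 'I_n) (x : 'rV[R]_n).

Lemma differentiable_mxD M N x : differentiable_mx M x ->
  differentiable_mx N x -> differentiable_mx (fun y => M y + N y) x.
Proof.
by move=> dM dN a b; under eq_fun do rewrite mxE; exact: differentiableD.
Qed.

Lemma differentiable_mxN M x :
  differentiable_mx M x -> differentiable_mx (fun y => - M y) x.
Proof.
by move=> dM a b; under eq_fun do rewrite mxE; exact: differentiableN.
Qed.

Lemma differentiable_mxB M N x : differentiable_mx M x ->
  differentiable_mx N x -> differentiable_mx (fun y => M y - N y) x.
Proof.
by move=> dM dN; apply: differentiable_mxD dM (differentiable_mxN dN).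
Qed.

Lemma differentiable_mx_cst (C : 'M[R]_(k, l)) x :
  differentiable_mx (fun=> C) x.
Proof. by move=> a b; exact: differentiable_cst. Qed.

Lemma differentiable_mxM p M (N : 'rV[R]_n -> 'M[R]_(l, p)) x :
  differentiable_mx M x -> differentiable_mx N x ->
  differentiable_mx (fun y => M y *m N y) x.
Proof.
move=> dM dN a b; under eq_fun do rewrite mxE.
by apply: differentiable_bigsum => c; exact: differentiableM.
Qed.

Lemma differentiable_mx_tr M x :
  differentiable_mx M x -> differentiable_mx (fun y => (M y)^T) x.
Proof. by move=> dM a b; under eq_fun do rewrite mxE; exact: dM. Qed.

Lemma partial_mxD M N i x : differentiable_mx M x -> differentiable_mx N x ->
  partial_mx i (fun y => M y + N y) x = partial_mx i M x + partial_mx i N x.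
Proof.
move=> dM dN; apply/matrixP => a b; rewrite mxE !partial_mxE.
by under eq_fun do rewrite mxE; rewrite partialD.
Qed.

Lemma partial_mxN M i x : differentiable_mx M x ->
  partial_mx i (fun y => - M y) x = - partial_mx i M x.
Proof.
move=> dM; apply/matrixP => a b; rewrite mxE !partial_mxE.
by under eq_fun do rewrite mxE; rewrite partialN.
Qed.

Lemma partial_mxB M N i x : differentiable_mx M x -> differentiable_mx N x ->
  partial_mx i (fun y => M y - N y) x = partial_mx i M x - partial_mx i N x.
Proof.
by move=> dM dN; rewrite partial_mxD ?partial_mxN //; exact: differentiable_mxN.
Qed.

Lemma partial_mxM p M (N : 'rV[R]_n -> 'M[R]_(l, p)) i x :
  differentiable_mx M x -> differentiable_mx N x ->
  partial_mx i (fun y => M y *m N y) x =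
  partial_mx i M x *m N x + M x *m partial_mx i N x.
Proof.
move=> dM dN; apply/matrixP => a b; rewrite partial_mxE !mxE.
under eq_fun do rewrite mxE.
rewrite partial_sum; last by move=> c; exact: differentiableM.
by rewrite -big_split; apply: eq_bigr => c _; rewrite partialM // !partial_mxE.
Qed.

Lemma partial_mx_tr M i x :
  partial_mx i (fun y => (M y)^T) x = (partial_mx i M x)^T.
Proof.
by apply/matrixP => a b; rewrite mxE !partial_mxE; under eq_fun do rewrite mxE.
Qed.

Variable U : set 'rV[R]_n.
Hypothesis U_open : open U.

Lemma eq_partial_mx_on M N i x : U x ->
  (forall y, U y -> M y = N y) -> partial_mx i M x = partial_mx i N x.
Proof.
move=> Ux MN; apply/matrixP => a b; rewrite !partial_mxE.
by apply: (eq_partial_on i U_open Ux) => y Uy; rewrite MN.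
Qed.

Lemma smooth_mx_partial M i : smooth_mx U M -> smooth_mx U (partial_mx i M).
Proof.
by move=> sM a b; under eq_fun do rewrite partial_mxE; exact: smooth_on_partial.
Qed.

Lemma smooth_mx_differentiable M x :
  smooth_mx U M -> U x -> differentiable_mx M x.
Proof. by move=> sM Ux a b; exact: smooth_on_differentiable (sM a b) Ux. Qed.

Lemma partial_mxC M i j x : U x -> smooth_mx U M ->
  partial_mx i (partial_mx j M) x = partial_mx j (partial_mx i M) x.
Proof.
move=> Ux sM; apply/matrixP => a b.
have entryE d : (fun y => partial_mx d M y a b) = partial d (fun y => M y a b).
  by apply/funext => y; rewrite partial_mxE.
by rewrite !partial_mxE !entryE (smooth_on_partialC U_open i j (sM a b) Ux).
Qed.

End Pointwise.

Lemma partial_mxtrace k (M : 'rV[R]_n -> 'M[R]_k) i x :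
  differentiable_mx M x ->
  partial i (fun y => \tr (M y)) x = \tr (partial_mx i M x).
Proof.
move=> dM; rewrite /mxtrace partial_sum //.
by apply: eq_bigr => a _; rewrite partial_mxE.
Qed.

Section Inverse.
Variables (U : set 'rV[R]_n) (k : nat) (M : 'rV[R]_n -> 'M[R]_k).
Hypothesis U_open : open U.

Lemma smooth_on_det l (N : 'rV[R]_n -> 'M[R]_l) :
  smooth_mx U N -> smooth_on U (fun x => \det (N x)).
Proof.
move=> sN; apply: (smooth_on_sum U_open) => s; apply: (smooth_onM U_open).
  exact: smooth_on_cst.
exact: smooth_on_prod.
Qed.

Lemma smooth_mx_inv : (forall x, U x -> M x \in unitmx) ->
  smooth_mx U M -> smooth_mx U (fun x => invmx (M x)).
Proof.
move=> uM sM i j; apply: (eq_smooth_on U_open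
    (f := fun x => (\det (M x))^-1 * cofactor (M x) j i)).
  by move=> x Ux; rewrite /invmx uM // !mxE.
apply: (smooth_onM U_open).
  apply: (smooth_onV U_open); last exact: smooth_on_det.
  by move=> x /uM; rewrite unitmxE unitfE.
apply: (smooth_onM U_open); first exact: smooth_on_cst.
by apply: smooth_on_det => a b; under eq_fun do rewrite !mxE; exact: sM.
Qed.

End Inverse.
End MatrixFunctions.

(** * Bilinear and trilinear forms in coordinates *)

Section MatrixForms.
Context {R : realFieldType} {n : nat}.
Implicit Types (M N A : 'M[R]_n) (X Y Z : 'rV[R]_n).

Definition mxform M X Y : R := (X *m M *m Y^T) ord0 ord0.

Lemma mxformE M X Y :
  mxform M X Y = \sum_i \sum_j X ord0 i * Y ord0 j * M i j.
Proof.
rewrite /mxform mxE exchange_big; apply: eq_bigr => j _ /=.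
rewrite !mxE mulr_suml; apply: eq_bigr => i _; ring.
Qed.

Lemma mxform_delta M i j : mxform M (delta_mx ord0 i) (delta_mx ord0 j) = M i j.
Proof. by rewrite /mxform -rowE trmx_delta -colE !mxE. Qed.

Lemma mxform_tr M X Y : mxform M^T X Y = mxform M Y X.
Proof.
rewrite /mxform -[in RHS](trmxK (_ *m _ *m _)) [RHS]mxE !trmx_mul trmxK.
by rewrite mulmxA.
Qed.

Lemma mxform_mull M A X Y : mxform M (X *m A) Y = mxform (A *m M) X Y.
Proof. by rewrite /mxform !mulmxA. Qed.

Lemma mxform_mulr M A X Y : mxform M X (Y *m A) = mxform (M *m A^T) X Y.
Proof. by rewrite /mxform trmx_mul !mulmxA. Qed.

Lemma mxform_linearl M a X Y Z :
  mxform M (a *: X + Y) Z = a * mxform M X Z + mxform M Y Z.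
Proof. by rewrite /mxform !mulmxDl -!scalemxAl !mxE. Qed.

Lemma mxform_linear a M N X Y :
  mxform (a *: M + N) X Y = a * mxform M X Y + mxform N X Y.
Proof.
by rewrite /mxform mulmxDr mulmxDl -scalemxAr -scalemxAl !mxE.
Qed.

Lemma mxformN M X Y : mxform (- M) X Y = - mxform M X Y.
Proof. by rewrite /mxform mulmxN mulNmx mxE. Qed.

Lemma mxform_rows M (e : 'I_n -> 'rV[R]_n) i j :
  (\matrix_k e k *m M *m (\matrix_k e k)^T) i j = mxform M (e i) (e j).
Proof.
by rewrite -[LHS]mxform_delta -mxform_mulr -mxform_mull -!rowE !rowK.
Qed.

Definition trilinear (T : 'I_n -> 'I_n -> 'I_n -> R) X Y Z : R :=
  \sum_i \sum_j \sum_k X ord0 i * Y ord0 j * Z ord0 k * T i j k.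

Lemma trilinear_cyclic (T : 'I_n -> 'I_n -> 'I_n -> R) X Y Z :
  (forall i j k, T i j k + T j k i + T k i j = 0) ->
  trilinear T X Y Z + trilinear T Y Z X + trilinear T Z X Y = 0.
Proof.
move=> T_cyclic.
have -> : trilinear T Y Z X =
    \sum_i \sum_j \sum_k X ord0 i * Y ord0 j * Z ord0 k * T j k i.
  rewrite /trilinear [RHS]exchange_big; apply: eq_bigr => j _.
  rewrite [RHS]exchange_big; apply: eq_bigr => k _.
  by apply: eq_bigr => i _; ring.
have -> : trilinear T Z X Y =
    \sum_i \sum_j \sum_k X ord0 i * Y ord0 j * Z ord0 k * T k i j.
  rewrite /trilinear exchange_big; apply: eq_bigr => i _.
  rewrite exchange_big; apply: eq_bigr => j _.
  by apply: eq_bigr => k _; ring.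
rewrite -!big_split big1 // => i _ /=; rewrite -!big_split big1 // => j _ /=.
rewrite -!big_split big1 // => k _ /=.
by rewrite -!mulrDr T_cyclic mulr0.
Qed.

Definition posdef_mx M : Prop :=
  M^T = M /\ forall X, X != 0 -> 0 < mxform M X X.

Lemma posdef_inner M : posdef_mx M -> inner_product (mxform M).
Proof.
move=> [MT M_pos]; split=> // [a X Y Z|X Y]; first exact: mxform_linearl.
by rewrite -mxform_tr MT.
Qed.

Lemma posdef_unitmx M : posdef_mx M -> M \in unitmx.
Proof.
move=> [_ M_pos]; rewrite -row_free_unit -kermx_eq0.
apply/negPn/negP => /rowV0Pn[X /sub_kermxP XM X_neq0].
by have := M_pos X X_neq0; rewrite /mxform XM mul0mx mxE ltxx.
Qed.

Record hermitian_mx (g J : 'M[R]_n) : Prop := HermitianMx {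
  hm_posdef : posdef_mx g;
  hm_sqr : J *m J = - 1%:M;
  hm_isometry : J *m g *m J^T = g }.

Lemma hermitian_mx_structure g J : hermitian_mx g J ->
  hermitian_structure (mxform g) (fun X => X *m J).
Proof.
move=> [g_posdef JJ JgJ]; split; first exact: posdef_inner.
- split=> [a X Y|X]; first by rewrite mulmxDl -scalemxAl.
  by rewrite -mulmxA JJ mulmxN mulmx1.
- by move=> X Y; rewrite mxform_mull mxform_mulr JgJ.
Qed.

Lemma hermitian_mx_skew g J : hermitian_mx g J -> g *m J^T = - (J *m g).
Proof.
by move=> [_ JJ JgJ]; rewrite -{2}JgJ !mulmxA JJ !mulNmx mul1mx opprK.
Qed.

End MatrixForms.

(** * Connection matrices and their curvature *)

(* Identities in a noncommutative ring: products are expanded and then treated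
   as atoms, entry by entry. *)
Ltac matrix_ring :=
  rewrite ?(mulmxDl, mulmxDr, mulNmx, mulmxN, opprD, opprK, mulmxA);
  repeat match goal with
    |- context [mulmx ?A ?B] => move: (mulmx A B) => ? end;
  repeat match goal with
    |- context [trmx ?A] => move: (trmx A) => ? end;
  repeat match goal with
    |- context [partial_mx ?i ?A ?x] => move: (partial_mx i A x) => ? end;
  apply/matrixP => ? ?; rewrite !mxE; ring.

(* A connection is given by its matrices A_k, where nabla_k (d_i) is
   \sum_j (A_k)_{ij} d_j. *)
Section Connections.
Context {R : realType} {n : nat} (U : set 'rV[R]_n).
Variable A : 'I_n -> 'rV[R]_n -> 'M[R]_n.
Hypothesis U_open : open U.
Hypothesis A_smooth : forall i, smooth_mx U (A i).

Definition curvature_mx (i j : 'I_n) (x : 'rV[R]_n) : 'M[R]_n :=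
  partial_mx i (A j) x - partial_mx j (A i) x
  + (A j x *m A i x - A i x *m A j x).

Definition cov_deriv_curvature (k i j : 'I_n) (x : 'rV[R]_n) : 'M[R]_n :=
  partial_mx k (curvature_mx i j) x
  + curvature_mx i j x *m A k x - A k x *m curvature_mx i j x.

Definition parallel_endo (J : 'rV[R]_n -> 'M[R]_n) : Prop :=
  forall k x, U x -> partial_mx k J x = A k x *m J x - J x *m A k x.

Definition parallel_form (g : 'rV[R]_n -> 'M[R]_n) : Prop :=
  forall k x, U x -> partial_mx k g x = A k x *m g x + g x *m (A k x)^T.

Definition torsion_free : Prop :=
  forall i j k x, U x -> A i x j k = A j x i k.

Lemma curvature_mx_anti i j x : curvature_mx j i x = - curvature_mx i j x.
Proof. by rewrite /curvature_mx; matrix_ring. Qed.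

Section AtPoint.
Variable x : 'rV[R]_n.
Hypothesis Ux : U x.

Let A_diff i : differentiable_mx (A i) x.
Proof. exact: smooth_mx_differentiable Ux. Qed.

Let partialA_diff i j : differentiable_mx (partial_mx j (A i)) x.
Proof.
exact: smooth_mx_differentiable (smooth_mx_partial j (A_smooth i)) Ux.
Qed.

Let AA_diff i j : differentiable_mx (fun y => A i y *m A j y) x.
Proof. exact: differentiable_mxM. Qed.

Lemma curvature_mx_differentiable i j : differentiable_mx (curvature_mx i j) x.
Proof. by apply: differentiable_mxD; exact: differentiable_mxB. Qed.

Lemma partial_curvature_mx i j k : partial_mx k (curvature_mx i j) x =
  partial_mx k (partial_mx i (A j)) x - partial_mx k (partial_mx j (A i)) x
  + (partial_mx k (A j) x *m A i x + A j x *m partial_mx k (A i) x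
     - (partial_mx k (A i) x *m A j x + A i x *m partial_mx k (A j) x)).
Proof.
have partial_diff a b :=
  differentiable_mxB (partialA_diff a b) (partialA_diff b a).
rewrite /curvature_mx (partial_mxD _ (partial_diff _ _)); last first.
  exact: differentiable_mxB.
by rewrite !partial_mxB // !partial_mxM.
Qed.

Lemma second_bianchi i j k : cov_deriv_curvature k i j x
  + cov_deriv_curvature i j k x + cov_deriv_curvature j k i x = 0.
Proof.
rewrite /cov_deriv_curvature !partial_curvature_mx /curvature_mx.
rewrite (partial_mxC U_open k i Ux (A_smooth j)).
rewrite (partial_mxC U_open k j Ux (A_smooth i)).
rewrite (partial_mxC U_open j i Ux (A_smooth k)).
by matrix_ring.
Qed.

Lemma curvature_parallel_endo J i j : smooth_mx U J -> parallel_endo J ->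
  curvature_mx i j x *m J x = J x *m curvature_mx i j x.
Proof.
move=> J_smooth J_par.
have J_diff : differentiable_mx J x by exact: smooth_mx_differentiable Ux.
have partial2 a b : partial_mx a (partial_mx b J) x =
    partial_mx a (A b) x *m J x + A b x *m (A a x *m J x - J x *m A a x)
    - ((A a x *m J x - J x *m A a x) *m A b x + J x *m partial_mx a (A b) x).
  rewrite (eq_partial_mx_on U_open a Ux (J_par b)) partial_mxB;
    try exact: differentiable_mxM.
  by rewrite !partial_mxM // !J_par.
apply/eqP; rewrite -subr_eq0; apply/eqP.
have := partial_mxC U_open i j Ux J_smooth; rewrite !partial2 => /eqP.
rewrite -subr_eq0 => /eqP <-; rewrite /curvature_mx.
by matrix_ring.
Qed.

Lemma curvature_parallel_form g i j : smooth_mx U g -> parallel_form g ->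
  curvature_mx i j x *m g x + g x *m (curvature_mx i j x)^T = 0.
Proof.
move=> g_smooth g_par.
have g_diff : differentiable_mx g x by exact: smooth_mx_differentiable Ux.
have AT_diff k : differentiable_mx (fun y => (A k y)^T) x.
  exact: differentiable_mx_tr.
have partial2 a b : partial_mx a (partial_mx b g) x =
    partial_mx a (A b) x *m g x + A b x *m (A a x *m g x + g x *m (A a x)^T)
    + ((A a x *m g x + g x *m (A a x)^T) *m (A b x)^T
       + g x *m (partial_mx a (A b) x)^T).
  rewrite (eq_partial_mx_on U_open a Ux (g_par b)) partial_mxD;
    try exact: differentiable_mxM.
  by rewrite !partial_mxM // !g_par // partial_mx_tr.
have := partial_mxC U_open i j Ux g_smooth; rewrite !partial2 => /eqP.
rewrite -subr_eq0 => /eqP <-; rewrite /curvature_mx.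
have trD (X Y : 'M[R]_n) : (X + Y)^T = X^T + Y^T by rewrite linearD.
have trN (X : 'M[R]_n) : (- X)^T = - X^T by rewrite linearN.
by rewrite !(trD, trN, trmx_mul); matrix_ring.
Qed.

Lemma first_bianchi i j l p : torsion_free -> curvature_mx i j x l p
  + curvature_mx j l x i p + curvature_mx l i x j p = 0.
Proof.
move=> A_sym; have partial_sym a b c :
    partial_mx a (A b) x c p = partial_mx a (A c) x b p.
  rewrite !partial_mxE; apply: (eq_partial_on a U_open Ux) => y.
  exact: A_sym.
have mul_sym a b c : (A a x *m A b x) c p = (A c x *m A b x) a p.
  by rewrite [LHS]mxE [RHS]mxE; apply: eq_bigr => q _; rewrite A_sym.
have entryE (P Q S T : 'M[R]_n) a :
    (P - Q + (S - T)) a p = P a p - Q a p + (S a p - T a p) by rewrite !mxE.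
rewrite /curvature_mx !entryE (partial_sym i j l) (partial_sym j i l).
rewrite (partial_sym l i j) (mul_sym j i l) (mul_sym i j l) (mul_sym i l j).
by ring.
Qed.

End AtPoint.
End Connections.

HB.lock Definition christoffel_mx (R : realType) (n : nat)
    (g : 'rV[R]_n -> 'M[R]_n) (i : 'I_n) (x : 'rV[R]_n) : 'M[R]_n :=
  \matrix_(j, k) christoffel g k i j x.

Lemma christoffel_mxE (R : realType) (n : nat) (g : 'rV[R]_n -> 'M[R]_n)
    i x j k :
  christoffel_mx g i x j k = christoffel g k i j x.
Proof. by rewrite christoffel_mx.unlock mxE. Qed.

Record metric_on (R : realType) (n : nat) (U : set 'rV[R]_n)
    (g : 'rV[R]_n -> 'M[R]_n) : Prop := MetricOn {
  mo_open : open U;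
  mo_smooth : smooth_mx U g;
  mo_posdef : forall x, U x -> posdef_mx (g x) }.

Section LeviCivita.
Context {R : realType} {n : nat} (U : set 'rV[R]_n) (g : 'rV[R]_n -> 'M[R]_n).
Hypothesis gU : metric_on U g.

Let U_open : open U := mo_open gU.

Lemma metric_sym x : U x -> (g x)^T = g x.
Proof. by move=> /(mo_posdef gU)[]. Qed.

Lemma metric_unitmx x : U x -> g x \in unitmx.
Proof. by move=> /(mo_posdef gU); exact: posdef_unitmx. Qed.

Let partial_sym i j l x : U x ->
  partial i (fun y => g y j l) x = partial i (fun y => g y l j) x.
Proof.
move=> Ux; apply: (eq_partial_on i U_open Ux) => y Uy.
by rewrite -[in LHS](metric_sym Uy) mxE.
Qed.

Lemma koszul i j l x : U x -> (christoffel_mx g i x *m g x) j l =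
  2^-1 * (partial i (fun y => g y j l) x + partial j (fun y => g y i l) x
          - partial l (fun y => g y i j) x).
Proof.
move=> Ux; pose K := \matrix_(j, l) (2^-1 *
  (partial i (fun y => g y j l) x + partial j (fun y => g y i l) x
   - partial l (fun y => g y i j) x)).
have -> : christoffel_mx g i x = K *m invmx (g x).
  apply/matrixP => a b; rewrite [RHS]mxE christoffel_mxE /christoffel mulr_sumr.
  apply: eq_bigr => c _; rewrite mxE mulrCA mulrC.
  by rewrite -[in RHS](metric_sym Ux) -trmx_inv mxE.
by rewrite mulmxKV ?metric_unitmx // mxE.
Qed.

Lemma christoffel_mx_torsion_free : torsion_free U (christoffel_mx g).
Proof.
move=> i j k x Ux; rewrite !christoffel_mxE /christoffel; congr (_ * _).
apply: eq_bigr => l _; congr (_ * _).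
by rewrite (partial_sym l i j Ux); ring.
Qed.

Lemma christoffel_mx_parallel : parallel_form U (christoffel_mx g) g.
Proof.
move=> i x Ux; have -> : g x *m (christoffel_mx g i x)^T =
    (christoffel_mx g i x *m g x)^T by rewrite trmx_mul metric_sym.
apply/matrixP => j l; rewrite partial_mxE.
have entryE (K : 'M[R]_n) : (K + K^T) j l = K j l + K l j by rewrite !mxE.
by rewrite entryE !koszul // (partial_sym i l j Ux); field.
Qed.

Lemma christoffel_mx_unique (A : 'I_n -> 'M[R]_n) x : U x ->
  (forall i j k, A i j k = A j i k) ->
  (forall i, partial_mx i g x = A i *m g x + g x *m (A i)^T) ->
  forall i, A i = christoffel_mx g i x.
Proof.
move=> Ux A_sym A_metric i; rewrite -[A i](mulmxK (metric_unitmx Ux)).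
rewrite -[christoffel_mx g i x](mulmxK (metric_unitmx Ux)); congr (_ *m _).
pose K i j l := (A i *m g x) j l.
have K_sym a b c : K a b c = K b a c.
  by rewrite /K !mxE; apply: eq_bigr => k _; rewrite A_sym.
have partialE a b c : partial a (fun y => g y b c) x = K a b c + K a c b.
  have := congr1 (fun M : 'M[R]_n => M b c) (A_metric a).
  rewrite (_ : g x *m (A a)^T = (A a *m g x)^T); last first.
    by rewrite trmx_mul metric_sym.
  by rewrite /K; move: (A a *m g x) => P; rewrite partial_mxE !mxE.
apply/matrixP => j l; rewrite koszul // -/(K i j l) !partialE.
by rewrite (K_sym j i l) (K_sym l i j) (K_sym l j i); field.
Qed.

Lemma christoffel_mx_smooth i : smooth_mx U (christoffel_mx g i).
Proof.
move=> j k; under eq_fun do rewrite christoffel_mxE.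
apply: (smooth_onM U_open); first exact: smooth_on_cst.
apply: (smooth_on_sum U_open) => l; apply: (smooth_onM U_open).
  exact: (smooth_mx_inv U_open metric_unitmx (mo_smooth gU)).
have partial_smooth a b c : smooth_on U (partial a (fun y => g y b c)).
  exact: smooth_on_partial (mo_smooth gU b c).
by apply: (smooth_onD U_open); [exact: smooth_onD|exact: smooth_onN].
Qed.

End LeviCivita.

Section RiemannTensor.
Context {R : realType} {n : nat} (g : 'rV[R]_n -> 'M[R]_n).
Implicit Types (x X Y Z W : 'rV[R]_n).

Local Notation F := (curvature_mx (christoffel_mx g)).

Lemma riemann_coefE i j k l x :
  riemann_coef g i j k l x = \sum_p g x k p * F i j x l p.
Proof.
apply: eq_bigr => p _; congr (_ * _); rewrite /curvature_mx.
have partialE a b : partial_mx a (christoffel_mx g b) x l p =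
    partial a (christoffel g p b l) x.
  rewrite partial_mxE; congr (partial _ _ x); apply/funext => y.
  by rewrite christoffel_mxE.
have mulE a b : (christoffel_mx g b x *m christoffel_mx g a x) l p =
    \sum_q christoffel g p a q x * christoffel g q b l x.
  by rewrite mxE; apply: eq_bigr => q _; rewrite !christoffel_mxE mulrC.
have entryE (P Q S T : 'M[R]_n) :
    (P - Q + (S - T)) l p = P l p - Q l p + (S l p - T l p) by rewrite !mxE.
by rewrite entryE !partialE !mulE sumrB.
Qed.

Definition curvature_endo x X Y : 'M[R]_n :=
  \sum_i \sum_j (X ord0 i * Y ord0 j) *: F i j x.

Lemma curvature_endo_delta x i j :
  curvature_endo x (delta_mx ord0 i) (delta_mx ord0 j) = F i j x.
Proof.
rewrite /curvature_endo (bigD1 i) //= [X in _ + X]big1 ?addr0 => [|a ai].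
  rewrite (bigD1 j) //= [X in _ + X]big1 ?addr0 => [|b bj].
    by rewrite !mxE !eqxx mulr1 scale1r.
  by rewrite !mxE (negbTE bj) andbF mulr0 scale0r.
by rewrite big1 // => b _; rewrite !mxE (negbTE ai) andbF mul0r scale0r.
Qed.

Lemma curvature_endo_anti x X Y : curvature_endo x Y X = - curvature_endo x X Y.
Proof.
rewrite /curvature_endo exchange_big /= -sumrN; apply: eq_bigr => i _.
rewrite -sumrN; apply: eq_bigr => j _.
by rewrite curvature_mx_anti scalerN mulrC.
Qed.

Lemma curvature_endo_linear x a X X' Y : curvature_endo x (a *: X + X') Y =
  a *: curvature_endo x X Y + curvature_endo x X' Y.
Proof.
rewrite /curvature_endo scaler_sumr -big_split; apply: eq_bigr => i _ /=.
rewrite scaler_sumr -big_split; apply: eq_bigr => j _ /=.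
by rewrite !mxE mulrDl scalerDl scalerA mulrA.
Qed.

Lemma riemannE x X Y Z W :
  riemann g x X Y Z W = mxform (curvature_endo x X Y *m (g x)^T) W Z.
Proof.
have mxform_sum (E : 'I_n -> 'I_n -> 'M[R]_n) (a : 'I_n -> 'I_n -> R) :
    mxform ((\sum_i \sum_j a i j *: E i j) *m (g x)^T) W Z =
    \sum_i \sum_j a i j * mxform (E i j *m (g x)^T) W Z.
  rewrite mulmx_suml /mxform mulmx_sumr mulmx_suml summxE.
  apply: eq_bigr => i _; rewrite mulmx_suml mulmx_sumr mulmx_suml summxE.
  by apply: eq_bigr => j _; rewrite -scalemxAl -scalemxAr -scalemxAl mxE.
rewrite mxform_sum; apply: eq_bigr => i _; apply: eq_bigr => j _.
rewrite mxformE mulr_sumr exchange_big /=; apply: eq_bigr => l _.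
rewrite mulr_sumr; apply: eq_bigr => k _; rewrite riemann_coefE.
rewrite [(_ *m _) l k]mxE (eq_bigr (fun p => F i j x l p * (g x)^T p k)).
  by ring.
by move=> p _; rewrite [_^T _ _]mxE mulrC.
Qed.

Lemma differentiable_riemann (V1 V2 V3 V4 : 'rV[R]_n -> 'rV[R]_n) x :
  (forall i j, differentiable_mx (F i j) x) -> differentiable_mx g x ->
  differentiable_mx V1 x -> differentiable_mx V2 x ->
  differentiable_mx V3 x -> differentiable_mx V4 x ->
  differentiable (fun y => riemann g y (V1 y) (V2 y) (V3 y) (V4 y)) x.
Proof.
move=> dF dg dV1 dV2 dV3 dV4.
apply: differentiable_bigsum => i; apply: differentiable_bigsum => j.
apply: differentiable_bigsum => k; apply: differentiable_bigsum => l.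
apply: differentiableM => //; apply: differentiableM => //.
apply: differentiableM => //; apply: differentiableM => //.
rewrite (_ : riemann_coef g i j k l = fun y => \sum_p g y k p * F i j y l p).
  apply: differentiable_bigsum => p.
  by apply: differentiableM; [exact: dg|exact: dF].
by apply/funext => y; exact: riemann_coefE.
Qed.

Variable U : set 'rV[R]_n.
Hypothesis gU : metric_on U g.

Lemma curvature_endo_skew x X Y : U x ->
  curvature_endo x X Y *m g x = - (g x *m (curvature_endo x X Y)^T).
Proof.
move=> Ux; rewrite /curvature_endo mulmx_suml linear_sum mulmx_sumr -sumrN.
apply: eq_bigr => i _; rewrite mulmx_suml linear_sum mulmx_sumr -sumrN.
apply: eq_bigr => j _; rewrite -scalemxAl linearZ /= -scalemxAr -scalerN.
congr (_ *: _); apply/eqP; rewrite -addr_eq0; apply/eqP.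
apply: (curvature_parallel_form (mo_open gU) _ Ux).
- exact: christoffel_mx_smooth.
- exact: mo_smooth.
- exact: christoffel_mx_parallel.
Qed.

Lemma curvature_endo_parallel J x X Y : smooth_mx U J ->
  parallel_endo U (christoffel_mx g) J -> U x ->
  curvature_endo x X Y *m J x = J x *m curvature_endo x X Y.
Proof.
move=> J_smooth J_par Ux; rewrite /curvature_endo mulmx_suml mulmx_sumr.
apply: eq_bigr => i _; rewrite mulmx_suml mulmx_sumr; apply: eq_bigr => j _.
rewrite -scalemxAl -scalemxAr.
by rewrite (curvature_parallel_endo (mo_open gU) (christoffel_mx_smooth gU) Ux).
Qed.

Lemma curvature_endo_bianchi x X Y W : U x ->
  W *m curvature_endo x X Y + X *m curvature_endo x Y W
  + Y *m curvature_endo x W X = 0.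
Proof.
move=> Ux; apply/rowP => p.
have entryE (A B C : 'rV[R]_n) : (C *m curvature_endo x A B) ord0 p =
    trilinear (fun i j l => F i j x l p) A B C.
  rewrite /curvature_endo mulmx_sumr summxE; apply: eq_bigr => i _.
  rewrite mulmx_sumr summxE; apply: eq_bigr => j _.
  rewrite -scalemxAr [LHS]mxE [X in _ * X]mxE mulr_sumr.
  by apply: eq_bigr => l _; rewrite mulrA.
rewrite mxE [X in X + _]mxE [RHS]mxE !entryE; apply: trilinear_cyclic => i j l.
apply: (first_bianchi (mo_open gU) Ux); exact: christoffel_mx_torsion_free.
Qed.

End RiemannTensor.

(** * Schur's lemma for Kähler metrics *)

Section HermitianAlgebra.
Context {R : rcfType} {n : nat} (g J : 'M[R]_n).
Implicit Types (X Y Z W : 'rV[R]_n).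

Lemma mxtrace_ip_frame (F : 'M[R]_n) (e : 'I_n -> 'rV[R]_n) :
  (forall i j, mxform g (e i) (e j) = (i == j)%:R) ->
  \tr F = \sum_i mxform (F *m g) (e i) (e i).
Proof.
move=> e_orth; pose E := \matrix_i e i.
have EgE : E *m (g *m E^T) = 1%:M.
  by apply/matrixP => i j; rewrite mulmxA mxform_rows e_orth mxE.
rewrite -[F in LHS]mulmx1 -(mulmx1C EgE) mulmxA mxtrace_mulC !mulmxA.
by apply: eq_bigr => i _; rewrite -[E *m F *m g]mulmxA mxform_rows.
Qed.

Hypothesis gJ : hermitian_mx g J.

Lemma hsc_model_ricci_form (F : 'M[R]_n) X Y c :
  (forall Z W, mxform (F *m g) W Z =
    c / 4 * hsc_model (mxform g) (fun X => X *m J) X Y Z W) ->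
  \tr (F *m J) = - (c * (n%:R + 2) / 2) * mxform (g *m J^T) X Y.
Proof.
move=> FE; have gJ_struct := hermitian_mx_structure gJ.
have [|e e_frame] := @exists_ip_frame _ _ _ (hs_inner gJ_struct) n.
  by rewrite dimvf dim_matrix mul1r.
rewrite (mxtrace_ip_frame _ (proj1 e_frame)).
under eq_bigr => i _.
  rewrite -[F *m J *m g]mulmxA -[J *m g]opprK -(hermitian_mx_skew gJ) mulmxN.
  rewrite mulmxA mxformN -mxform_mulr FE -mulrN; over.
rewrite -mulr_sumr sumrN (hsc_model_ricci X Y gJ_struct e_frame) mxform_mulr.
by field.
Qed.

Lemma exists_orthogonal2 (u v : 'cV[R]_n) : (2 < n)%N ->
  exists2 X : 'rV[R]_n, X != 0 & X *m u = 0 /\ X *m v = 0.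
Proof.
move=> n_gt2; have : kermx (row_mx u v) != 0.
  rewrite kermx_eq0 /row_free; apply/negP => /eqP rank_uv.
  by have := rank_leq_col (row_mx u v); rewrite rank_uv leqNgt n_gt2.
move=> /rowV0Pn[X /sub_kermxP + X_neq0]; rewrite mul_mx_row => /eqP.
by rewrite row_mx_eq0 => /andP[/eqP Xu /eqP Xv]; exists X.
Qed.

(* Wedging with the Kähler form is injective on covectors: for n > 2 every Z
   has a nonzero X orthogonal to both Z and JZ, and only one term of the
   cyclic sum survives on (X, JX, Z). *)
Lemma wedge_kahler_form_eq0 (a : 'I_n -> R) : (2 < n)%N ->
  (forall i j k, (g *m J^T) i j * a k + (g *m J^T) j k * a i
     + (g *m J^T) k i * a j = 0) ->
  forall k, a k = 0.
Proof.
move=> n_gt2 wedge0 k; pose omega := g *m J^T.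
pose Z : 'rV[R]_n := delta_mx ord0 k.
have trilinearE X Y W : trilinear (fun i j l => omega i j * a l) X Y W =
    mxform omega X Y * \sum_l W ord0 l * a l.
  rewrite mxformE mulr_suml; apply: eq_bigr => i _; rewrite mulr_suml.
  by apply: eq_bigr => j _; rewrite mulr_sumr; apply: eq_bigr => l _; ring.
have aZ : \sum_l Z ord0 l * a l = a k.
  rewrite (bigD1 k) //= mxE !eqxx mul1r big1 ?addr0 // => l lk.
  by rewrite mxE (negbTE lk) mul0r.
have [X X_neq0 [XZ XJZ]] :=
  exists_orthogonal2 (g *m Z^T) (g *m (Z *m J)^T) n_gt2.
have := trilinear_cyclic X (X *m J) Z wedge0.
rewrite !trilinearE aZ /omega -!mxform_mulr.
have := hs_isometry (hermitian_mx_structure gJ) => /= isom.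
have [g_posdef JJ _] := gJ.
rewrite -[X *m J *m J]mulmxA JJ mulmxN mulmx1 (ipNr (posdef_inner g_posdef)).
rewrite isom [mxform g X Z](_ : _ = 0) ?mul0r ?addr0; last first.
  by rewrite /mxform -mulmxA XZ mxE.
have -> : mxform g Z (X *m J) = 0.
  rewrite -isom -[X *m J *m J]mulmxA JJ mulmxN mulmx1.
  rewrite (ipNr (posdef_inner g_posdef)) (ip_sym (posdef_inner g_posdef)).
  by rewrite /mxform -mulmxA XJZ mxE oppr0.
rewrite mul0r addr0 => /eqP; rewrite mulf_eq0 oppr_eq0 gt_eqF /=.
  by move=> /eqP.
exact: (proj2 g_posdef).
Qed.

End HermitianAlgebra.

Record kahler_on (R : realType) (n : nat) (U : set 'rV[R]_n)
    (g J : 'rV[R]_n -> 'M[R]_n) : Prop := KahlerOn {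
  ko_metric : metric_on U g;
  ko_smooth : smooth_mx U J;
  ko_hermitian : forall x, U x -> hermitian_mx (g x) (J x);
  ko_parallel : parallel_endo U (christoffel_mx g) J }.

Section LocalKahler.
Context {R : realType} {n : nat} (U : set 'rV[R]_n) (g J : 'rV[R]_n -> 'M[R]_n).
Hypothesis gJ : kahler_on U g J.

Let U_open : open U := mo_open (ko_metric gJ).
Let F := curvature_mx (christoffel_mx g).

Lemma riemann_kahler x : U x ->
  kahler_tensor (fun X => X *m J x) (riemann g x).
Proof.
move=> Ux; have gU := ko_metric gJ; have gT := metric_sym gU Ux.
have [_ _ JgJ] := ko_hermitian gJ Ux.
have anti34 X Y Z W : riemann g x X Y W Z = - riemann g x X Y Z W.
  rewrite !riemannE gT -mxform_tr trmx_mul gT.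
  by rewrite (curvature_endo_skew gU) // mxformN opprK.
split=> [a X X'|X|X|X|X] Y Z W.
- by rewrite !riemannE curvature_endo_linear mulmxDl -scalemxAl mxform_linear.
- by rewrite !riemannE curvature_endo_anti mulNmx mxformN.
- exact: anti34.
- rewrite (anti34 X Y W Z) (anti34 Y Z W X) (anti34 Z X W Y) -!opprD.
  rewrite !riemannE gT -!mxform_mull.
  have ip := posdef_inner (mo_posdef gU Ux).
  by rewrite -!(ipDl ip) (curvature_endo_bianchi gU) // (ip0l ip) oppr0.
- rewrite !riemannE gT mxform_mull mxform_mulr mulmxA.
  rewrite -(curvature_endo_parallel gU _ _ (ko_smooth gJ) (ko_parallel gJ) Ux).
  by rewrite -!mulmxA (mulmxA (J x)) JgJ.
Qed.

Lemma riemann_const_hsc x c : U x ->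
  (forall X, riemann g x X (X *m J x) X (X *m J x) =
    c * mxform (g x) X X ^+ 2) ->
  forall X Y Z W, riemann g x X Y Z W =
    c / 4 * hsc_model (mxform (g x)) (fun X => X *m J x) X Y Z W.
Proof.
move=> Ux hsc; have gJ_struct := hermitian_mx_structure (ko_hermitian gJ Ux).
exact: (kt_const_hsc gJ_struct (riemann_kahler Ux) hsc).
Qed.

Definition ricci_form i j x : R := \tr (F i j x *m J x).
Definition kahler_form x : 'M[R]_n := g x *m (J x)^T.

Section AtPoint.
Variable x : 'rV[R]_n.
Hypothesis Ux : U x.

Let g_diff : differentiable_mx g x.
Proof. exact: smooth_mx_differentiable (mo_smooth (ko_metric gJ)) Ux. Qed.
Let J_diff : differentiable_mx J x.
Proof. exact: smooth_mx_differentiable (ko_smooth gJ) Ux. Qed.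
Let F_diff i j : differentiable_mx (F i j) x.
Proof.
have A_smooth := christoffel_mx_smooth (ko_metric gJ).
exact: (curvature_mx_differentiable A_smooth Ux).
Qed.

Lemma ricci_form_closed i j k : partial k (ricci_form i j) x
  + partial i (ricci_form j k) x + partial j (ricci_form k i) x = 0.
Proof.
have partialE a b c : partial c (ricci_form a b) x =
    \tr (cov_deriv_curvature (christoffel_mx g) c a b x *m J x).
  rewrite partial_mxtrace; last exact: differentiable_mxM.
  rewrite partial_mxM // (ko_parallel gJ) // /cov_deriv_curvature -/F.
  move: (partial_mx c _ x) (F a b x) (J x) (christoffel_mx g c x) => P K L A.
  rewrite mulmxBr mulmxBl mulmxDl addrA !mulmxA ![\tr (_ - _)]linearB /=.
  by congr (_ - _); rewrite mxtrace_mulC mulmxA.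
have A_smooth := christoffel_mx_smooth (ko_metric gJ).
rewrite !partialE -!mxtraceD -!mulmxDl (second_bianchi U_open A_smooth Ux).
by rewrite mul0mx mxtrace0.
Qed.

Lemma partial_kahler_form k : partial_mx k kahler_form x =
  christoffel_mx g k x *m kahler_form x
  + kahler_form x *m (christoffel_mx g k x)^T.
Proof.
have gU := ko_metric gJ.
rewrite partial_mxM //; last exact: differentiable_mx_tr.
rewrite partial_mx_tr (ko_parallel gJ) // (christoffel_mx_parallel gU) //.
rewrite linearB /= !trmx_mul mulmxDl mulmxBr /kahler_form !mulmxA.
by rewrite addrACA subrr addr0.
Qed.

Lemma kahler_form_anti i j : kahler_form x i j = - kahler_form x j i.
Proof.
have gJx := ko_hermitian gJ Ux.
have /matrixP/(_ j i) : (kahler_form x)^T = - kahler_form x.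
  rewrite /kahler_form trmx_mul trmxK (hermitian_mx_skew gJx) opprK.
  by rewrite (metric_sym (ko_metric gJ) Ux).
by rewrite mxE => ->; rewrite mxE.
Qed.

Lemma kahler_form_closed i j k : partial_mx k kahler_form x i j
  + partial_mx i kahler_form x j k + partial_mx j kahler_form x k i = 0.
Proof.
have entryE a b c : partial_mx c kahler_form x a b =
    \sum_q (christoffel_mx g c x a q * kahler_form x q b
            - christoffel_mx g c x b q * kahler_form x q a).
  rewrite partial_kahler_form mxE [X in X + _]mxE [X in _ + X]mxE -big_split.
  apply: eq_bigr => q _ /=.
  rewrite [_^T _ _]mxE (kahler_form_anti a q) mulNr.
  by rewrite (mulrC (kahler_form x q a)).
rewrite !entryE -!big_split big1 // => q _ /=.
have A_sym a b : christoffel_mx g a x b q = christoffel_mx g b x a q.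
  exact: christoffel_mx_torsion_free (ko_metric gJ) _ _ _ _ Ux.
by rewrite (A_sym i k) (A_sym j k) (A_sym j i); ring.
Qed.

End AtPoint.

Variable c : 'rV[R]_n -> R.
Hypothesis hsc : forall x, U x -> forall X,
  riemann g x X (X *m J x) X (X *m J x) = c x * mxform (g x) X X ^+ 2.

Lemma hsc_ricci_form i j x : U x ->
  ricci_form i j x = - (c x * (n%:R + 2) / 2) * kahler_form x i j.
Proof.
move=> Ux; rewrite -[kahler_form x i j]mxform_delta.
apply: (hsc_model_ricci_form (ko_hermitian gJ Ux)) => Z W.
rewrite -(riemann_const_hsc Ux (hsc Ux)) riemannE curvature_endo_delta.
by rewrite (metric_sym (ko_metric gJ) Ux).
Qed.

Lemma hsc_differentiable x : (0 < n)%N -> U x -> differentiable c x.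
Proof.
move=> n_gt0 Ux; pose X : 'rV[R]_n := delta_mx ord0 (Ordinal n_gt0).
have X_neq0 : X != 0.
  apply/eqP => /matrixP/(_ ord0 (Ordinal n_gt0))/eqP.
  by rewrite !mxE !eqxx oner_eq0.
have norm_gt0 y : U y -> 0 < mxform (g y) X X.
  by move=> /(mo_posdef (ko_metric gJ))[_]; exact.
have cE y : U y -> riemann g y X (X *m J y) X (X *m J y) *
    ((mxform (g y) X X)^-1 * (mxform (g y) X X)^-1) = c y.
  by move=> Uy; rewrite (hsc Uy); field; rewrite gt_eqF ?norm_gt0.
apply: near_eq_differentiable (open_near_eq U_open Ux cE) _.
have X_diff : differentiable_mx (fun=> X) x by exact: differentiable_mx_cst.
have g_diff := smooth_mx_differentiable (mo_smooth (ko_metric gJ)) Ux.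
have J_diff := smooth_mx_differentiable (ko_smooth gJ) Ux.
have XJ_diff := differentiable_mxM X_diff J_diff.
have norm_diff : differentiable (fun y => (mxform (g y) X X)^-1) x.
  apply: differentiableV; last by rewrite gt_eqF ?norm_gt0.
  have XT_diff : differentiable_mx (fun=> X^T) x.
    exact: differentiable_mx_cst.
  exact: (differentiable_mxM (differentiable_mxM X_diff g_diff) XT_diff).
apply: differentiableM; last exact: differentiableM.
apply: differentiable_riemann => // i j.
have A_smooth := christoffel_mx_smooth (ko_metric gJ).
exact: (curvature_mx_differentiable A_smooth Ux).
Qed.

Lemma partial_hsc_wedge i j k x : (0 < n)%N -> U x ->
  kahler_form x i j * partial k c x + kahler_form x j k * partial i c x
  + kahler_form x k i * partial j c x = 0.
Proof.
move=> n_gt0 Ux; have c_diff := hsc_differentiable n_gt0 Ux.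
have form_diff : differentiable_mx kahler_form x.
  apply: differentiable_mxM; last apply: differentiable_mx_tr.
    exact: smooth_mx_differentiable (mo_smooth (ko_metric gJ)) Ux.
  exact: smooth_mx_differentiable (ko_smooth gJ) Ux.
pose K : R := - ((n%:R + 2) / 2).
have K_neq0 : K != 0 by rewrite oppr_eq0 gt_eqF // divr_gt0 // ltr_wpDl.
have partialE a b d : partial d (ricci_form a b) x =
    K * (partial d c x * kahler_form x a b
         + c x * partial_mx d kahler_form x a b).
  rewrite (@eq_partial_on _ _ U _ (fun y => K * (c y * kahler_form y a b)) d x
    U_open Ux).
    rewrite partialM; [|exact: differentiable_cst|exact: differentiableM].
    by rewrite partial_cst mul0r add0r partialM // partial_mxE.
  by move=> y Uy; rewrite hsc_ricci_form // /K; field.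
have := ricci_form_closed Ux i j k; rewrite !partialE -!mulrDr => /eqP.
rewrite mulf_eq0 (negbTE K_neq0) /= => /eqP c_closed.
have /(congr1 ( *%R (c x))) := kahler_form_closed Ux i j k.
move: c_closed; rewrite mulr0.
move: (partial_mx k _ _ _ _) (partial_mx i _ _ _ _) (partial_mx j _ _ _ _).
move: (partial k c x) (partial i c x) (partial j c x) => *.
by lra.
Qed.

Lemma schur_kahler k x : (2 < n)%N -> U x -> partial k c x = 0.
Proof.
move=> n_gt2 Ux; apply: (wedge_kahler_form_eq0 (ko_hermitian gJ Ux)
  (a := fun k => partial k c x)) => // i j l.
exact: partial_hsc_wedge (ltnW (ltnW n_gt2)) Ux.
Qed.

End LocalKahler.

(** * Change of chart *)

Section SmoothMaps.
Context {R : realType} {n : nat} (U : set 'rV[R]_n) (f : 'rV[R]_n -> 'rV[R]_n).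
Hypothesis U_open : open U.
Hypothesis f_smooth : smooth_mx U f.

Lemma smooth_map_differentiable x : U x -> differentiable f x.
Proof.
move=> Ux; have -> : f = \sum_(k < n) (fun x => f x ord0 k *: delta_mx ord0 k).
  by apply/funext => y; rewrite fct_sumE [LHS]row_sum_delta.
apply: differentiable_sum => k; apply: differentiableZl.
exact: smooth_on_differentiable (f_smooth ord0 k) Ux.
Qed.

Lemma jacobianE x j p : U x ->
  'J f x j p = partial j (fun y => f y ord0 p) x.
Proof.
move=> Ux; have df := smooth_map_differentiable Ux; rewrite mxE /partial.
have := derive_mx (diff_derivable (v := delta_mx ord0 j) df).
rewrite (deriveE _ df) => /(congr1 (fun M : 'rV[R]_n => M ord0 p)).
by rewrite [RHS]mxE.
Qed.

Lemma jacobian_smooth : smooth_mx U (fun x => 'J f x).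
Proof.
move=> j p; apply: (eq_smooth_on U_open (f := partial j (fun y => f y ord0 p))).
  by move=> x Ux; rewrite jacobianE.
exact: smooth_on_partial.
Qed.

Lemma partial_jacobian_sym i j p x : U x ->
  partial_mx i (fun y => 'J f y) x j p = partial_mx j (fun y => 'J f y) x i p.
Proof.
move=> Ux; rewrite !partial_mxE.
rewrite (eq_partial_on i U_open Ux (fun y Uy => jacobianE j p Uy)).
rewrite (eq_partial_on j U_open Ux (fun y Uy => jacobianE i p Uy)).
exact: (smooth_on_partialC U_open i j (f_smooth ord0 p) Ux).
Qed.

Lemma partial_comp (h : 'rV[R]_n -> R) i x : U x -> differentiable h (f x) ->
  partial i (fun y => h (f y)) x = \sum_p 'J f x i p * partial p h (f x).
Proof.
move=> Ux dh; have df := smooth_map_differentiable Ux.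
have dhf : differentiable (h \o f) x by exact: differentiable_comp.
rewrite /partial (deriveE (f := h \o f)) // diff_comp //= diff_partialE //.
by apply: eq_bigr => p _; rewrite mxE.
Qed.

Lemma partial_mx_comp k l (M : 'rV[R]_n -> 'M[R]_(k, l)) i x : U x ->
  differentiable_mx M (f x) ->
  partial_mx i (fun y => M (f y)) x = \sum_p 'J f x i p *: partial_mx p M (f x).
Proof.
move=> Ux dM; apply/matrixP => a b; rewrite partial_mxE.
rewrite (partial_comp (h := fun y => M y a b)) // summxE.
by apply: eq_bigr => p _; rewrite [RHS]mxE partial_mxE.
Qed.

Lemma differentiable_mx_comp k l (M : 'rV[R]_n -> 'M[R]_(k, l)) x : U x ->
  differentiable_mx M (f x) -> differentiable_mx (fun y => M (f y)) x.
Proof.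
move=> Ux dM a b; apply: (differentiable_comp (g := fun y => M y a b)) => //.
exact: smooth_map_differentiable.
Qed.

End SmoothMaps.

Section GaugeChange.
Context {R : realType} {n : nat} (U : set 'rV[R]_n).
Variables (A B : 'I_n -> 'rV[R]_n -> 'M[R]_n) (D : 'rV[R]_n -> 'M[R]_n).
Hypothesis U_open : open U.
Hypothesis A_diff : forall i x, U x -> differentiable_mx (A i) x.
Hypothesis B_diff : forall i x, U x -> differentiable_mx (B i) x.
Hypothesis D_smooth : smooth_mx U D.
Hypothesis gauge : forall i x, U x ->
  A i x *m D x = partial_mx i D x + D x *m B i x.

Lemma curvature_gauge i j x : U x ->
  curvature_mx A i j x *m D x = D x *m curvature_mx B i j x.
Proof.
move=> Ux.
have D_diff : differentiable_mx D x by exact: smooth_mx_differentiable Ux.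
have A_diffx a := A_diff a Ux; have B_diffx a := B_diff a Ux.
have partial_gauge a b : partial_mx a (A b) x *m D x =
    partial_mx a (partial_mx b D) x
    + (partial_mx a D x *m B b x + D x *m partial_mx a (B b) x)
    - A b x *m partial_mx a D x.
  apply/eqP; rewrite eq_sym subr_eq -(partial_mxM a (A_diffx b) D_diff).
  apply/eqP; rewrite (eq_partial_mx_on U_open a Ux (gauge b)) partial_mxD.
  - by rewrite partial_mxM.
  - exact: smooth_mx_differentiable (smooth_mx_partial b D_smooth) Ux.
  - exact: differentiable_mxM.
have mul_gauge a b : A a x *m A b x *m D x = A a x *m partial_mx b D x
    + partial_mx a D x *m B b x + D x *m B a x *m B b x.
  by rewrite -mulmxA gauge // mulmxDr mulmxA gauge // mulmxDl addrA.
rewrite /curvature_mx !mulmxDl !mulNmx !mul_gauge !partial_gauge.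
rewrite (partial_mxC U_open i j Ux D_smooth).
by matrix_ring.
Qed.

End GaugeChange.

Section PullbackConnection.
Context {R : realType} {n : nat} (U U' : set 'rV[R]_n).
Variables (f : 'rV[R]_n -> 'rV[R]_n) (A : 'I_n -> 'rV[R]_n -> 'M[R]_n).
Hypothesis U_open : open U.
Hypothesis f_smooth : smooth_mx U f.
Hypothesis fU : forall x, U x -> U' (f x).
Hypothesis A_smooth : forall i, smooth_mx U' (A i).

Definition pullback_conn (i : 'I_n) (x : 'rV[R]_n) : 'M[R]_n :=
  \sum_p 'J f x i p *: A p (f x).

Lemma pullback_connE i x a b :
  pullback_conn i x a b = \sum_p 'J f x i p * A p (f x) a b.
Proof. by rewrite summxE; apply: eq_bigr => p _; rewrite mxE. Qed.

Let J_diff x : U x -> differentiable_mx (fun y => 'J f y) x.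
Proof. exact: smooth_mx_differentiable (jacobian_smooth U_open f_smooth). Qed.

Let A_diff p x : U x -> differentiable_mx (A p) (f x).
Proof. by move=> /fU; exact: smooth_mx_differentiable (A_smooth p). Qed.

Let Af_diff p x : U x -> differentiable_mx (fun y => A p (f y)) x.
Proof.
by move=> Ux; exact: (differentiable_mx_comp f_smooth Ux (A_diff p Ux)).
Qed.

Lemma pullback_conn_differentiable i x :
  U x -> differentiable_mx (pullback_conn i) x.
Proof.
move=> Ux a b; under eq_fun do rewrite pullback_connE.
apply: differentiable_bigsum => p; apply: differentiableM; first exact: J_diff.
exact: Af_diff.
Qed.

Lemma partial_pullback_conn i j x : U x -> partial_mx i (pullback_conn j) x =
  \sum_p partial_mx i (fun y => 'J f y) x j p *: A p (f x)
  + \sum_p \sum_q ('J f x i p * 'J f x j q) *: partial_mx p (A q) (f x).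
Proof.
move=> Ux; apply/matrixP => a b; rewrite partial_mxE.
under eq_fun do rewrite pullback_connE.
have J_entry p : differentiable (fun y => 'J f y j p) x by exact: J_diff.
have A_entry p : differentiable (fun y => A p (f y) a b) x by exact: Af_diff.
rewrite partial_sum => [|p]; last exact: differentiableM.
rewrite [X in _ + X]exchange_big /= -big_split summxE; apply: eq_bigr => p _ /=.
rewrite partialM // [RHS]mxE [X in _ = X + _]mxE partial_mxE; congr (_ + _).
have A_comp := partial_comp f_smooth i (h := fun y => A p y a b) Ux.
rewrite A_comp; last exact: A_diff.
rewrite mulr_sumr summxE; apply: eq_bigr => q _.
by rewrite [RHS]mxE partial_mxE mulrCA mulrA.
Qed.

Lemma mul_pullback_conn i j x : pullback_conn i x *m pullback_conn j x =
  \sum_p \sum_q ('J f x i p * 'J f x j q) *: (A p (f x) *m A q (f x)).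
Proof.
rewrite /pullback_conn mulmx_suml; apply: eq_bigr => p _.
rewrite mulmx_sumr; apply: eq_bigr => q _.
by rewrite -scalemxAl -scalemxAr scalerA.
Qed.

Lemma curvature_pullback i j x : U x -> curvature_mx pullback_conn i j x =
  \sum_p \sum_q ('J f x i p * 'J f x j q) *: curvature_mx A p q (f x).
Proof.
move=> Ux; have swap (K : 'I_n -> 'I_n -> 'M[R]_n) :
    \sum_p \sum_q ('J f x j p * 'J f x i q) *: K p q =
    \sum_p \sum_q ('J f x i p * 'J f x j q) *: K q p.
  rewrite exchange_big; apply: eq_bigr => p _; apply: eq_bigr => q _.
  by rewrite mulrC.
rewrite /curvature_mx !partial_pullback_conn // !mul_pullback_conn !swap.
rewrite (eq_bigr (fun p => partial_mx j (fun y => 'J f y) x i p *: A p (f x)));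
  last by move=> p _; rewrite (partial_jacobian_sym U_open f_smooth).
rewrite [X in X - _]addrC addrKA -!sumrB -big_split; apply: eq_bigr => p _ /=.
rewrite -!sumrB -big_split; apply: eq_bigr => q _ /=.
by rewrite -!scalerBr -scalerDr.
Qed.

End PullbackConnection.

Section ChartChange.
Context {R : realType} {n : nat} (U U' : set 'rV[R]_n).
Variables (f : 'rV[R]_n -> 'rV[R]_n) (g g' : 'rV[R]_n -> 'M[R]_n).
Hypothesis gU : metric_on U g.
Hypothesis gU' : metric_on U' g'.
Hypothesis f_smooth : smooth_mx U f.
Hypothesis fU : forall x, U x -> U' (f x).
Hypothesis metric_pullback : forall x, U x ->
  g x = 'J f x *m g' (f x) *m ('J f x)^T.

Let U_open : open U := mo_open gU.
Local Notation D := (fun x => 'J f x).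
Local Notation B := (pullback_conn f (christoffel_mx g')).

Let D_smooth : smooth_mx U D. Proof. exact: jacobian_smooth. Qed.

Lemma jacobian_unitmx x : U x -> 'J f x \in unitmx.
Proof.
move=> Ux; have := metric_unitmx gU Ux; rewrite (metric_pullback Ux).
by rewrite !unitmx_mul => /andP[/andP[]].
Qed.

Let gauge_conn i x := partial_mx i D x + 'J f x *m B i x.

Let gauge_conn_sym i j p x : U x -> gauge_conn i x j p = gauge_conn j x i p.
Proof.
move=> Ux; rewrite [LHS]mxE [RHS]mxE (partial_jacobian_sym U_open f_smooth) //.
congr (_ + _); rewrite [LHS]mxE [RHS]mxE.
under eq_bigr do rewrite pullback_connE mulr_sumr.
rewrite exchange_big; apply: eq_bigr => r _.
rewrite pullback_connE mulr_sumr; apply: eq_bigr => q _.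
by rewrite (christoffel_mx_torsion_free gU' q r p (fU Ux)); ring.
Qed.

Let pullback_conn_metric i x : U x ->
  \sum_p 'J f x i p *: partial_mx p g' (f x) =
  B i x *m g' (f x) + g' (f x) *m (B i x)^T.
Proof.
move=> Ux; rewrite mulmx_suml linear_sum mulmx_sumr -big_split.
apply: eq_bigr => p _ /=.
rewrite (christoffel_mx_parallel gU' p (fU Ux)) scalerDr.
by rewrite -scalemxAl linearZ /= -scalemxAr.
Qed.

(* The gauge transform of the pulled-back connection is symmetric and metric,
   hence it is the Levi-Civita connection. *)
Lemma christoffel_mx_change i x : U x ->
  christoffel_mx g i x *m 'J f x = partial_mx i D x + 'J f x *m B i x.
Proof.
move=> Ux; have J_unit := jacobian_unitmx Ux.
have D_diff : differentiable_mx D x by exact: smooth_mx_differentiable Ux.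
pose A a := gauge_conn a x *m invmx ('J f x).
have AJ a : A a *m 'J f x = gauge_conn a x by rewrite /A mulmxKV.
suff <- : A i = christoffel_mx g i x by [].
apply: (christoffel_mx_unique gU Ux) => [a b k|a].
  rewrite /A [LHS]mxE [RHS]mxE; apply: eq_bigr => q _.
  by rewrite gauge_conn_sym.
have g'_diff := smooth_mx_differentiable (mo_smooth gU') (fU Ux).
have g'f_diff := differentiable_mx_comp f_smooth Ux g'_diff.
have DT_diff := differentiable_mx_tr D_diff.
rewrite (eq_partial_mx_on U_open a Ux metric_pullback).
rewrite (partial_mxM a (differentiable_mxM D_diff g'f_diff) DT_diff).
rewrite (partial_mxM a D_diff g'f_diff) partial_mx_tr.
rewrite (partial_mx_comp f_smooth a Ux g'_diff) pullback_conn_metric //.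
have -> : g x *m (A a)^T = 'J f x *m g' (f x) *m (gauge_conn a x)^T.
  by rewrite (metric_pullback Ux) -AJ (trmx_mul (A a)) !mulmxA.
have -> : (gauge_conn a x)^T =
    (partial_mx a D x)^T + (B a x)^T *m ('J f x)^T.
  by rewrite /gauge_conn linearD /= trmx_mul.
rewrite [in A a *m g x](metric_pullback Ux) !mulmxA AJ /gauge_conn.
by matrix_ring.
Qed.

Lemma curvature_endo_change x X Y : U x ->
  curvature_endo g x X Y *m 'J f x =
  'J f x *m curvature_endo g' (f x) (X *m 'J f x) (Y *m 'J f x).
Proof.
move=> Ux; have A_diff i y (Uy : U y) :
    differentiable_mx (christoffel_mx g i) y.
  exact: smooth_mx_differentiable (christoffel_mx_smooth gU i) Uy.
have A'_smooth := christoffel_mx_smooth gU'.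
have B_diff := pullback_conn_differentiable U_open f_smooth fU A'_smooth.
transitivity (\sum_i \sum_j \sum_p \sum_q
    (X ord0 i * 'J f x i p * (Y ord0 j * 'J f x j q)) *:
    ('J f x *m curvature_mx (christoffel_mx g') p q (f x))).
  rewrite /curvature_endo mulmx_suml; apply: eq_bigr => i _.
  rewrite mulmx_suml; apply: eq_bigr => j _; rewrite -scalemxAl.
  rewrite (curvature_gauge U_open A_diff B_diff D_smooth) //; last first.
    by move=> a y; exact: christoffel_mx_change.
  rewrite (curvature_pullback U_open f_smooth fU A'_smooth) // mulmx_sumr.
  rewrite scaler_sumr; apply: eq_bigr => p _.
  rewrite mulmx_sumr scaler_sumr; apply: eq_bigr => q _.
  by rewrite -scalemxAr scalerA; congr (_ *: _); ring.
rewrite /curvature_endo mulmx_sumr.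
under eq_bigr do rewrite exchange_big /=.
rewrite exchange_big; apply: eq_bigr => p _.
under eq_bigr do rewrite exchange_big /=.
rewrite exchange_big mulmx_sumr; apply: eq_bigr => q _; rewrite -scalemxAr.
rewrite [(X *m _) _ _]mxE [(Y *m _) _ _]mxE mulr_suml scaler_suml.
by apply: eq_bigr => i _; rewrite mulr_sumr scaler_suml.
Qed.

Lemma riemann_change x X Y Z W : U x -> riemann g x X Y Z W =
  riemann g' (f x) (X *m 'J f x) (Y *m 'J f x) (Z *m 'J f x) (W *m 'J f x).
Proof.
move=> Ux; rewrite !riemannE (metric_sym gU Ux) (metric_sym gU' (fU Ux)).
rewrite mxform_mull mxform_mulr (metric_pullback Ux) !mulmxA.
by rewrite curvature_endo_change.
Qed.

End ChartChange.

(** * Kähler manifolds *)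

Lemma connected_near_const (T : topologicalType) (X : Type) (f : T -> X) :
  connected [set: T] -> (forall p, \forall q \near p, f q = f p) ->
  forall p q, f p = f q.
Proof.
move=> T_connected f_near p q; pose A := [set r | f r = f p].
have A_open : open A.
  rewrite openE => r Ar; apply: filterS (f_near r) => s fs.
  by rewrite /A /= fs.
have A_closed : closed A.
  rewrite -openC openE => r nAr; apply: filterS (f_near r) => s fs As.
  by apply: nAr; rewrite /A /= -fs.
have AT : A = [set: T].
  by apply: T_connected; [exists p|exists A; rewrite ?setTI..].
by have : A q by rewrite AT.
Qed.

Lemma partial_eq0_near_const (R : realType) (n : nat) (U : set 'rV[R]_n)
    (c : 'rV[R]_n -> R) x :
  open U -> U x -> (forall y, U y -> differentiable c y) ->
  (forall k y, U y -> partial k c y = 0) -> \forall y \near x, c y = c x.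
Proof.
move=> U_open Ux c_diff c_partial.
have /nbhs_ballP[r /= r_gt0 ball_U] : nbhs x U by exact: open_nbhs_nbhs.
apply/nbhs_ballP; exists r => //= y; rewrite -ball_normE /= => xy.
pose v := y - x.
have segment_U (t : R) : 0 <= t <= 1 -> U (t *: v + x).
  move=> /andP[t0 t1]; apply: ball_U; rewrite -ball_normE /=.
  rewrite opprD addrA addrAC subrr sub0r normrN normrZ ger0_norm //.
  by apply: le_lt_trans xy; rewrite /v distrC ler_piMl.
have segment_derive (t : R) : 0 <= t <= 1 ->
    is_derive t 1 (fun s : R => c (s *: v + x)) 0.
  move=> /segment_U Ut; apply: (is_derive_eq (is_derive_line (c_diff _ Ut))).
  rewrite deriveE; last exact: c_diff.
  rewrite diff_partialE; last exact: c_diff.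
  by rewrite big1 // => i _; rewrite c_partial // mulr0.
have := @MVT _ (fun s : R => c (s *: v + x)) (fun=> 0) 0 1 ltr01.
case=> [t|| t _].
- by rewrite in_itv /= => /andP[t0 t1]; apply: segment_derive; rewrite !ltW.
- apply: derivable_within_continuous => t; rewrite in_itv /=.
  by move=> /segment_derive[].
rewrite mul0r scale1r scale0r add0r /v subrK => /eqP; rewrite subr_eq0.
by move=> /eqP.
Qed.

Section KahlerManifold.
Context {R : realType} {m : nat} (M : kahler_manifold R m).
Hypothesis m_ge2 : (2 <= m)%N.
Local Notation n := (2 * m)%N.
Local Notation G a := (metric_mx (kahler_metric M) a).
Local Notation J a := (acs_mx (kahler_J M) a).
Local Notation dom a := (chart_dom (man_chart a)).
Local Notation phi a := (chart_map (man_chart a)).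
Implicit Types (a b : man_index M) (p : M).

Let n_gt0 : (0 < n)%N. Proof. by rewrite muln_gt0 (ltnW m_ge2). Qed.

Definition chart_img a : set 'rV[R]_n := phi a @` dom a.

Lemma chart_kahler_on a : kahler_on (chart_img a) (G a) (J a).
Proof.
have posdef x : chart_img a x -> posdef_mx (G a x).
  move=> [p pa <-]; split; first exact: (Defs.metric_sym (kahler_metric M) pa).
  by move=> v v_neq0; exact: (metric_pos (kahler_metric M) pa v_neq0).
split=> [|i j|x Ux|k _ [p pa <-]].
- by split=> // [|i j]; [exact: chart_img_open|exact: metric_smooth].
- exact: acs_smooth.
- split; first exact: posdef.
    by case: Ux => p pa <-; exact: (acs_sqr (kahler_J M) pa).
  by case: Ux => p pa <-; exact: (kahler_hermitian pa).
- apply/matrixP => i l; have := kahler_parallel k i l pa.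
  rewrite /cov_deriv_endo -partial_mxE sumrB; move: (phi a p) => x.
  have entryE (P Q : 'M[R]_n) : (P - Q) i l = P i l - Q i l by rewrite !mxE.
  rewrite entryE [X in _ -> _ = X - _]mxE [X in _ -> _ = _ - X]mxE.
  under [X in _ -> _ = X - _]eq_bigr do rewrite christoffel_mxE.
  under [X in _ -> _ = _ - X]eq_bigr do rewrite christoffel_mxE mulrC.
  by move=> /eqP; rewrite addr_eq0 opprB => /eqP.
Qed.

Lemma chart_metric_on a : metric_on (chart_img a) (G a).
Proof. exact: ko_metric (chart_kahler_on a). Qed.

Definition hsc_at a x c : Prop := forall X,
  riemann (G a) x X (X *m J a x) X (X *m J a x) = c * mxform (G a x) X X ^+ 2.

Lemma open_chart_overlap a b : open (phi a @` (dom a `&` dom b)).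
Proof.
rewrite openE => _ [p [pa pb] <-].
have pU : chart_img a (phi a p) by exists p.
have near_U : nbhs (phi a p) (chart_img a).
  by apply: open_nbhs_nbhs; split=> //; exact: chart_img_open.
have near_b : nbhs (phi a p) (chart_inv (man_chart a) @^-1` dom b).
  apply: (chart_inv_cont pU); rewrite chart_mapK //.
  by apply: open_nbhs_nbhs; split=> //; exact: chart_dom_open.
apply: filterS (filterI near_U near_b) => y [[q qa <-]] /=.
by rewrite chart_mapK // => qb; exists q.
Qed.

Lemma hsc_at_change a b p c : dom a p -> dom b p ->
  hsc_at a (phi a p) c -> hsc_at b (phi b p) c.
Proof.
move=> pa pb hsc Y; pose f := transition (man_chart a) (man_chart b).
pose V := phi a @` (dom a `&` dom b).
have fE q : dom a q -> f (phi a q) = phi b q.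
  by move=> qa; rewrite /f /transition chart_mapK.
have Vp : V (phi a p) by exists p.
have VU x : V x -> chart_img a x by case=> q [qa _] <-; exists q.
have V_metric : metric_on V (G a).
  split=> [|i j s x /VU Ux|x /VU]; first exact: open_chart_overlap.
    exact: metric_smooth.
  exact: mo_posdef (chart_metric_on a) x.
have f_smooth : smooth_mx V f by move=> i k; rewrite ord1; exact: man_smooth.
have fV x : V x -> chart_img b (f x).
  by case=> q [qa qb] <-; rewrite fE //; exists q.
have pullback x : V x -> G a x = 'J f x *m G b (f x) *m ('J f x)^T.
  case=> q [qa qb] <-; rewrite fE //.
  exact: (metric_change (kahler_metric M) qa qb).
have J_unit := jacobian_unitmx V_metric pullback Vp.
have [X ->] : exists X, Y = X *m 'J f (phi a p).
  by exists (Y *m invmx ('J f (phi a p))); rewrite mulmxKV.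
have XJ : X *m 'J f (phi a p) *m J b (phi b p) =
    X *m J a (phi a p) *m 'J f (phi a p).
  by rewrite -!mulmxA (acs_change (kahler_J M) pa pb).
rewrite XJ mxform_mull mxform_mulr -(fE p pa) -(pullback _ Vp) -hsc.
by rewrite (riemann_change V_metric (chart_metric_on b) f_smooth fV pullback).
Qed.

Lemma hsc_at_near_const (c : 'rV[R]_n -> R) a x :
  (forall y, chart_img a y -> hsc_at a y (c y)) -> chart_img a x ->
  \forall y \near x, c y = c x.
Proof.
move=> hsc Ux; have gJ := chart_kahler_on a.
apply: (partial_eq0_near_const (mo_open (ko_metric gJ)) Ux).
- by move=> y; exact: (hsc_differentiable gJ hsc n_gt0).
- move=> k y; apply: (schur_kahler gJ hsc).
  by rewrite (leq_trans (_ : 3 <= 2 * 2)%N) // leq_mul2l.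
Qed.

Definition pointwise_hsc_at p c : Prop :=
  forall a, dom a p -> hsc_at a (phi a p) c.

Lemma hsc_at_pointwise a p c :
  dom a p -> hsc_at a (phi a p) c -> pointwise_hsc_at p c.
Proof. by move=> pa hsc b pb; exact: hsc_at_change hsc. Qed.

Lemma pointwise_hsc_constant (c : M -> R) : connected [set: M] ->
  (forall p, pointwise_hsc_at p (c p)) -> forall p q, c p = c q.
Proof.
move=> M_connected hsc; apply: connected_near_const => // p.
have [a pa] := man_cover p; pose c_chart y := c (chart_inv (man_chart a) y).
have hsc_chart y : chart_img a y -> hsc_at a y (c_chart y).
  by case=> q qa <-; rewrite /c_chart chart_mapK //; exact: hsc.
have Up : chart_img a (phi a p) by exists p.
have near_dom : nbhs p (dom a).
  by apply: open_nbhs_nbhs; split=> //; exact: chart_dom_open.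
have near_const : nbhs p (phi a @^-1` [set y | c_chart y = c_chart (phi a p)]).
  by apply: (chart_map_cont pa); exact: hsc_at_near_const hsc_chart Up.
apply: filterS (filterI near_dom near_const) => q [qa] /=.
by rewrite /c_chart !chart_mapK.
Qed.

Lemma exists_constant_hsc (P : R -> Prop) : connected [set: M] -> P 0 ->
  (forall a p, dom a p -> exists2 c, P c & hsc_at a (phi a p) c) ->
  exists2 c, P c & has_constant_hsc M c.
Proof.
move=> M_connected P0 hsc.
have exists_c p : exists c, P c /\ pointwise_hsc_at p c.
  have [a pa] := man_cover p; have [c Pc hsc_c] := hsc a p pa.
  by exists c; split=> //; exact: hsc_at_pointwise hsc_c.
have [c Pc] := choice exists_c.
have c_const := pointwise_hsc_constant M_connected (fun p => proj2 (Pc p)).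
have [[p0 _]|M_empty] := pselect (exists p : M, True).
  exists (c p0) => [|a p pa x g J0 X X1]; first exact: (proj1 (Pc p0)).
  by rewrite (proj2 (Pc p) a pa) /mxform X1 (c_const p p0) expr1n mulr1.
by exists 0 => // a p; case: M_empty; exists p.
Qed.

Lemma hsc_at0_flat : (forall a p, dom a p -> hsc_at a (phi a p) 0) ->
  flat (kahler_metric M).
Proof.
move=> hsc a p pa X Y Z W; have Up : chart_img a (phi a p) by exists p.
rewrite (riemann_const_hsc (chart_kahler_on a) Up (hsc a p pa)).
by rewrite !mul0r.
Qed.

Section PinchedCurvature.
Variable alpha : R.
Hypothesis alpha_le : alpha <= 3 / 2 * (m%:R ^+ 2 - 1).

Lemma kahler_tensor_hsc a p D : dom a p -> 1 <= alpha <= (dimS20 n)%:R ->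
  kahler_tensor (fun X => X *m J a (phi a p)) D ->
  (forall (E : 'M[R]_n) psi, orthonormal_frame (G a) (phi a p) E ->
    orthonormal_basisS20 psi ->
    0 <= alpha_sum alpha
      (fun i : 'I_(dimS20 n) => curv_form D (fun j => row j E) (psi i))) ->
  exists c, [/\ 0 <= c, alpha < 3 / 2 * (m%:R ^+ 2 - 1) -> c = 0 &
    forall X, D X (X *m J a (phi a p)) X (X *m J a (phi a p)) =
      c * mxform (G a (phi a p)) X X ^+ 2].
Proof.
move=> pa alphaN D_kahler sum_ge0; have Up : chart_img a (phi a p) by exists p.
have gJ := hermitian_mx_structure (ko_hermitian (chart_kahler_on a) Up).
have dimV : \dim {: 'rV[R]_n} = n by rewrite dimvf dim_matrix mul1r.
apply: (pointwise_hsc m_ge2 dimV gJ D_kahler alphaN alpha_le).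
move=> e psi e_orth psi_basis.
have -> : e = (fun j => row j (\matrix_i e i)).
  by apply/funext => j; rewrite rowK.
apply: sum_ge0 => //; apply/matrixP => i j.
by rewrite mxform_rows e_orth mxE.
Qed.

Lemma alpha_nonnegative_hsc a p : alpha_nonnegative (kahler_metric M) alpha ->
  dom a p -> exists c, [/\ 0 <= c, alpha < 3 / 2 * (m%:R ^+ 2 - 1) -> c = 0 &
    hsc_at a (phi a p) c].
Proof.
move=> [alphaN sum_ge0] pa; have Up : chart_img a (phi a p) by exists p.
apply: (kahler_tensor_hsc pa alphaN (riemann_kahler (chart_kahler_on a) Up)).
by move=> E psi E_frame; exact: (sum_ge0 a p pa E E_frame psi).
Qed.

Lemma alpha_nonpositive_hsc a p : alpha_nonpositive (kahler_metric M) alpha ->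
  dom a p -> exists c, [/\ c <= 0, alpha < 3 / 2 * (m%:R ^+ 2 - 1) -> c = 0 &
    hsc_at a (phi a p) c].
Proof.
move=> [alphaN sum_le0] pa; have Up : chart_img a (phi a p) by exists p.
have D_kahler := kahler_tensorN (riemann_kahler (chart_kahler_on a) Up).
have [E psi E_frame psi_basis|c [c_ge0 c_eq0 hsc]] :=
    kahler_tensor_hsc pa alphaN D_kahler.
  rewrite (_ : (fun i => _) = (fun i => - second_kind (G a) (phi a p) E
      (psi i) (psi i))) ?alpha_sumN ?oppr_ge0; first exact: (sum_le0 a p pa).
  apply/funext => i; rewrite /second_kind -sumrN; apply: eq_bigr => j _.
  rewrite -sumrN; apply: eq_bigr => k _; rewrite -sumrN.
  apply: eq_bigr => l _; rewrite -sumrN.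
  by apply: eq_bigr => s _; rewrite !mulNr.
exists (- c); split; first by rewrite oppr_le0.
- by move=> /c_eq0->; rewrite oppr0.
- by move=> X; rewrite mulNr -hsc opprK.
Qed.

End PinchedCurvature.
End KahlerManifold.

Theorem theorem1p2 (R : realType) (m : nat) (M : kahler_manifold R m)
    (hm : (2 <= m)%N) (hconn : connected [set: M]) :
  [/\ forall alpha : R, alpha < 3 / 2 * (m%:R ^+ 2 - 1) ->
        alpha_nonnegative (kahler_metric M) alpha -> flat (kahler_metric M),
      forall alpha : R, alpha < 3 / 2 * (m%:R ^+ 2 - 1) ->
        alpha_nonpositive (kahler_metric M) alpha -> flat (kahler_metric M),
      alpha_nonnegative (kahler_metric M) (3 / 2 * (m%:R ^+ 2 - 1)) ->
        exists2 c : R, 0 <= c & has_constant_hsc M c &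
      alpha_nonpositive (kahler_metric M) (3 / 2 * (m%:R ^+ 2 - 1)) ->
        exists2 c : R, c <= 0 & has_constant_hsc M c].
Proof.
split=> [alpha alpha_lt nonneg|alpha alpha_lt nonpos|nonneg|nonpos].
- apply: hsc_at0_flat => a p pa.
  by have [c [_ /(_ alpha_lt) <-]] :=
    alpha_nonnegative_hsc hm (ltW alpha_lt) nonneg pa.
- apply: hsc_at0_flat => a p pa.
  by have [c [_ /(_ alpha_lt) <-]] :=
    alpha_nonpositive_hsc hm (ltW alpha_lt) nonpos pa.
- apply: (exists_constant_hsc hm hconn) => // a p pa.
  have [c [c_ge0 _ hsc]] := alpha_nonnegative_hsc hm (lexx _) nonneg pa.
  by exists c.
- apply: (exists_constant_hsc hm hconn) => // a p pa.
  have [c [c_le0 _ hsc]] := alpha_nonpositive_hsc hm (lexx _) nonpos pa.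
  by exists c.
Qed.
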